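(* Let $I\subset\mathbb R$ be an open interval, let $N_0:I\to\mathbb S^2_1$ and $N_1:I\to\mathfrak{sl}(2,\mathbb R)$ be smooth with $\langle N_1,N_0\rangle=0$, and let $F:I\to SL(2,\mathbb R)$ be any smooth map with $\mathrm{Ad}_Fe_3=N_0$. Let $x_0\in I$ and put $$\beta_1=-\tfrac14\big[e_3,\mathrm{Ad}_F^{-1}N_1\big],\qquad \gamma_{-1}=-\tfrac14\big[e_3,\mathrm{Ad}_F^{-1}(N_0'-N_1)\big],\qquad \hat\alpha^\lambda=\big(F^{-1}F'\big)_{\mathfrak k}+\lambda\beta_1+\lambda^{-1}\gamma_{-1},$$ functions on $I$, where $(\cdot)_{\mathfrak k}$ denotes the $e_3$-component. Then there are an open neighbourhood $\Omega$ of the diagonal in $I\times I$ and a harmonic map $\nu:\Omega\to\mathbb S^2_1$, for the Lorentz structure in which $(x,y)$ are null coordinates, with $$\nu(x,x)=N_0(x),\qquad \nu_x(x,x)=N_1(x)\qquad(x\in I).$$ It is obtained by the DPW recipe from the potentials $\mathcal X(x)=\hat\alpha^\lambda(x)\,dx$ and $\mathcal Y(y)=\hat\alpha^\lambda(y)\,dy$ with $X(x_0)=Y(x_0)=F(x_0)$, and its extended frame $\hat F$ coincides with $X$ along the diagonal.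
   Context: On $\mathfrak{sl}(2,\mathbb R)$ let $\langle X,Y\rangle=\tfrac12\operatorname{tr}(XY)$ and $\mathbb S^2_1=\{X\in\mathfrak{sl}(2,\mathbb R):\langle X,X\rangle=1\}$. Put $e_1=\begin{pmatrix}0&-1\\1&0\end{pmatrix}$, $e_2=\begin{pmatrix}0&1\\1&0\end{pmatrix}$, $e_3=\begin{pmatrix}-1&0\\0&1\end{pmatrix}$, $\mathrm{Ad}_FX=FXF^{-1}$, $\mathfrak k=\mathbb Re_3$, $\mathfrak p=\operatorname{span}(e_1,e_2)$. A map $\nu$ into $\mathbb S^2_1$ from a domain with null coordinates $(x,y)$ is harmonic if and only if $[\nu,\nu_{xy}]=0$. Extended frames. A frame of $\nu:\Omega\to\mathbb S^2_1$ is a map $F:\Omega\to SL(2,\mathbb R)$ with $\nu=\mathrm{Ad}_Fe_3$; write $F^{-1}F_x=\beta_0+\beta_1$, $F^{-1}F_y=\gamma_0+\gamma_{-1}$ with $\beta_0,\gamma_0\in\mathfrak k$, $\beta_1,\gamma_{-1}\in\mathfrak p$. An extended frame of a harmonic $\nu$ is a $\lambda$-family $\hat F$ with $\hat F|_{\lambda=1}=F$ a frame of $\nu$ and $\hat F^{-1}d\hat F=(\beta_0+\lambda\beta_1)\,dx+(\gamma_0+\lambda^{-1}\gamma_{-1})\,dy$ for all $\lambda\neq0$. Loop groups. Let $G_\sigma$ be the group of smooth loops $\gamma(\lambda)$ in $SL(2,\mathbb C)$ satisfying the reality condition $\overline{\gamma(\bar\lambda)}=\gamma(\lambda)$ and the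 twisting condition $\gamma(-\lambda)=\mathrm{Ad}_{e_3}\gamma(\lambda)$. Let $G_\sigma^+$ (resp. $G_\sigma^-$) be the subgroup of loops extending holomorphically to the unit disc $\mathbb D$ (resp. to $\mathbb P^1\setminus\mathbb D$, with diagonal value at $\infty$), and let $G^-_{\sigma,*}\subset G^-_\sigma$ be the loops equal to $\mathrm{Id}$ at $\lambda=\infty$. The big cell $G^-_{\sigma,*}\cdot G^+_\sigma$ is open and dense, and elements of it factor uniquely (Birkhoff factorization). DPW recipe. Given the potentials, solve $X^{-1}dX=\mathcal X$ and $Y^{-1}dY=\mathcal Y$ on $I$ (for every $\lambda$) with the given initial conditions at $x_0$; on the open set of $(x,y)\in I\times I$ where $X(x)^{-1}Y(y)$ lies in the big cell, factor $X(x)^{-1}Y(y)=H_-(x,y)H_+(x,y)$ with $H_-\in G^-_{\sigma,*}$, $H_+\in G^+_\sigma$, and set $\hat F(x,y)=X(x)H_-(x,y)=Y(y)H_+(x,y)^{-1}$. The map obtained is $\nu=\mathrm{Ad}_{\hat F|_{\lambda=1}}e_3$, and $\hat F$ is its extended frame. *)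

(* Defs.v *)
From mathcomp Require Import all_boot all_order all_algebra.
From mathcomp Require Import complex.
From mathcomp Require Import all_classical all_reals all_analysis.

Set Implicit Arguments.
Unset Strict Implicit.
Unset Printing Implicit Defensive.

Import Order.TTheory GRing.Theory Num.Theory.
Import numFieldNormedType.Exports.

Local Open Scope classical_set_scope.
Local Open Scope ring_scope.
Local Open Scope complex_scope.

Section Algebra.
Variable K : comUnitRingType.

Definition mx2 (a b c d : K) : 'M[K]_2 :=
  \matrix_(i, j) if i == 0 then (if j == 0 then a else b)
                 else (if j == 0 then c else d).

Definition e1 : 'M[K]_2 := mx2 0 (-1) 1 0.
Definition e2 : 'M[K]_2 := mx2 0 1 1 0.
Definition e3 : 'M[K]_2 := mx2 (-1) 0 0 1.

Definition lie (A B : 'M[K]_2) : 'M[K]_2 := A * B - B * A.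

Definition Ad (F A : 'M[K]_2) : 'M[K]_2 := F * A * F^-1.

End Algebra.

Arguments e1 {K}.
Arguments e2 {K}.
Arguments e3 {K}.

Section Sl2R.
Variable R : realType.
Implicit Types A B : 'M[R]_2.

Definition sl2_form A B : R := 2^-1 * \tr (A * B).

Definition sl2 : set 'M[R]_2 := [set A | \tr A = 0].

Definition S21 : set 'M[R]_2 := [set A | sl2 A /\ sl2_form A A = 1].

Definition in_k A := exists c : R, A = c *: e3.
Definition in_p A := exists a b : R, A = a *: e1 + b *: e2.

(* The basis e1, e2, e3 is orthogonal for [sl2_form] and [sl2_form e3 e3 = 1],
   so the e3-component is given by pairing with e3. *)
Definition kpart A : 'M[R]_2 := sl2_form A e3 *: e3.

End Sl2R.

(* For an open set [A] of a finite-dimensional [V], [smooth A f] says that f is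
   C^oo on A: all iterated directional derivatives exist and are continuous at
   every point of A.  The values of f outside A are irrelevant. *)
Fixpoint Cn (R : realType) (V W : normedModType R) (n : nat) (A : set V)
    (f : V -> W) : Prop :=
  if n is m.+1 then
    forall v : V, (forall p, A p -> derivable f p v) /\ Cn m A ('D_v f)
  else forall p, A p -> {for p, continuous f}.

Definition smooth (R : realType) (V W : normedModType R) (A : set V)
  (f : V -> W) : Prop := forall n, Cn n A f.

Section ComplexValued.
Variable R : realType.

Definition toC (A : 'M[R]_2) : 'M[R[i]]_2 := map_mx (real_complex R) A.
Definition reM (A : 'M[R[i]]_2) : 'M[R]_2 := map_mx (@complex.Re R) A.
Definition imM (A : 'M[R[i]]_2) : 'M[R]_2 := map_mx (@complex.Im R) A.

(* Smoothness and directional derivatives in real variables of a map with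
   values in complex matrices, through real and imaginary parts. *)
Definition csmooth (V : normedModType R) (A : set V)
    (f : V -> 'M[R[i]]_2) : Prop :=
  smooth A (reM \o f) /\ smooth A (imM \o f).

Definition cderive (V : normedModType R) (f : V -> 'M[R[i]]_2) (p v : V) :
    'M[R[i]]_2 :=
  toC ('D_v (reM \o f) p) + 'i%C *: toC ('D_v (imM \o f) p).

End ComplexValued.

(* Continuous on the closed unit disc and complex differentiable on the open
   one; used with [K := R[i]]. *)
Definition holomorphic_disc (K : numFieldType) (g : K -> 'M[K]_2) : Prop :=
  {within [set z : K | `|z| <= 1], continuous g} /\
  forall z : K, `|z| < 1 -> derivable g z 1.

Section LoopGroups.
Variable R : realType.
Implicit Type g : R[i] -> 'M[R[i]]_2.

(* Only the values of g on the unit circle matter. *)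
Definition G_sigma g : Prop :=
  csmooth [set: R] (fun t : R => g (cos t +i* sin t)) /\
  forall l : R[i], `|l| = 1 ->
    [/\ \det (g l) = 1,
        map_mx conjc (g (conjc l)) = g l
      & g (- l) = Ad e3 (g l)].

(* A loop which extends to the disc is identified with its extension: the
   values of g inside the disc are those of the extension. *)
Definition G_sigma_plus g : Prop :=
  [/\ G_sigma g, holomorphic_disc g
    & forall l : R[i], `|l| <= 1 -> \det (g l) = 1].

(* g in the chart w = 1/l around infinity, with value A at infinity. *)
Definition at_infinity (A : 'M[R[i]]_2) g : R[i] -> 'M[R[i]]_2 :=
  fun w => if w == 0 then A else g w^-1.

(* As for [G_sigma_plus], g is identified with its extension to `|l| >= 1,
   here with value 1 at infinity. *)
Definition G_sigma_minus_star g : Prop :=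
  [/\ G_sigma g, holomorphic_disc (at_infinity 1 g)
    & forall l : R[i], 1 <= `|l| -> \det (g l) = 1].

End LoopGroups.

Section Frames.
Variable R : realType.
Implicit Types (Omega : set (R * R)) (p : R * R).

Definition dx (f : R * R -> 'M[R]_2) p : 'M[R]_2 := derive f p (1, 0).
Definition dy (f : R * R -> 'M[R]_2) p : 'M[R]_2 := derive f p (0, 1).

Definition harmonic_map Omega (nu : R * R -> 'M[R]_2) : Prop :=
  [/\ smooth Omega nu,
      forall p, Omega p -> S21 (nu p)
    & forall p, Omega p -> lie (nu p) (dy (dx nu) p) = 0].

Definition frame Omega (nu F : R * R -> 'M[R]_2) : Prop :=
  smooth Omega F /\
  forall p, Omega p -> \det (F p) = 1 /\ nu p = Ad (F p) e3.

Definition extended_frame Omega (nu : R * R -> 'M[R]_2)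
    (Fh : R * R -> R[i] -> 'M[R[i]]_2) : Prop :=
  exists F b0 b1 c0 c1 : R * R -> 'M[R]_2,
  [/\ frame Omega nu F,
      forall p, Omega p -> Fh p 1 = toC (F p),
      forall p, Omega p ->
        [/\ in_k (b0 p), in_p (b1 p) & (F p)^-1 * dx F p = b0 p + b1 p],
      forall p, Omega p ->
        [/\ in_k (c0 p), in_p (c1 p) & (F p)^-1 * dy F p = c0 p + c1 p]
    & forall l : R[i], l != 0 ->
        csmooth Omega (fun q => Fh q l) /\
        forall p, Omega p ->
          [/\ \det (Fh p l) = 1,
              (Fh p l)^-1 * cderive (fun q => Fh q l) p (1, 0)
                = toC (b0 p) + l *: toC (b1 p)
            & (Fh p l)^-1 * cderive (fun q => Fh q l) p (0, 1)
                = toC (c0 p) + l^-1 *: toC (c1 p)]].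

End Frames.

Section DPW.
Variable R : realType.

(* [P l x] is the coefficient of dx in the potential at parameter l. *)
Definition solves (I : set R) (x0 : R) (P : R[i] -> R -> 'M[R[i]]_2)
    (A : 'M[R]_2) (X : R -> R[i] -> 'M[R[i]]_2) : Prop :=
  forall l : R[i], l != 0 ->
    [/\ csmooth I (fun x => X x l),
        forall x, I x -> \det (X x l) = 1,
        forall x, I x -> (X x l)^-1 * cderive (fun t => X t l) x 1 = P l x
      & X x0 l = toC A].

(* [Hm] and [Hp] carry their holomorphic extensions, so that the two formulas
   for [Fh] together define it for every nonzero l. *)
Record dpw (I : set R) (x0 : R) (PX PY : R[i] -> R -> 'M[R[i]]_2)
    (X0 Y0 : 'M[R]_2) (Omega : set (R * R))
    (X Y : R -> R[i] -> 'M[R[i]]_2) (Fh : R * R -> R[i] -> 'M[R[i]]_2)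
    (nu : R * R -> 'M[R]_2) : Prop := Dpw {
  dpw_X : solves I x0 PX X0 X;
  dpw_Y : solves I x0 PY Y0 Y;
  dpw_factor : forall p, Omega p ->
    exists Hm Hp : R[i] -> 'M[R[i]]_2,
    [/\ G_sigma_minus_star Hm,
        G_sigma_plus Hp,
        forall l : R[i], `|l| = 1 -> (X p.1 l)^-1 * Y p.2 l = Hm l * Hp l,
        forall l : R[i], 1 <= `|l| -> Fh p l = X p.1 l * Hm l
      & forall l : R[i], l != 0 -> `|l| <= 1 ->
          Fh p l = Y p.2 l * (Hp l)^-1];
  dpw_map : forall p, Omega p -> toC (nu p) = Ad (Fh p 1) e3
}.

Definition beta1 (N1 F : R -> 'M[R]_2) (x : R) : 'M[R]_2 :=
  (- 4^-1) *: lie e3 (Ad (F x)^-1 (N1 x)).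

Definition gamma_m1 (N0 N1 F : R -> 'M[R]_2) (x : R) : 'M[R]_2 :=
  (- 4^-1) *: lie e3 (Ad (F x)^-1 (derive1 N0 x - N1 x)).

Definition alpha_hat (N0 N1 F : R -> 'M[R]_2) (l : R[i]) (x : R) :
    'M[R[i]]_2 :=
  toC (kpart ((F x)^-1 * derive1 F x)) + l *: toC (beta1 N1 F x)
    + l^-1 *: toC (gamma_m1 N0 N1 F x).

End DPW.

(* Main.v *)
Require Import Defs.
From mathcomp Require Import all_boot all_order all_algebra.
From mathcomp Require Import complex.
From mathcomp Require Import all_classical all_reals all_analysis.
From mathcomp Require Import ring lra.

(* In the gauge [gamma_0 = 0] the Maurer-Cartan form of the extended frame is
   [(b e3 + l beta_1(x)) dx + l^-1 gamma(x, y) dy], where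
   [beta_1 = (0, B1; B2, 0)], [gamma = (0, c1(y) e^(2 phi); c2(y) e^(-2 phi), 0)]
   and [b = phi_x].  Its flatness is the sinh-Gordon type equation
   [phi_xy = B2 c1 e^(2 phi) - B1 c2 e^(-2 phi)], to be solved with the values
   [phi = 0] and [phi_x = b0] on the diagonal; Picard iteration converges on the
   strip [|m x - m y| < eps] around the diagonal, [m] being a primitive of a bound
   of the data.  If [G] solves the x-equation with [G = 1] on the diagonal, then
   [Fhat(x, y) = X(y) G(x, y)] also solves the y-equation, by flatness.  No
   Birkhoff theorem is needed: the factors are explicit.  [H_+ = G^-1] is entire
   in [l] because the x-equation is affine in [l], and [H_-] solves, in [y] and
   with value [1] on the diagonal, the equation whose coefficient [l^-1 gamma] is
   linear in [l^-1]; so it is entire in [l^-1] and equal to [1] at [l = oo]. *)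

Set Implicit Arguments.
Unset Strict Implicit.
Unset Printing Implicit Defensive.

Import Order.TTheory GRing.Theory Num.Theory.
Import numFieldNormedType.Exports.

Local Open Scope classical_set_scope.
Local Open Scope ring_scope.
Local Open Scope complex_scope.

(** * Calculus of C^n maps *)

(** The gauge is forced by the factorization: [H_-] is the identity at l = oo, so the y-part of
    [Fhat = X H_-] has no term of order 0 in l. Flatness at order l then makes beta_1 independent of
    y. At order l^-1 it reads gamma_x = - b [e3, gamma]; as ad e3 multiplies the two off-diagonal
    entries by -2 and 2, the solutions carry the factors e^(2 phi) and e^(-2 phi) with phi_x = b.
    Order 0 is the scalar equation.

    The obstacle is uniformity. The domain must contain the whole diagonal of an interval on which
    the data may be unbounded, the solutions must be smooth on it, and the factors smooth on the
    circle and holomorphic in l. Therefore the equations are integrated along horizontal segments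
    issuing from a line x = k y + d: slope 1 makes the diagonal the initial line, slope 0 gives a
    fixed initial point and leaves y free as a parameter, for instance the angle of l on the unit
    circle. One Leibniz rule with this moving base point gives smoothness in every case; holomorphy
    in l comes from a quadratic remainder estimate. *)

Section Ck.
Context {R : realType}.

(** Directional derivability in the plane does not imply continuity, and [Cn] asks for continuity of
    the derivatives of top order only. Here it is demanded at every order, so that an induction on
    the order always has it at hand. *)
Fixpoint Ck (V W : normedModType R) (n : nat) (A : set V) (f : V -> W) : Prop :=
  (forall p, A p -> {for p, continuous f}) /\
  if n is m.+1 then
    forall v : V, (forall p, A p -> derivable f p v) /\ Ck m A ('D_v f)
  else True.

(** Over all orders together the two notions agree: continuity of a derivative of order m is read
    off from [Cn] at m. *)
Lemma smoothP (V W : normedModType R) (A : set V) (f : V -> W) :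
  smooth A f <-> forall n, Ck n A f.
Proof.
split=> [sf n|sf n]; last first.
  elim: n f {sf}(sf n) => [|n IH] f /= [cf //] df v.
  by split; [exact: (df v).1|exact/IH/(df v).2].
elim: n f sf => [|n IH] f sf /=; first by split=> //; exact: (sf 0%N).
split; first exact: (sf 0%N).
move=> v; split; first exact: ((sf 1%N) v).1.
by apply: IH => m; exact: ((sf m.+1) v).2.
Qed.

Lemma near_eq_continuous (S T : topologicalType) (f g : S -> T) p :
  {near p, f =1 g} -> {for p, continuous f} -> {for p, continuous g}.
Proof.
move=> fg cf; rewrite /prop_for /continuous_at -(nbhs_singleton fg).
apply: cvg_trans cf; apply: near_eq_cvg.
by apply: filterS fg => q ->.
Qed.

Section W.
Context {V W : normedModType R}.
Implicit Types (A : set V) (f g : V -> W).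

Lemma Ck_cont n A f : Ck n A f -> forall p, A p -> {for p, continuous f}.
Proof. by case: n => [[]|n []]. Qed.

Lemma Ck_eq n A f g : open A -> (forall p, A p -> f p = g p) ->
  Ck n A f -> Ck n A g.
Proof.
move=> oA; elim: n f g => [|n IH] f g fg [cf df];
  have nfg p : A p -> {near p, f =1 g} by
    move=> Ap; apply: filterS (open_nbhs_nbhs (conj oA Ap)) => q /fg.
  by split=> // p Ap; apply: near_eq_continuous (nfg p Ap) (cf p Ap).
split=> [p Ap|v]; first exact: near_eq_continuous (nfg p Ap) (cf p Ap).
split=> [p Ap|]; first by apply: near_eq_derivable (nfg p Ap) _; exact: (df v).1.
apply: IH (df v).2 => p Ap; exact: near_eq_derive (nfg p Ap).
Qed.

Lemma Ck_sub n A (B : set V) f : A `<=` B -> Ck n B f -> Ck n A f.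
Proof.
move=> AB; elim: n f => [|n IH] f [cf df]; first by split=> // p /AB/cf.
split=> [p /AB/cf //|v]; split=> [p /AB|]; first exact: (df v).1.
exact/IH/(df v).2.
Qed.

(** The form in which most closure properties are proved: the derivative is exhibited by a formula,
    which is then of class n by induction. *)
Lemma Ck_build n A f (df : V -> V -> W) : open A ->
  (forall p, A p -> {for p, continuous f}) ->
  (forall v p, A p -> is_derive p v f (df v p)) ->
  (forall v, Ck n A (df v)) -> Ck n.+1 A f.
Proof.
move=> oA cf hd hdf; split=> // v; split=> [p Ap|]; first by case: (hd v p Ap).
by apply: Ck_eq (hdf v) => // p Ap; case: (hd v p Ap).
Qed.

Lemma Ck_der n A f v : Ck n.+1 A f -> Ck n A ('D_v f).
Proof. by case=> _ /(_ v)[]. Qed.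

Lemma Ck_is_derive n A f v p : Ck n.+1 A f -> A p -> is_derive p v f ('D_v f p).
Proof. by case=> _ /(_ v)[df _] /df /derivableP. Qed.

Lemma Ck_pred n A f : Ck n.+1 A f -> Ck n A f.
Proof.
elim: n f => [|n IH] f []; first by move=> cf _; split.
by move=> cf df; split=> // v; split; [exact: (df v).1|exact/IH/(df v).2].
Qed.

Lemma Ck_cst n A (c : W) : open A -> Ck n A (fun=> c).
Proof.
move=> oA; elim: n c => [|n IH] c.
  by split=> // p _; exact: cvg_cst.
by apply: (Ck_build (df := fun _ _ => 0)) => // p _; exact: cvg_cst.
Qed.

Lemma CkD n A f g : open A -> Ck n A f -> Ck n A g -> Ck n A (fun p => f p + g p).
Proof.
move=> oA; elim: n f g => [|n IH] f g hf hg.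
  by split=> // p Ap; apply: cvgD; apply: Ck_cont hf _ Ap || apply: Ck_cont hg _ Ap.
apply: (Ck_build (df := fun v p => 'D_v f p + 'D_v g p)) => //.
- by move=> p Ap; apply: cvgD; [apply: Ck_cont hf _ Ap|apply: Ck_cont hg _ Ap].
- move=> v p Ap; apply: is_deriveD; [exact: Ck_is_derive hf Ap|exact: Ck_is_derive hg Ap].
- by move=> v; apply: IH; exact: Ck_der.
Qed.

End W.

Section comp.
Context {V' V W : normedModType R}.

(* A directional derivative of [f] along an affine map is a directional
   derivative of [f], so no differentiability of [f] is needed here. *)
Lemma Ck_affine n (A : set V) (f : V -> W) (L : V' -> V) (DL : V' -> V) :
  continuous L -> (forall h p v, L (h *: v + p) = h *: DL v + L p) ->
  Ck n A f -> Ck n (L @^-1` A) (f \o L).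
Proof.
move=> cL hL; elim: n f => [|n IH] f [cf df].
  by split=> // p Ap; apply: continuous_comp; [exact: cL|exact: cf].
have E v p : (fun h : R => h^-1 *: ((f \o L \o shift p) (h *: v) - (f \o L) p))
   = (fun h : R => h^-1 *: ((f \o shift (L p)) (h *: DL v) - f (L p))).
  by apply/funext => h /=; rewrite hL.
split=> [p Ap|v]; first by apply: continuous_comp; [exact: cL|exact: cf].
split=> [p Ap|]; first by rewrite /derivable E; exact: ((df _).1 _ Ap).
have -> : 'D_v (f \o L) = 'D_(DL v) f \o L.
  by apply/funext => p; rewrite /derive E.
exact/IH/(df _).2.
Qed.
End comp.

Section scalar.
Context {V : normedModType R}.
Implicit Types (A : set V) (f g : V -> R).

Lemma CkM n A f g : open A -> Ck n A f -> Ck n A g -> Ck n A (fun p => f p * g p).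
Proof.
move=> oA; elim: n f g => [|n IH] f g hf hg.
  by split=> // p Ap; apply: cvgM; [apply: Ck_cont hf _ Ap|apply: Ck_cont hg _ Ap].
apply: (Ck_build (df := fun v p => f p * 'D_v g p + g p * 'D_v f p)) => //.
- by move=> p Ap; apply: cvgM; [apply: Ck_cont hf _ Ap|apply: Ck_cont hg _ Ap].
- move=> v p Ap; apply: is_deriveM; [exact: Ck_is_derive hf Ap|exact: Ck_is_derive hg Ap].
- by move=> v; apply: CkD => //; apply: IH => //; (exact: Ck_der || exact: Ck_pred).
Qed.

Lemma CkN n A f : open A -> Ck n A f -> Ck n A (fun p => - f p).
Proof.
move=> oA hf; apply: (@Ck_eq _ _ _ _ (fun p => -1 * f p)) => //.
  by move=> p _; rewrite mulN1r.
by apply: CkM => //; exact: Ck_cst.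
Qed.

Lemma CkB n A f g : open A -> Ck n A f -> Ck n A g -> Ck n A (fun p => f p - g p).
Proof. by move=> oA hf hg; apply: CkD => //; apply: CkN. Qed.

Lemma Ck_sum n A (I : Type) (r : seq I) (P : pred I) (F : I -> V -> R) : open A ->
  (forall i, Ck n A (F i)) -> Ck n A (fun p => \sum_(i <- r | P i) F i p).
Proof.
move=> oA hF; elim: r => [|i r IH].
  by under eq_fun do rewrite big_nil; exact: Ck_cst.
under eq_fun do rewrite big_cons.
by case: (P i) => //; apply: CkD.
Qed.

(** On the line through [p] with direction [v] this is the chain rule of one variable. *)
Lemma is_derive_chain (g : R -> R) f p v a b :
  is_derive (f p) (1 : R) g a -> is_derive p v f b ->
  is_derive p v (g \o f) (a * b).
Proof.
move=> hg [df <-].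
have E (F : V -> R) : (fun h : R => h^-1 *: ((F \o shift p) (h *: v) - F p))
  = (fun h : R => h^-1 *: (((fun h => F (h *: v + p)) \o shift 0) (h *: 1) - (fun h => F (h *: v + p)) 0)).
  apply/funext => h /=; rewrite scale0r add0r addr0; congr (_ *: (F _ - _)).
  by rewrite [h *: 1]mulr1.
have d1 : is_derive (0 : R) (1 : R) (fun h => f (h *: v + p)) ('D_v f p).
  split; first by move: df; rewrite /derivable E.
  by rewrite /derive [in RHS]E.
have hg' : is_derive ((fun h => f (h *: v + p)) 0) (1 : R) g a.
  by rewrite scale0r add0r.
have [d2 d2E] := is_derive1_comp hg' d1.
split; first by rewrite /derivable E.
by rewrite -d2E /derive E.
Qed.

Lemma Ck_comp n A f (g : R -> R) : open A ->
  Ck n setT g -> Ck n A f -> Ck n A (g \o f).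
Proof.
move=> oA; elim: n f g => [|n IH] f g hg hf.
  split=> // p Ap; apply: continuous_comp; first exact: Ck_cont hf _ Ap.
  exact: Ck_cont hg _ _.
apply: (Ck_build (df := fun v p => ('D_1 g \o f) p * 'D_v f p)) => //.
- move=> p Ap; apply: continuous_comp; first exact: Ck_cont hf _ Ap.
  exact: Ck_cont hg _ _.
- move=> v p Ap; apply: is_derive_chain; last exact: Ck_is_derive hf Ap.
  exact: Ck_is_derive hg _.
- move=> v; apply: CkM => //; last exact: Ck_der.
  by apply: IH; [exact: Ck_der|exact: Ck_pred].
Qed.

End scalar.

Section mx.
Context {V : normedModType R} {m k : nat}.
Implicit Types (A : set V) (f : V -> 'M[R]_(m, k)).

Lemma is_derive_mxP f p v (D : 'M[R]_(m, k)) :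
  is_derive p v f D <-> forall i j, is_derive p v (fun q => f q i j) (D i j).
Proof.
split=> [[df <-] i j|hd].
  split; first by move/derivable_mxP : df.
  by rewrite derive_mx // mxE.
have df : derivable f p v by apply/derivable_mxP => i j; case: (hd i j).
split=> //; rewrite derive_mx //; apply/matrixP => i j; rewrite mxE.
by case: (hd i j).
Qed.

Lemma continuous_mxP f p :
  {for p, continuous f} <-> forall i j, {for p, continuous (fun q => f q i j)}.
Proof.
split=> [cf i j|cf].
  by apply: (@continuous_comp _ _ _ f (fun M : 'M[R]_(m, k) => M i j)) => //;
    exact: coord_continuous.
apply/cvgrPdist_le => e e0; near=> q.
rewrite [leLHS]/Num.Def.normr/= mx_normrE (bigmax_le _ (ltW e0)) //= => -[i j] _ /=.
rewrite !mxE; move: (i) (j); near: q.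
apply: filter_forall => i'; apply: filter_forall => j'.
exact: ((cvgrPdist_le _ _).1 (cf i' j')).
Unshelve. all: by end_near. Qed.

Lemma Ck_mxP n A f : open A ->
  Ck n A f <-> forall i j, Ck n A (fun q => f q i j).
Proof.
move=> oA; split.
  elim: n f => [|n IH] f hf i j.
    split=> // p Ap; move: i j; apply/continuous_mxP; exact: Ck_cont hf _ Ap.
  apply: (Ck_build (df := fun v p => 'D_v f p i j)) => //.
  - move=> p Ap; move: i j; apply/continuous_mxP; exact: Ck_cont hf _ Ap.
  - move=> v p Ap; move: i j; apply/is_derive_mxP; exact: Ck_is_derive hf Ap.
  - by move=> v; apply: IH; exact: Ck_der.
elim: n f => [|n IH] f hf.
  split=> // p Ap; apply/continuous_mxP => i j; exact: Ck_cont (hf i j) _ Ap.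
apply: (Ck_build (df := fun v p => \matrix_(i, j) 'D_v (fun q => f q i j) p)) => //.
- move=> p Ap; apply/continuous_mxP => i j; exact: Ck_cont (hf i j) _ Ap.
- move=> v p Ap; apply/is_derive_mxP => i j; rewrite mxE; exact: Ck_is_derive (hf i j) Ap.
- move=> v; apply: IH => i j; under eq_fun do rewrite mxE.
  exact: Ck_der.
Qed.

End mx.

Lemma Ck_mulmx (V : normedModType R) (a b c n : nat) (A : set V)
    (f : V -> 'M[R]_(a, b)) (g : V -> 'M[R]_(b, c)) : open A ->
  Ck n A f -> Ck n A g -> Ck n A (fun p => f p *m g p).
Proof.
move=> oA /(Ck_mxP _ _ oA) hf /(Ck_mxP _ _ oA) hg; apply/(Ck_mxP _ _ oA) => i j.
under eq_fun do rewrite mxE.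
by apply: Ck_sum => // l; apply: CkM.
Qed.

End Ck.

(** * Oriented integrals with parameters *)

Section seg.
Context {R : realType}.
Implicit Types (a b c s x : R) (f g df dg : R -> R).

(** An unordered closed segment: the domain extends to both sides of the base line, so either order
    of the end points occurs. *)
Definition seg a b s := (a <= s <= b) || (b <= s <= a).

Lemma seg_sym a b s : seg a b s = seg b a s.
Proof. by rewrite /seg orbC. Qed.

Lemma seg_l a b : seg a b a.
Proof. by rewrite /seg !lexx /= andbT; case: (leP a b) => // /ltW. Qed.

Lemma seg_r a b : seg a b b.
Proof. by rewrite seg_sym seg_l. Qed.

Lemma seg_sub a b x y s : seg a b x -> seg a b y -> seg x y s -> seg a b s.
Proof. rewrite /seg; lra. Qed.

Lemma seg_cat a b c s : seg a c s -> seg a b s || seg b c s.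
Proof. rewrite /seg; lra. Qed.

Lemma seg_dist a b s : seg a b s -> `|s - a| <= `|b - a|.
Proof.
move=> /orP[]/andP[h1 h2].
  by rewrite !ger0_norm; lra.
by rewrite !ler0_norm; lra.
Qed.

Lemma is_derive_cont f x d : is_derive x (1 : R) f d -> {for x, continuous f}.
Proof. by move=> [df _]; exact/differentiable_continuous/derivable1_diffP. Qed.

Lemma mvt_seg f df a b : (forall s, seg a b s -> is_derive s (1 : R) f (df s)) ->
  exists2 s, seg a b s & f b - f a = df s * (b - a).
Proof.
wlog ab : a b / a <= b => [W hf|hf].
  case: (leP a b) => [/W|/ltW/W]; first exact.
  case=> [s|s sba E]; first by rewrite seg_sym; exact: hf.
  by exists s; [rewrite seg_sym|lra].
have [s|s|s sab E] := @MVT_segment _ f df _ _ ab.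
- by rewrite in_itv /= => /andP[h1 h2]; apply: hf; rewrite /seg (ltW h1) (ltW h2).
- apply: continuous_in_subspaceT => t; rewrite inE /= in_itv /= => h.
  by apply: (@is_derive_cont _ _ (df t)); apply: hf; rewrite /seg h.
- by exists s => //; move: sab; rewrite in_itv /seg /= => ->.
Qed.

Lemma seg_cst f a b : (forall s, seg a b s -> is_derive s (1 : R) f 0) -> f b = f a.
Proof. by move=> /mvt_seg[s _]; lra. Qed.

(** [g + f] and [g - f] have nonnegative derivatives, so their increments have the sign of [b - a];
    this covers both orientations. *)
Lemma seg_le f g df dg a b :
  (forall s, seg a b s -> is_derive s (1 : R) f (df s)) ->
  (forall s, seg a b s -> is_derive s (1 : R) g (dg s)) ->
  (forall s, seg a b s -> `|df s| <= dg s) ->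
  `|f b - f a| <= `|g b - g a|.
Proof.
move=> hf hg h.
have [s1 s1s E1] := @mvt_seg (g + f) (fun s => dg s + df s) a b
  (fun s ss => is_deriveD (hg s ss) (hf s ss)).
have [s2 s2s E2] := @mvt_seg (g - f) (fun s => dg s - df s) a b
  (fun s ss => is_deriveB (hg s ss) (hf s ss)).
have := h _ s1s; rewrite ler_norml => /andP[h1 h2].
have := h _ s2s; rewrite ler_norml => /andP[h3 h4].
rewrite /= -![(_ + _) _]/(_ + _) -![(- _) _]/(- _) in E1 E2.
case: (leP a b) => ab.
  have e1 : 0 <= (dg s1 + df s1) * (b - a) by apply: mulr_ge0; lra.
  have e2 : 0 <= (dg s2 - df s2) * (b - a) by apply: mulr_ge0; lra.
  by rewrite ler_norml; have := ler_norm (g b - g a); lra.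
have e1 : (dg s1 + df s1) * (b - a) <= 0 by apply: mulr_ge0_le0; lra.
have e2 : (dg s2 - df s2) * (b - a) <= 0 by apply: mulr_ge0_le0; lra.
by rewrite ler_norml; have := ler_norm (g a - g b); rewrite distrC; lra.
Qed.

Lemma seg_mono f df x y s : (forall t, seg x y t -> is_derive t (1 : R) f (df t)) ->
  (forall t, seg x y t -> 0 <= df t) -> seg x y s -> `|f s - f x| <= `|f y - f x|.
Proof.
move=> hf h0 ss.
have [t tt E1] := @mvt_seg f df x s (fun t tt => hf t (seg_sub (seg_l _ _) ss tt)).
have [u uu E2] := @mvt_seg f df s y (fun t tt => hf t (seg_sub ss (seg_r _ _) tt)).
have dt : 0 <= df t by apply: h0; exact: seg_sub (seg_l _ _) ss tt.
have du : 0 <= df u by apply: h0; exact: seg_sub ss (seg_r _ _) uu.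
move: ss => /orP[] /andP[h1 h2].
  have k1 : 0 <= df t * (s - x) by rewrite mulr_ge0 //; lra.
  have k2 : 0 <= df u * (y - s) by rewrite mulr_ge0 //; lra.
  by rewrite !ger0_norm; lra.
have k1 : df t * (s - x) <= 0 by rewrite mulr_ge0_le0 //; lra.
have k2 : df u * (y - s) <= 0 by rewrite mulr_ge0_le0 //; lra.
by rewrite !ler0_norm; lra.
Qed.

End seg.

Section oint.
Context {R : realType}.
Notation mu := (@lebesgue_measure R).
Implicit Types (a b c s x : R) (f g : R -> R) (S : set R).

(* One of the two integrals is over an empty set or a point. *)
Definition oint f a b : R :=
  (\int[mu]_(t in `[a, b]) f t)%R - (\int[mu]_(t in `[b, a]) f t)%R.

Lemma oint_id f a : oint f a a = 0.
Proof. by rewrite /oint subrr. Qed.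

Lemma eq_oint f g a b : (forall s, seg a b s -> f s = g s) ->
  oint f a b = oint g a b.
Proof.
move=> fg; rewrite /oint; congr (_ - _); apply: eq_Rintegral => s;
  by rewrite inE /= in_itv /= => h; apply: fg; rewrite /seg h ?orbT.
Qed.

(** The fundamental theorem is applied with a base point to the left of everything: [a] and [x] are
    enclosed in an interval [[lo, hi]] contained in [S], and [oint f a] is a difference of two
    integrals from [lo], whatever the order of [a] and [x]. *)
Lemma oint_derive S f a x : open S -> (forall s, S s -> {for s, continuous f}) ->
  (forall s, seg a x s -> S s) -> is_derive x (1 : R) (oint f a) (f x).
Proof.
move=> oS cf sS.
have nb y : seg a x y -> exists2 e, 0 < e & forall s, `|s - y| <= e -> S s.
  move=> /sS Sy; have /nbhs_ballP[e /= e0 eS] := open_nbhs_nbhs (conj oS Sy).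
  exists (e / 2); first by rewrite divr_gt0.
  move=> s sy; apply: eS; rewrite /ball /= distrC (le_lt_trans sy) //.
  by rewrite ltr_pdivrMr // ltr_pMr // ltr1n.
have [e1 e10 h1] := nb a (seg_l _ _); have [e2 e20 h2] := nb x (seg_r _ _).
pose lo := Num.min (a - e1) (x - e2); pose hi := Num.max (a + e1) (x + e2).
have lohi s : lo <= s <= hi -> S s.
  rewrite /lo /hi ge_min le_max => /andP[/orP l /orP r].
  case sax : (seg a x s); first exact: sS.
  case ea : (`|s - a| <= e1); first exact: h1.
  case ex : (`|s - x| <= e2); first exact: h2.
  move: ea ex sax; rewrite /seg !ler_norml; lra.
have la : lo < a by rewrite /lo gt_min; apply/orP; left; lra.
have lx : lo < x by rewrite /lo gt_min; apply/orP; right; lra.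
have ah : a < hi by rewrite /hi lt_max; apply/orP; left; lra.
have xh : x < hi by rewrite /hi lt_max; apply/orP; right; lra.
have intf : mu.-integrable `[lo, hi] (EFin \o f).
  apply: continuous_compact_integrable; first exact: segment_compact.
  apply: continuous_in_subspaceT => t; rewrite inE /= in_itv /= => h.
  exact/cf/lohi.
pose F t := (\int[mu]_(u in `[lo, t]) f u)%R.
have [dF FE] := continuous_FTC1_closed xh intf lx (cf x (sS x (seg_r _ _))).
have ge u t : lo < u -> u <= t -> t <= hi -> oint f u t = F t - F u.
  move=> lu ut th; rewrite /oint.
  have -> : (\int[mu]_(v in `[t, u]) f v = 0)%R.
    move: ut; rewrite le_eqVlt => /predU1P[->|ut].
      by rewrite set_itv1 Rintegral_set1.
    by rewrite set_itv_ge ?Rintegral_set0 // bnd_simp -ltNge.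
  have int2 : mu.-integrable `[lo, t] (EFin \o f).
    by apply: integrableS intf => //; apply: subset_itvl; rewrite bnd_simp.
  rewrite subr0 /F Rintegral_itvB ?bnd_simp //; last exact: ltW.
  rewrite Rintegral_itv_obnd_cbnd //.
  apply: integrableS int2 => //; apply: subset_itvr; rewrite bnd_simp.
  exact: ltW.
have oF t : lo < t -> t < hi -> oint f a t = F t - F a.
  move=> lt th; case: (leP a t) => [at_|/ltW ta]; first by rewrite ge // ltW.
  have -> : oint f a t = - oint f t a by rewrite /oint opprB.
  by rewrite ge ?opprB // ltW.
apply: (@near_eq_is_derive _ _ _ (fun t => F t - F a)).
  near=> t; rewrite oF //; near: t; [exact: lt_nbhsr|exact: lt_nbhsl].
rewrite -[f x]subr0; apply: is_deriveB; rewrite /F.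
by split; [exact: dF|rewrite -derive1E; exact: FE].
Unshelve. all: by end_near. Qed.

(** Two primitives on a segment differ by a constant. Additivity, subtraction and finite sums are
    read off from this rule, without going back to the Lebesgue integral. *)
Lemma oint_primitive S f F a b : open S ->
  (forall s, S s -> {for s, continuous f}) -> (forall s, seg a b s -> S s) ->
  (forall s, seg a b s -> is_derive s (1 : R) F (f s)) ->
  oint f a b = F b - F a.
Proof.
move=> oS cf sS hF.
have h : (oint f a - F) b = (oint f a - F) a.
  apply: seg_cst => s sab; rewrite -(subrr (f s)); apply: is_deriveB (hF s sab).
  apply: oint_derive oS cf _ => t tas; apply: sS; exact: seg_sub (seg_l _ _) sab tas.
by move: h; rewrite -![(_ - _) _]/(_ - _) oint_id; lra.
Qed.

Lemma oint_cat S f a b c : open S -> (forall s, S s -> {for s, continuous f}) ->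
  (forall s, seg a b s -> S s) -> (forall s, seg b c s -> S s) ->
  oint f a c = oint f a b + oint f b c.
Proof.
move=> oS cf s1 s2; suff /(@oint_primitive S f (oint f a) b c oS cf s2) -> : forall s, seg b c s ->
    is_derive s (1 : R) (oint f a) (f s) by lra.
move=> s sbc; apply: oint_derive oS cf _ => t /(@seg_cat _ _ b _ _)/orP[/s1//|h].
apply: s2; exact: seg_sub (seg_l _ _) sbc h.
Qed.

(** With [g] a multiple of [m], the integral is measured in the same unit as the width of the
    strip. *)
Lemma oint_norm_le S f g dg a b : open S ->
  (forall s, S s -> {for s, continuous f}) -> (forall s, seg a b s -> S s) ->
  (forall s, seg a b s -> is_derive s (1 : R) g (dg s)) ->
  (forall s, seg a b s -> `|f s| <= dg s) -> `|oint f a b| <= `|g b - g a|.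
Proof.
move=> oS cf sS hg h; rewrite -[oint f a b]subr0 -(oint_id f a).
apply: (seg_le _ hg h) => s sab.
apply: oint_derive oS cf _ => t h'; apply: sS; exact: seg_sub (seg_l _ _) sab h'.
Qed.

Lemma oint_norm_cst S f M a b : open S ->
  (forall s, S s -> {for s, continuous f}) -> (forall s, seg a b s -> S s) ->
  (forall s, seg a b s -> `|f s| <= M) -> `|oint f a b| <= M * `|b - a|.
Proof.
move=> oS cf sS h; have M0 : 0 <= M by rewrite (le_trans _ (h a (seg_l _ _))).
rewrite -[X in X * _](ger0_norm M0) -normrM mulrBr.
apply: (oint_norm_le (g := fun x => M * x) (dg := fun=> M) oS cf sS) => // s _.
by apply: is_derive_eq (is_deriveZ M (is_derive_id s 1)) _; exact: mulr1.
Qed.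

Lemma ointB S f g a b : open S -> (forall s, S s -> {for s, continuous f}) ->
  (forall s, S s -> {for s, continuous g}) -> (forall s, seg a b s -> S s) ->
  oint (fun s => f s - g s) a b = oint f a b - oint g a b.
Proof.
move=> oS cf cg sS.
have cfg s : S s -> {for s, continuous (fun s => f s - g s)}.
  by move=> Ss; apply: cvgB; [exact: cf|exact: cg].
suff /(oint_primitive oS cfg sS) -> : forall s, seg a b s ->
    is_derive s (1 : R) (oint f a - oint g a) (f s - g s).
  by rewrite -![(_ - _) _]/(_ - _) !oint_id !subr0.
move=> s sab; have h t : seg a s t -> S t.
  by move=> h'; apply: sS; exact: seg_sub (seg_l _ _) sab h'.
by apply: is_deriveB; exact: oint_derive h.
Qed.

Lemma oint_sum S (I : Type) (r : seq I) (F : I -> R -> R) a b : open S ->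
  (forall i s, S s -> {for s, continuous (F i)}) -> (forall s, seg a b s -> S s) ->
  oint (fun s => \sum_(i <- r) F i s) a b = \sum_(i <- r) oint (F i) a b.
Proof.
move=> oS cF sS.
have cs s : S s -> {for s, continuous (fun s => \sum_(i <- r) F i s)}.
  move=> Ss; rewrite /prop_for /continuous_at.
  by apply: cvg_big => [|i _]; [exact: add_continuous|exact: cF].
suff h s : seg a b s -> is_derive s (1 : R) (fun s => \sum_(i <- r) oint (F i) a s) (\sum_(i <- r) F i s).
  rewrite (oint_primitive oS cs sS h) -sumrB.
  by apply: eq_bigr => i _; rewrite oint_id subr0.
move=> ss; elim: r {cs} => [|i r IH].
  under eq_fun do rewrite big_nil; rewrite big_nil; exact: is_derive_cst.
under eq_fun do rewrite big_cons; rewrite big_cons; apply: is_deriveD IH.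
apply: (oint_derive oS (cF i)) => t tt; apply: sS; exact: seg_sub (seg_l _ _) ss tt.
Qed.

End oint.

(** * Partial derivatives in the plane *)

Section plane.
Context {R : realType}.
Implicit Types (a b s t x y h : R) (p : R * R) (f g u : R * R -> R) (A : set (R * R)).

Lemma box_nbhs x y (P : R * R -> Prop) : (\forall p \near (x, y), P p) <->
  exists2 d, 0 < d & forall s t, `|s - x| < d -> `|t - y| < d -> P (s, t).
Proof.
split=> [/nbhs_ballP[d /= d0 dP]|[d d0 dP]].
  by exists d => // s t sx ty; apply: dP; split; rewrite /ball /= distrC.
apply/nbhs_ballP; exists d => //= -[s t] [/= sx ty].
by apply: dP; rewrite distrC.
Qed.

Lemma cont_box f x y : {for (x, y), continuous f} <-> forall e, 0 < e ->
  exists2 d, 0 < d & forall s t, `|s - x| < d -> `|t - y| < d ->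
    `|f (s, t) - f (x, y)| < e.
Proof.
split=> [cf e e0|h].
  have /cvgrPdist_lt/(_ e e0) := cf.
  move=> /box_nbhs[d d0 dP]; exists d => // s t sx ty.
  by rewrite distrC; exact: dP.
apply/cvgrPdist_lt => e e0; apply/box_nbhs; have [d d0 dP] := h e e0.
by exists d => // s t sx ty; rewrite distrC; exact: dP.
Qed.

Lemma is_derive_ball (V : normedModType R) (F : V -> R) (q v : V) D : is_derive q v F D <->
  forall e, 0 < e -> exists2 d, 0 < d & forall h, h != 0 -> `|h| < d ->
    `|h^-1 * (F (h *: v + q) - F q) - D| <= e.
Proof.
split=> [[df <-] e e0|hd].
  have /cvgrPdist_le/(_ e e0)/nbhs_ballP[d /= d0 dP] : derivable F q v by [].
  exists d => // h h0 hd; rewrite distrC; apply: dP => //.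
  by rewrite /ball /= sub0r normrN.
have cD : h^-1 *: ((F \o shift q) (h *: v) - F q) @[h --> 0^'] --> D.
  apply/cvgrPdist_le => e e0; have [d d0 dP] := hd e e0.
  apply/nbhs_ballP; exists d => //= h; rewrite /ball /= sub0r normrN => hd' h0.
  by rewrite distrC; exact: dP.
by split; [apply/cvg_ex; exists D|exact: cvg_lim cD].
Qed.

Lemma is_derive1_ball (F : R -> R) x D : is_derive x (1 : R) F D <->
  forall e, 0 < e -> exists2 d, 0 < d & forall h, h != 0 -> `|h| < d ->
    `|h^-1 * (F (x + h) - F x) - D| <= e.
Proof.
split=> [/is_derive_ball hd|hd]; [|apply/is_derive_ball];
  move=> e /hd[d d0 dP]; exists d => // h h0 /(dP h h0);
  by rewrite [h *: 1]mulr1 [h + x]addrC.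
Qed.

Lemma shift_fst h x y : h *: (1, 0) + (x, y) = (h *: 1 + x, y) :> R * R.
Proof. by rewrite -[LHS]/(h *: 1 + x, h * 0 + y) mulr0 add0r. Qed.

Lemma shift_snd h x y : h *: (0, 1) + (x, y) = (x, h *: 1 + y) :> R * R.
Proof. by rewrite -[LHS]/(h * 0 + x, h *: 1 + y) mulr0 add0r. Qed.

Lemma is_derive_fst f x y D :
  is_derive (x, y) (1, 0) f D <-> is_derive x (1 : R) (fun s => f (s, y)) D.
Proof.
split=> /is_derive_ball hd; apply/is_derive_ball => e /hd[d d0 dP];
  exists d => // h h0 /(dP h h0); by rewrite shift_fst.
Qed.

Lemma is_derive_snd f x y D :
  is_derive (x, y) (0, 1) f D <-> is_derive y (1 : R) (fun t => f (x, t)) D.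
Proof.
split=> /is_derive_ball hd; apply/is_derive_ball => e /hd[d d0 dP];
  exists d => // h h0 /(dP h h0); by rewrite shift_snd.
Qed.

Lemma continuous_pairl y : continuous (fun s : R => (s, y)).
Proof. by move=> s; apply: (@cvg_pair _ _ _ _ (nbhs s) (nbhs y));
  [exact: cvg_id|exact: cvg_cst]. Qed.

Lemma continuous_pairr x : continuous (fun t : R => (x, t)).
Proof. by move=> s; apply: (@cvg_pair _ _ _ _ (nbhs x) (nbhs s));
  [exact: cvg_cst|exact: cvg_id]. Qed.

Lemma open_fst A y : open A -> open [set s | A (s, y)].
Proof. by apply: open_comp => s _; exact: continuous_pairl. Qed.

Lemma open_snd A x : open A -> open [set t | A (x, t)].
Proof. by apply: open_comp => s _; exact: continuous_pairr. Qed.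

Lemma cont_fst (T : topologicalType) (F : R * R -> T) s y :
  {for (s, y), continuous F} -> {for s, continuous (fun s => F (s, y))}.
Proof.
by apply: (@continuous_comp _ _ _ (fun s => (s, y)) F); exact: continuous_pairl.
Qed.

(** The increment is taken along one vertical and one horizontal side of a box, with the mean value
    theorem on each; both intermediate points are close to [p], where the partials are nearly
    constant. *)
Lemma is_derive_partials A f f1 f2 p v : open A -> A p ->
  (forall q, A q -> is_derive q.1 (1 : R) (fun s => f (s, q.2)) (f1 q)) ->
  (forall q, A q -> is_derive q.2 (1 : R) (fun t => f (q.1, t)) (f2 q)) ->
  {for p, continuous f1} -> {for p, continuous f2} ->
  is_derive p v f (v.1 * f1 p + v.2 * f2 p).
Proof.
case: p v => [x y] [v1 v2] oA Ap h1 h2 c1 c2 /=; apply/is_derive_ball => e e0.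
(* The summand 1 keeps the denominator positive when [v] is zero. *)
pose M := `|v1| + `|v2| + 1.
have M0 : 0 < M by rewrite /M; have := normr_ge0 v1; have := normr_ge0 v2; lra.
have eM : 0 < e / M by rewrite divr_gt0.
have [d1 d10 D1] := (cont_box f1 x y).1 c1 _ eM.
have [d2 d20 D2] := (cont_box f2 x y).1 c2 _ eM.
have [d3 d30 D3] := (box_nbhs x y A).1 (open_nbhs_nbhs (conj oA Ap)).
pose d := Num.min d1 (Num.min d2 d3).
have d0 : 0 < d by rewrite /d !lt_min d10 d20 d30.
exists (d / M); first by rewrite divr_gt0.
move=> h h0; rewrite ltr_pdivlMr // => hM.
have b1 : `|h * v1| < d.
  rewrite normrM (le_lt_trans _ hM) // ler_wpM2l //.
  by rewrite /M; have := normr_ge0 v2; lra.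
have b2 : `|h * v2| < d.
  rewrite normrM (le_lt_trans _ hM) // ler_wpM2l //.
  by rewrite /M; have := normr_ge0 v1; lra.
have box s t : seg x (h * v1 + x) s -> seg y (h * v2 + y) t ->
   [/\ A (s, t), `|f1 (s, t) - f1 (x, y)| < e / M
     & `|f2 (s, t) - f2 (x, y)| < e / M].
  move=> /seg_dist + /seg_dist; rewrite !addrK => sx ty.
  have sd := le_lt_trans sx b1; have td := le_lt_trans ty b2.
  move: sd td; rewrite /d !lt_min => /and3P[? ? ?] /and3P[? ? ?].
  by split; [exact: D3|exact: D1|exact: D2].
have [s ss E1] := @mvt_seg _ (fun s => f (s, h * v2 + y)) (fun s => f1 (s, h * v2 + y))
  x (h * v1 + x) (fun s ss => h1 _ (let: And3 A0 _ _ := box s _ ss (seg_r _ _) in A0)).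
have [t tt E2] := @mvt_seg _ (fun t => f (x, t)) (fun t => f2 (x, t))
  y (h * v2 + y) (fun t tt => h2 _ (let: And3 A0 _ _ := box _ t (seg_l _ _) tt in A0)).
have [_ B1 _] := box _ _ ss (seg_r _ _); have [_ _ B2] := box _ _ (seg_l _ _) tt.
have -> : h *: (v1, v2) + (x, y) = (h * v1 + x, h * v2 + y) by [].
rewrite [X in `|X|](_ : _ = v1 * (f1 (s, h * v2 + y) - f1 (x, y))
    + v2 * (f2 (x, t) - f2 (x, y))); last first.
  rewrite [f _ - _](_ : _ = f1 (s, h * v2 + y) * (h * v1) + f2 (x, t) * (h * v2)).
    by field; exact: h0.
  by move: E1 E2; rewrite !addrK; lra.
rewrite (le_trans (ler_normD _ _)) // !normrM.
have : `|v1| * `|f1 (s, h * v2 + y) - f1 (x, y)| <= `|v1| * (e / M).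
  by rewrite ler_wpM2l // ltW.
have : `|v2| * `|f2 (x, t) - f2 (x, y)| <= `|v2| * (e / M).
  by rewrite ler_wpM2l // ltW.
have : M * (e / M) = e by rewrite mulrC divfK // gt_eqF.
rewrite {1}/M; lra.
Qed.

Lemma Ck_partials n A f f1 f2 : open A ->
  (forall p, A p -> {for p, continuous f}) ->
  (forall q, A q -> is_derive q.1 (1 : R) (fun s => f (s, q.2)) (f1 q)) ->
  (forall q, A q -> is_derive q.2 (1 : R) (fun t => f (q.1, t)) (f2 q)) ->
  Ck n A f1 -> Ck n A f2 -> Ck n.+1 A f.
Proof.
move=> oA cf h1 h2 k1 k2.
apply: (Ck_build (df := fun v p => v.1 * f1 p + v.2 * f2 p)) => //.
  move=> v p Ap; apply: (is_derive_partials v oA Ap h1 h2);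
    [exact: Ck_cont k1 _ Ap|exact: Ck_cont k2 _ Ap].
by move=> v; apply: CkD => //; apply: CkM => //; exact: Ck_cst.
Qed.

(** Compactness of the segment: since [Q] survives a decrease of [d], the local radii can be
    replaced by a common one. *)
Lemma seg_unif (Q : R -> R -> Prop) a b :
  (forall d d' s, d' <= d -> Q d s -> Q d' s) ->
  (forall s, seg a b s -> exists2 d, 0 < d & forall s', `|s' - s| < d -> Q d s') ->
  exists2 d, 0 < d & forall s, seg a b s -> Q d s.
Proof.
move=> Qle h; have cpt := @segment_compact R (Num.min a b) (Num.max a b).
have E s : s \in `[Num.min a b, Num.max a b] <-> seg a b s.
  by rewrite in_itv /= /seg ge_min le_max; split; lra.
have cov : \forall d \near 0^'+, `[Num.min a b, Num.max a b]%classic `<=` Q d.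
  apply: ((compact_near_coveringP _).1 cpt R (0 : R)^'+ Q _) => s /E/h[d d0 dQ].
  exists ([set s' | `|s' - s| < d], [set d' | d' <= d]).
    split=> /=; last exact: nbhs_right_le.
    by apply/nbhs_ballP; exists d => //= s'; rewrite /ball /= distrC.
  by move=> [s' d'] /= [/dQ + dd]; exact: Qle.
have [d [d0 hd]] := filter_ex (filterI (nbhs_right_gt (0 : R)) cov).
by exists d => // s /E; exact: hd.
Qed.

End plane.

Lemma divMS_le (R : realFieldType) (e M : R) : 0 <= e -> 0 <= M -> e / (M + 1) * M <= e.
Proof. by move=> e0 M0; rewrite mulrAC ler_pdivrMr; nra. Qed.

(** * Integrals with fixed limits depending on a parameter *)

Section fixed_limits.
Context {R : realType} (A : set (R * R)).
Hypothesis oA : open A.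
Implicit Types (a b s t x y h e : R) (f g u : R * R -> R).

Lemma slice_open y : open [set s | A (s, y)].
Proof. exact: open_fst. Qed.

Lemma slice_cont f y : (forall p, A p -> {for p, continuous f}) ->
  forall s, A (s, y) -> {for s, continuous (fun s => f (s, y))}.
Proof. by move=> cf s As; exact/cont_fst/cf. Qed.

(** The tube lemma for a horizontal segment in an open set. *)
Lemma seg_nbhs y a b : (forall s, seg a b s -> A (s, y)) ->
  exists2 d, 0 < d & forall t, `|t - y| < d -> forall s, seg a b s -> A (s, t).
Proof.
move=> sA.
have [|s /sA As|d d0 dP] := @seg_unif _ (fun d s => forall t, `|t - y| < d -> A (s, t)) a b.
- by move=> d d' s dd h t ty; apply: h; exact: lt_le_trans ty dd.
- have [d d0 dP] := (box_nbhs s y A).1 (open_nbhs_nbhs (conj oA As)).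
  by exists d => // s' ss t ty; exact: dP.
- by exists d => // t ty s /dP; exact.
Qed.

(** The values of [f] at heights [t] and [y] are close near each point of the segment, hence
    uniformly on it by compactness. *)
Lemma oint_param_cont f y a b : (forall p, A p -> {for p, continuous f}) ->
  (forall s, seg a b s -> A (s, y)) -> forall e, 0 < e ->
  exists2 d, 0 < d & forall t, `|t - y| < d ->
   `|oint (fun s => f (s, t)) a b - oint (fun s => f (s, y)) a b| <= e.
Proof.
move=> cf sA e e0; have [d1 d10 dA] := seg_nbhs sA.
pose e' := e / (`|b - a| + 1).
have e'0 : 0 < e' by rewrite divr_gt0 //; have := normr_ge0 (b - a); lra.
have [|s /sA As|d d0 dP] := @seg_unif _ (fun d s => forall t, `|t - y| < d ->
   `|f (s, t) - f (s, y)| <= e') a b.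
- by move=> d d' s dd h t ty; apply: h; exact: lt_le_trans ty dd.
- have e2 : 0 < e' / 2 by rewrite divr_gt0.
  have [d d0 dP] := (cont_box f s y).1 (cf _ As) _ e2.
  exists d => // s' ss t ty; have h1 := dP s' t ss ty.
  have h2 : `|f (s', y) - f (s, y)| < e' / 2 by apply: dP; rewrite ?subrr ?normr0.
  rewrite -(subrKA (f (s, y))) (le_trans (ler_normD _ _)) //.
  by rewrite [`|f (s, y) - _|]distrC; lra.
- exists (Num.min d d1); first by rewrite lt_min d0.
  move=> t; rewrite lt_min => /andP[td td1].
  rewrite -(ointB (S := [set s | A (s, t)] `&` [set s | A (s, y)])).
  + apply: (le_trans _ (divMS_le (ltW e0) (normr_ge0 (b - a)))).
    apply: (oint_norm_cst (S := [set s | A (s, t)] `&` [set s | A (s, y)])).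
    * by apply: openI; exact: slice_open.
    * by move=> s [s1 s2]; apply: cvgB; exact: slice_cont.
    * by move=> s ss; split; [exact: dA|exact: sA].
    * by move=> s ss; exact: dP.
  + by apply: openI; exact: slice_open.
  + by move=> s [s1 s2]; exact: slice_cont.
  + by move=> s [s1 s2]; exact: slice_cont.
  + by move=> s ss; split; [exact: dA|exact: sA].
Qed.

(* The factor [g - g(., y)] vanishes at [t = y], so [u] need only be continuous. *)
Lemma oint_param_derive u g g2 y a b :
  (forall p, A p -> {for p, continuous u}) ->
  (forall p, A p -> {for p, continuous g}) ->
  (forall p, A p -> {for p, continuous g2}) ->
  (forall p, A p -> is_derive p.2 (1 : R) (fun t => g (p.1, t)) (g2 p)) ->
  (forall s, seg a b s -> A (s, y)) ->
  is_derive y (1 : R)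
    (fun t => oint (fun s => u (s, t) * (g (s, t) - g (s, y))) a b)
    (oint (fun s => u (s, y) * g2 (s, y)) a b).
Proof.
move=> cu cg cg2 dg sA; apply/is_derive1_ball => e e0.
pose e' := e / (`|b - a| + 1).
have e'0 : 0 < e' by rewrite divr_gt0 //; have := normr_ge0 (b - a); lra.
(* Two heights occur: [u] is evaluated at [y + h], while [g2] is evaluated at the intermediate point
   of the mean value theorem for [g]. *)
have [|s /sA As|d d0 dP] := @seg_unif _ (fun d s => forall t t', `|t - y| < d ->
  `|t' - y| < d -> A (s, t) /\ `|u (s, t) * g2 (s, t') - u (s, y) * g2 (s, y)| <= e') a b.
- move=> d d' s dd h t t' ty ty'; apply: h; [exact: lt_le_trans ty dd|exact: lt_le_trans ty' dd].
- have [d1 d10 dA] := (box_nbhs s y A).1 (open_nbhs_nbhs (conj oA As)).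
  pose k (q : (R * R) * R) := u (q.1.1, q.1.2) * g2 (q.1.1, q.2).
  have ck : {for ((s, y), y), continuous k}.
    apply: cvgM.
      apply: (@continuous_comp _ _ _ (fun q : (R * R) * R => q.1) (fun p => u (p.1, p.2))).
        exact: cvg_fst.
      by have := cu _ As; under [X in _ -> {for _, continuous X}]eq_fun do rewrite -surjective_pairing.
    apply: (@continuous_comp _ _ _ (fun q : (R * R) * R => (q.1.1, q.2)) g2).
      apply: (@cvg_pair _ _ _ _ (nbhs s) (nbhs y)); last exact: cvg_snd.
      by apply: (@cvg_comp _ _ _ (fun q : (R * R) * R => q.1) fst); [exact: cvg_fst|exact: cvg_fst].
    exact: cg2.
  have e2 : 0 < e' / 2 by rewrite divr_gt0.
  have /cvgrPdist_lt/(_ _ e2)/nbhs_ballP[d /= d20 dP] := ck.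
  exists (Num.min d1 d); first by rewrite lt_min d10.
  move=> s'; rewrite lt_min => /andP[s1 s2] t t'.
  rewrite !lt_min => /andP[t1 t2] /andP[t1' t2'].
  have h1 : `|k ((s, y), y) - k ((s', t), t')| < e' / 2.
    by apply: dP; split; [split|]; rewrite /ball /= distrC.
  have h2 : `|k ((s, y), y) - k ((s', y), y)| < e' / 2.
    by apply: dP; split; [split|]; rewrite /ball /= 1?distrC // subrr normr0.
  split; first exact: dA.
  move: h1 h2; rewrite /k /= => h1 h2.
  rewrite -(subrKA (u (s, y) * g2 (s, y))) (le_trans (ler_normD _ _)) //.
  by rewrite [X in X + _]distrC; lra.
have sA' t : `|t - y| < d -> forall s, seg a b s -> A (s, t).
  by move=> td s ss; have [|//] := dP s ss t y td; rewrite subrr normr0.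
exists d => // h h0 hd.
have yh : `|y + h - y| < d by rewrite addrAC subrr add0r.
pose S := [set s | A (s, y + h)] `&` [set s | A (s, y)].
have oS : open S by apply: openI; exact: slice_open.
have SS s : seg a b s -> S s by move=> ss; split; [exact: sA'|exact: sA].
pose F t s := u (s, t) * (g (s, t) - g (s, y)).
have cF s : S s -> {for s, continuous (F (y + h))}.
  by move=> [s1 s2]; apply: cvgM; [|apply: cvgB]; exact: slice_cont.
pose G s := h^-1 * F (y + h) s.
have cG s : S s -> {for s, continuous G}.
  by move=> Ss; apply: cvgM; [exact: cvg_cst|exact: cF].
have -> : oint (F y) a b = 0.
  rewrite (eq_oint (g := fun=> 0)); last by move=> s _; rewrite /F subrr mulr0.
  have /(oint_primitive openT) -> // : forall s, seg a b s ->
    is_derive s (1 : R) (cst 0 : R -> R) ((fun=> 0) s) by move=> s _; exact: is_derive_cst.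
  - by rewrite subrr.
  - by move=> s _; exact: cvg_cst.
have -> : h^-1 * (oint (F (y + h)) a b - 0) = oint G a b.
  apply/esym; rewrite subr0.
  have hd' s : seg a b s -> is_derive s (1 : R) (h^-1 \*: oint (F (y + h)) a) (G s).
    move=> ss; apply: is_deriveZ; apply: (oint_derive oS cF) => t tt.
    apply: SS; exact: seg_sub (seg_l _ _) ss tt.
  by rewrite (oint_primitive oS cG SS hd') /= oint_id scaler0 subr0.
have cK s : S s -> {for s, continuous (fun s => u (s, y) * g2 (s, y))}.
  by move=> [s1 s2]; apply: cvgM; exact: slice_cont.
rewrite -(ointB oS) //.
apply: (le_trans _ (divMS_le (ltW e0) (normr_ge0 (b - a)))).
apply: (oint_norm_cst oS) => //.
  by move=> s Ss; apply: cvgB; [exact: cG|exact: cK].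
move=> s ss; have nt t : seg y (y + h) t -> `|t - y| < d.
  by move=> /seg_dist/le_lt_trans; apply.
have [t tt E] := @mvt_seg _ (fun t => g (s, t)) (fun t => g2 (s, t)) y (y + h)
  (fun t tt => dg _ (sA' t (nt t tt) s ss)).
have -> : G s = u (s, y + h) * g2 (s, t).
  by rewrite /G /F E; field.
by have [] := dP s ss (y + h) t yh (nt t tt).
Qed.

End fixed_limits.
Arguments slice_open {R A} oA y.

(** * Primitives from a sloping base line *)

Section primitive_from_line.
Context {R : realType}.
Implicit Types (a b s t x y h e : R) (f g u : R * R -> R).

(** The base point moves with the height: [c y = y] starts on the diagonal, a constant [c] at a
    fixed point with the height as a parameter. *)
Definition Jop (c : R -> R) f (p : R * R) : R :=
  oint (fun s => f (s, p.2)) (c p.2) p.1.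

(** Star-shapedness along horizontals with respect to the graph of [c]: the path of integration of
    [Jop c] stays in [A]. *)
Definition star (c : R -> R) (A : set (R * R)) :=
  forall x y s, A (x, y) -> seg (c y) x s -> A (s, y).

Variables (k d : R) (A : set (R * R)).
Let c y := k * y + d.
Hypotheses (oA : open A) (sA : star c A).
Let J := Jop c.

Lemma star_seg x y : A (x, y) -> forall s, seg (c y) x s -> A (s, y).
Proof. by move=> Ap s; exact: sA. Qed.

Lemma star_base x y : A (x, y) -> A (c y, y).
Proof. by move=> Ap; apply: star_seg Ap _ (seg_l _ _). Qed.

Lemma Jop_fst f x y : (forall p, A p -> {for p, continuous f}) -> A (x, y) ->
  is_derive x (1 : R) (fun s => J f (s, y)) (f (x, y)).
Proof.
move=> cf Ap; have oS := slice_open oA y.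
have cS := slice_cont (A := A) (y := y) cf.
exact: (oint_derive oS cS (star_seg Ap)).
Qed.

Lemma Jop_diag f y : J f (c y, y) = 0.
Proof. exact: oint_id. Qed.

(** Only the two outer pieces have moving limits; they are short and lie where [f] is within [e] of
    its value at [(c y0, y0)] or [(x0, y0)]. The middle piece has fixed limits. Continuity and
    Leibniz' rule both start from this cut. *)
Lemma Jop_split f x0 y0 e : (forall p, A p -> {for p, continuous f}) ->
  A (x0, y0) -> 0 < e -> exists2 r, 0 < r & forall x y, `|x - x0| < r -> `|y - y0| < r ->
  let f_ s := f (s, y) in
  [/\ A (x, y), J f (x, y) = oint f_ (c y) (c y0) + oint f_ (c y0) x0 + oint f_ x0 x,
   forall s, seg (c y) (c y0) s -> A (s, y) /\ `|f (s, y) - f (c y0, y0)| < e,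
   forall s, seg (c y0) x0 s -> A (s, y)
   & forall s, seg x0 x s -> A (s, y) /\ `|f (s, y) - f (x0, y0)| < e].
Proof.
move=> cf Ap e0; have Ac : A (c y0, y0) := star_base Ap.
have [r1 r10 h1] := (box_nbhs _ _ _).1 (open_nbhs_nbhs (conj oA Ap)).
have [r2 r20 h2] := (box_nbhs _ _ _).1 (open_nbhs_nbhs (conj oA Ac)).
have [r3 r30 h3] := (cont_box f _ _).1 (cf _ Ap) _ e0.
have [r4 r40 h4] := (cont_box f _ _).1 (cf _ Ac) _ e0.
have [r5 r50 h5] := seg_nbhs oA (star_seg Ap).
pose m := Num.min r1 (Num.min r2 (Num.min r3 (Num.min r4 r5))).
have m0 : 0 < m by rewrite /m !lt_min r10 r20 r30 r40 r50.
(* The base point moves [|k|] times as fast as the height; this radius keeps both displacements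
   below [m]. *)
pose r := m / (`|k| + 1).
have k0 := normr_ge0 k.
have r0 : 0 < r by rewrite /r divr_gt0 //; lra.
have rm : r <= m by rewrite /r ler_pdivrMr; nra.
exists r => // x y xr yr f_.
have ym : `|y - y0| < m by lra.
have xm : `|x - x0| < m by lra.
have cm : `|c y - c y0| < m.
  have -> : c y - c y0 = k * (y - y0) by rewrite /c; ring.
  rewrite normrM (@le_lt_trans _ _ (`|k| * r)) //; first by rewrite ler_wpM2l // ltW.
  by rewrite /r mulrCA gtr_pMr // ltr_pdivrMr; lra.
move: (ym) (xm) (cm); rewrite /m !lt_min => /and5P[? ? ? ? ?] /and5P[? ? ? ? ?] /and5P[? ? ? ? ?].
have B1 s : seg (c y) (c y0) s -> A (s, y) /\ `|f (s, y) - f (c y0, y0)| < e.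
  rewrite seg_sym => /seg_dist/le_lt_trans h.
  by split; [apply: h2 => //; exact: h|apply: h4 => //; exact: h].
have B2 s : seg x0 x s -> A (s, y) /\ `|f (s, y) - f (x0, y0)| < e.
  move=> /seg_dist/le_lt_trans h.
  by split; [apply: h1 => //; exact: h|apply: h3 => //; exact: h].
split=> //; [exact: h1| |exact: h5].
have oS := slice_open oA y; have cS := slice_cont (A := A) (y := y) cf.
rewrite /J /Jop /= (oint_cat (b := c y0) oS cS).
- by rewrite (oint_cat (b := x0) oS cS (h5 y _)) // => [|s /B2[]]; rewrite ?addrA.
- by move=> s /B1[].
- move=> s /(@seg_cat _ _ x0 _ _)/orP[|/B2[]//]; exact: h5.
Qed.

Lemma Jop_cont f : (forall p, A p -> {for p, continuous f}) ->
  forall p, A p -> {for p, continuous (J f)}.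
Proof.
move=> cf [x0 y0] Ap; apply/cont_box => e e0.
have Ac : A (c y0, y0) := star_base Ap.
(* Tolerance 1 is enough here: it serves to bound [f] by [M] on the two short pieces. *)
have [r1 r10 h1] := Jop_split cf Ap (ltr01 : (0 : R) < 1).
have e4 : 0 < e / 4 by rewrite divr_gt0.
have [r2 r20 h2] := oint_param_cont oA cf (star_seg Ap) e4.
pose M := `|f (c y0, y0)| + `|f (x0, y0)| + 1.
have M0 : 0 < M by rewrite /M; have := normr_ge0 (f (c y0, y0)); have := normr_ge0 (f (x0, y0)); lra.
pose r := Num.min r1 (Num.min r2 (e / 4 / (M * (`|k| + 1)))).
have k0 := normr_ge0 k.
have Mk0 : 0 < M * (`|k| + 1) by rewrite mulr_gt0 //; lra.
exists r; first by rewrite /r !lt_min r10 r20 divr_gt0.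
move=> x y; rewrite /r !lt_min => /and3P[x1 x2 x3] /and3P[y1 y2 y3].
have [_ -> B1 _ B2] := h1 x y x1 y1.
have oS := slice_open oA y; have cS := slice_cont (A := A) (y := y) cf.
have bnd (w v : R) : `|w - v| < 1 -> `|v| <= M - 1 -> `|w| <= M.
  move=> uv vM; rewrite -(subrK v w) (le_trans (ler_normD _ _)) //; lra.
have b1 : `|oint (fun s => f (s, y)) (c y) (c y0)| <= M * `|c y0 - c y|.
  apply: (oint_norm_cst oS cS) => s /B1[//] Asy h; apply: bnd h _.
  by rewrite /M; have := normr_ge0 (f (x0, y0)); lra.
have b2 : `|oint (fun s => f (s, y)) x0 x| <= M * `|x - x0|.
  apply: (oint_norm_cst oS cS) => s /B2[//] Asy h; apply: bnd h _.
  by rewrite /M; have := normr_ge0 (f (c y0, y0)); lra.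
have ck : `|c y0 - c y| = `|k| * `|y - y0|.
  by rewrite -normrM distrC; congr `|_|; rewrite /c; ring.
have b3 := h2 y y2.
have b1' : M * `|c y0 - c y| <= e / 4.
  move: y3; rewrite ltr_pdivlMr // ck; have := normr_ge0 (y - y0); nra.
have b2' : M * `|x - x0| <= e / 4.
  move: x3; rewrite ltr_pdivlMr //; have := normr_ge0 (x - x0); nra.
rewrite /J /Jop /=.
set i1 := oint _ _ _ in b1 *; set i2 := oint _ _ x0 in b3 *.
set i3 := oint _ _ _ in b2 *; set i4 := oint _ _ _ in b3 *.
rewrite [X in `|X|](_ : _ = i1 + (i2 - i4) + i3); last by ring.
rewrite (le_lt_trans (ler_normD _ _)) // (@le_lt_trans _ _ (`|i1| + `|i2 - i4| + `|i3|)) //.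
  by rewrite lerD2r ler_normD.
lra.
Qed.

(** The segment from [c t] to [c y0] has length of first order in [t - y0], so the change of the
    integrand with [t] is of higher order: what remains is the derivative of [c y0 - c t] times the
    value at the end. *)
Lemma oint_moving_end f x0 y0 : (forall p, A p -> {for p, continuous f}) ->
  A (x0, y0) -> is_derive y0 (1 : R)
    (fun t => oint (fun s => f (s, t)) (c t) (c y0)) (- k * f (c y0, y0)).
Proof.
move=> cf Ap; apply/is_derive1_ball => e e0.
have k0 := normr_ge0 k.
have e1 : 0 < e / (`|k| + 1) by rewrite divr_gt0 //; lra.
have [r r0' h1] := Jop_split cf Ap e1.
exists r => // h hn0 hr.
have [|| _ _ B1 _ _] := h1 x0 (y0 + h); rewrite ?subrr ?normr0 //.
  by rewrite addrAC subrr add0r.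
have oS := slice_open oA (y0 + h); have cS := slice_cont (A := A) (y := y0 + h) cf.
have [s ss sE] := mvt_seg (fun s ss => oint_derive oS cS
  (fun t tt => (B1 t (seg_sub (seg_l _ _) ss tt)).1)).
move: sE; rewrite oint_id subr0 => sE; rewrite oint_id subr0 sE.
rewrite [X in `|X|](_ : _ = - k * (f (s, y0 + h) - f (c y0, y0))); last first.
  by rewrite /c; field.
rewrite normrM normrN (le_trans _ (divMS_le (ltW e0) k0)) // mulrC ler_wpM2r // ltW //.
by have [] := B1 s ss.
Qed.

(** Leibniz' rule; the lower limit [c y] moves at speed [k] and produces the boundary term. *)
Lemma Jop_snd f f2 x0 y0 : (forall p, A p -> {for p, continuous f}) ->
  (forall p, A p -> {for p, continuous f2}) ->
  (forall p, A p -> is_derive p.2 (1 : R) (fun t => f (p.1, t)) (f2 p)) ->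
  A (x0, y0) ->
  is_derive y0 (1 : R) (fun t => J f (x0, t)) (J f2 (x0, y0) - k * f (c y0, y0)).
Proof.
move=> cf cf2 df Ap.
have Ac : A (c y0, y0) := star_base Ap.
have [r0 r00 h0] := Jop_split cf Ap (ltr01 : (0 : R) < 1).
have cst1 : forall p, A p -> {for p, continuous (fun=> 1 : R)}.
  by move=> p _; exact: cvg_cst.
have dI : is_derive y0 (1 : R)
    (fun t => oint (fun s => f (s, t) - f (s, y0)) (c y0) x0) (J f2 (x0, y0)).
  (* The part [f (s, y0)], constant in [t], is split off, so that the rule for a factor vanishing at
     [t = y0] applies with [u = 1]. *)
  have h := oint_param_derive oA cst1 cf cf2 df (star_seg Ap).
  rewrite [X in is_derive _ _ X _](_ : _ = fun t =>
    oint (fun s => 1 * (f (s, t) - f (s, y0))) (c y0) x0).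
    by apply: is_derive_eq h _; apply: eq_oint => s _; rewrite mul1r.
  by apply/funext => t; apply: eq_oint => s _; rewrite mul1r.
pose E t := oint (fun s => f (s, t)) (c t) (c y0).
have dE : is_derive y0 (1 : R) E (- k * f (c y0, y0)) := oint_moving_end cf Ap.
have := is_deriveD dE (is_deriveD dI (is_derive_cst (oint (fun s => f (s, y0)) (c y0) x0) y0 (1 : R))).
rewrite addr0 mulNr [- _ + _]addrC.
apply: near_eq_is_derive; apply/nbhs_ballP; exists r0 => // t.
rewrite /ball /= distrC => ty.
have [|_ -> _ B _] := h0 x0 t _ ty; first by rewrite subrr normr0.
rewrite oint_id addr0 /= -![(_ + _) _]/(_ + _) -/(E t) /=; congr (_ + _).
pose S := [set s | A (s, t)] `&` [set s | A (s, y0)].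
rewrite (@ointB _ S).
- by rewrite subrK.
- by apply: openI; exact: slice_open.
- by move=> s [s1 s2]; exact: (slice_cont cf s1).
- by move=> s [s1 s2]; exact: (slice_cont cf s2).
- by move=> s ss; split; [exact: B|exact: star_seg Ap _ ss].
Qed.

Lemma Ck_base n f : Ck n A f -> Ck n A (fun p => f (c p.2, p.2)).
Proof.
move=> hf; pose L (p : R * R) := (c p.2, p.2); pose DL (p : R * R) := (k * p.2, p.2).
have cL : continuous L.
  move=> p; apply: (@cvg_pair _ _ _ _ (nbhs (c p.2)) (nbhs p.2)); last exact: cvg_snd.
  apply: cvgD; last exact: cvg_cst.
  by apply: cvgM; [exact: cvg_cst|exact: cvg_snd].
have hL h (p v : R * R) : L (h *: v + p) = h *: DL v + L p.
  rewrite -[RHS]/(h * (k * v.2) + c p.2, h * v.2 + p.2) /L /=; congr pair.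
  by rewrite -[(h *: v.2)%R]/(h * v.2) /c; ring.
apply: Ck_sub (Ck_affine cL hL hf) => -[x y] Ap; exact: star_base Ap.
Qed.

(** The derivative in x is [f] itself, the derivative in y is the primitive of a derivative of [f]
    plus a boundary term; both are one class below the claim by induction. *)
Lemma Ck_Jop n f : Ck n A f -> Ck n A (J f).
Proof.
elim: n f => [|n IH] f hf; first by split=> //; apply: Jop_cont; exact: Ck_cont hf.
have cf := Ck_cont hf; have hf' := Ck_pred hf.
pose f2 := 'D_(0, 1) f.
have hf2 : Ck n A f2 by exact: Ck_der.
have df2 p : A p -> is_derive p.2 (1 : R) (fun t => f (p.1, t)) (f2 p).
  by case: p => x y Ap; apply/is_derive_snd; exact: Ck_is_derive hf Ap.
apply: (Ck_partials (f1 := f) (f2 := fun p => J f2 p - k * f (c p.2, p.2))) => //.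
- exact: Jop_cont.
- by move=> [x y] Ap; apply: Jop_fst.
- by move=> [x y] Ap; apply: Jop_snd => //; exact: Ck_cont hf2.
- apply: CkB => //; first exact: IH.
  by apply: CkM => //; [exact: Ck_cst|exact: Ck_base].
Qed.

End primitive_from_line.

(** * Geometrically convergent iterations *)

Section half.
Context {R : realType}.

Lemma half_pow_lt (K e : R) : 0 < e -> exists n, K * 2^-1 ^+ n < e.
Proof.
move=> e0; have : K * 2^-1 ^+ n @[n --> \oo] --> K * 0.
  by apply: cvgM; [exact: cvg_cst|apply: cvg_expr; rewrite ger0_norm; lra].
rewrite mulr0 => /cvgrPdist_lt/(_ e e0)[n _ hn]; exists n.
have := hn n (leqnn n); rewrite sub0r normrN; exact: le_lt_trans (ler_norm _).
Qed.

Lemma half_pow_0 (K x : R) : (forall n, `|x| <= K * 2^-1 ^+ n) -> x = 0.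
Proof.
move=> h; apply/eqP; rewrite -normr_le0; apply/ler_addgt0Pl => e e0; rewrite addr0.
by have [n /ltW] := half_pow_lt K e0; exact: le_trans.
Qed.

End half.

Section iteration.
Context {R : realType} (A : set (R * R)) (u : nat -> R * R -> R) (w : R * R -> R).
Hypothesis oA : open A.
Hypothesis hu : forall n p, A p -> `|u n.+1 p - u n p| <= 2^-1 ^+ n * w p.

Let U p := lim (u n p @[n --> \oo]).

Lemma iter_dist n m p : A p -> (n <= m)%N -> `|u m p - u n p| <= 2 * 2^-1 ^+ n * w p.
Proof.
move=> Ap nm; have w0 : 0 <= w p.
  by have := hu 0 Ap; rewrite expr0 mul1r; exact: le_trans.
(* The induction on [m] runs on the partial sum of the geometric series, not on its limit. *)
suff : `|u m p - u n p| <= 2 * (2^-1 ^+ n - 2^-1 ^+ m) * w p.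
  move=> h; apply: (le_trans h); rewrite ler_wpM2r // ler_pM2l //.
  by rewrite gerBl exprn_ge0.
elim: m nm => [|m IH]; first by rewrite leqn0 => /eqP ->; rewrite !subrr normr0 mulr0 mul0r.
rewrite leq_eqVlt => /predU1P[->|]; first by rewrite !subrr normr0 mulr0 mul0r.
rewrite ltnS => /IH h; rewrite -(subrKA (u m p)) (le_trans (ler_normD _ _)) //.
have := hu m Ap; rewrite exprS; lra.
Qed.

Lemma iter_cvg p : A p -> u n p @[n --> \oo] --> U p.
Proof.
move=> Ap; have w0 : 0 <= w p.
  by have := hu 0 Ap; rewrite expr0 mul1r; exact: le_trans.
apply/cauchy_cvgP/cauchy_exP => e e0.
have [n hn] := half_pow_lt (2 * w p) e0.
exists (u n p); exists n => // m /= nm; rewrite /ball /= distrC.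
by apply: le_lt_trans (iter_dist Ap nm) _; rewrite mulrAC.
Qed.

Lemma iter_lim_dist n p : A p -> `|U p - u n p| <= 2 * 2^-1 ^+ n * w p.
Proof.
move=> Ap; apply/ler_addgt0Pl => e e0.
have /cvgrPdist_lt/(_ e e0)[m _ hm] := iter_cvg Ap.
have h2 := hm (maxn m n) (leq_maxl _ _).
have h1 := iter_dist Ap (leq_maxr m n).
rewrite -(subrKA (u (maxn m n) p)) (le_trans (ler_normD _ _)) // lerD // ltW //.
Qed.

(** [w] may be unbounded on [A], but near [p] it stays below [w p + 1], which makes the convergence
    locally uniform. *)
Lemma iter_lim_cont : (forall p, A p -> {for p, continuous w}) ->
  (forall n p, A p -> {for p, continuous (u n)}) ->
  forall p, A p -> {for p, continuous U}.
Proof.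
move=> cw cu p Ap; apply/cvgrPdist_lt => e e0.
have [n hn] := half_pow_lt (2 * (w p + 1)) (divr_gt0 e0 (ltr0n R 3)).
have nA := open_nbhs_nbhs (conj oA Ap).
near=> q.
have Aq : A q by near: q.
have h1 := iter_lim_dist n Ap; have h2 := iter_lim_dist n Aq.
have h3 : `|u n p - u n q| < e / 3.
  by near: q; apply: ((cvgrPdist_lt _ _).1 (cu n p Ap)); rewrite divr_gt0.
have h4 : `|w p - w q| < 1.
  by near: q; apply: ((cvgrPdist_lt _ _).1 (cw p Ap)).
have h5 : w q <= w p + 1.
  by move: h4; rewrite ltr_norml => /andP[]; lra.
have e2 : 0 <= 2^-1 ^+ n :> R by rewrite exprn_ge0.
have h6 : 2 * 2^-1 ^+ n * w q < e / 3.
  by apply: le_lt_trans hn; nra.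
have h7 : 2 * 2^-1 ^+ n * w p < e / 3.
  by apply: le_lt_trans hn; nra.
rewrite (_ : U p - U q = (U p - u n p) + (u n p - u n q) + (u n q - U q)); last by ring.
rewrite (le_lt_trans (ler_normD _ _)) //
    (@le_lt_trans _ _ (`|U p - u n p| + `|u n p - u n q| + `|u n q - U q|)) //.
  by rewrite lerD2r ler_normD.
by rewrite [`|u n q - _|]distrC; lra.
Unshelve. all: by end_near. Qed.

End iteration.

Lemma is_derive_mulmx (R : realType) (V : normedModType R) (a b c : nat)
    (F : V -> 'M[R]_(a, b)) (G : V -> 'M[R]_(b, c)) p v DF DG :
  is_derive p v F DF -> is_derive p v G DG ->
  is_derive p v (fun q => F q *m G q) (DF *m G p + F p *m DG).
Proof.
move=> /is_derive_mxP hF /is_derive_mxP hG; apply/is_derive_mxP => i j.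
rewrite [X in is_derive _ _ X](_ : _ = \sum_l (fun q => F q i l) * (fun q => G q l j)).
  apply: is_derive_eq; rewrite !mxE -big_split; apply: eq_bigr => l _ /=.
  by rewrite addrC [X in _ + X]mulrC.
by apply/funext => q; rewrite mxE fct_sumE.
Qed.

Lemma eq_continuous_at (S T : topologicalType) (f g : S -> T) p :
  f =1 g -> {for p, continuous f} -> {for p, continuous g}.
Proof. by move=> /funext ->. Qed.

Lemma continuous_mulmx (R : realType) (T : normedModType R) (a b c : nat)
    (F : T -> 'M[R]_(a, b)) (G : T -> 'M[R]_(b, c)) p :
  {for p, continuous F} -> {for p, continuous G} ->
  {for p, continuous (fun q => F q *m G q)}.
Proof.
move=> /continuous_mxP cF /continuous_mxP cG; apply/continuous_mxP => i j.
apply: (@eq_continuous_at _ _ (fun q => \sum_l F q i l * G q l j)).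
  by move=> q; rewrite mxE.
rewrite /prop_for /continuous_at; apply: cvg_big => [|l _]; first exact: add_continuous.
by apply: cvgM; [exact: cF|exact: cG].
Qed.

(** * Linear differential equations with parameters *)

Section weight.
Context {R : realType} (k d : R) (A : set (R * R)) (m mu : R -> R).
Let c y := k * y + d.
Hypotheses (oA : open A) (sA : star c A).
Hypothesis dm : forall p, A p -> is_derive p.1 (1 : R) m (mu p.1).
Hypothesis mu0 : forall p, A p -> 0 <= mu p.1.

(* In the norm with this weight the Picard operator contracts on all of [A]. *)
Definition weight (L : R) (p : R * R) := expR (L * `|m p.1 - m (c p.2)|).

Lemma weight_ge1 L p : 0 <= L -> 1 <= weight L p.
Proof. by move=> L0; rewrite -expR0 /weight ler_expR mulr_ge0. Qed.

Lemma weight_cont L p : A p -> {for p, continuous (weight L)}.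
Proof.
case: p => x y Ap; have Ac : A (c y, y) := star_base sA Ap.
have cm z y' : A (z, y') -> {for z, continuous m} by move=> /dm/is_derive_cont.
apply: (@continuous_comp _ _ _ (fun p : R * R => L * `|m p.1 - m (c p.2)|) expR);
  last exact: continuous_expR.
apply: cvgM; first exact: cvg_cst.
apply: (@continuous_comp _ _ _ (fun p : R * R => m p.1 - m (c p.2)) Num.norm);
  last exact: norm_continuous.
apply: cvgB.
  apply: (@continuous_comp _ _ _ (fun p : R * R => p.1) m); [exact: cvg_fst|exact: cm Ap].
apply: (@continuous_comp _ _ _ (fun p : R * R => c p.2) m); last exact: cm Ac.
apply: cvgD; last exact: cvg_cst.
by apply: cvgM; [exact: cvg_cst|exact: cvg_snd].
Qed.

(** Bielecki's device: along a segment [K * L * mu * weight] is, up to the sign of the direction,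
    the derivative of [K * weight], so integration gains the factor [1 / L]. *)
Lemma Jop_weight f (K L : R) : 0 < L -> 0 <= K ->
  (forall p, A p -> {for p, continuous f}) ->
  (forall p, A p -> `|f p| <= K * L * mu p.1 * weight L p) ->
  forall p, A p -> `|Jop c f p| <= K * weight L p.
Proof.
move=> L0 K0 cf hf [x y] Ap; have sg := star_seg sA Ap.
have dms s : seg (c y) x s -> is_derive s (1 : R) m (mu s) by move=> /sg/dm.
(* The direction of the segment; it turns the absolute value in the weight into a differentiable
   expression. *)
pose sgm : R := if c y <= x then 1 else -1.
have Hs s : seg (c y) x s -> `|m s - m (c y)| = sgm * (m s - m (c y)).
  move=> ss; have [|t tt E] := @mvt_seg _ m mu (c y) s.
    by move=> t tt; apply: dms; exact: seg_sub (seg_l _ _) ss tt.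
  have mt : 0 <= mu t by apply: (mu0 (sg t _)); exact: seg_sub (seg_l _ _) ss tt.
  rewrite /sgm E; move: ss => /orP ss; case: (leP (c y) x) => cx.
    by rewrite mul1r ger0_norm // mulr_ge0 //; case: ss => /andP[]; lra.
  by rewrite mulN1r ler0_norm // mulr_ge0_le0 //; case: ss => /andP[]; lra.
have sgm2 : sgm * sgm = 1 by rewrite /sgm; case: ifP; lra.
pose g s := sgm * K * expR (L * (sgm * (m s - m (c y)))).
have dg s : seg (c y) x s -> is_derive s (1 : R) g (K * L * mu s * weight L (s, y)).
  move=> ss; have dms' := dms s ss.
  have h1 : is_derive s (1 : R) (fun s => L * (sgm * (m s - m (c y)))) (L * sgm * mu s).
    have := is_deriveZ (L * sgm) (is_deriveB dms' (is_derive_cst (m (c y)) s 1)).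
    rewrite subr0; congr is_derive; apply/funext => t.
    by rewrite -[LHS]/(L * sgm * (m t - m (c y))) mulrA.
  have h2 := is_deriveZ (sgm * K) (is_derive1_comp (is_derive_expR _) h1).
  apply: is_derive_eq h2 _; rewrite /weight /= Hs //.
  rewrite -[LHS]/(sgm * K * (expR (L * (sgm * (m s - m (c y)))) * (L * sgm * mu s))).
  by rewrite -[X in _ = X]mul1r -sgm2; ring.
have oS := slice_open oA y; have cS := slice_cont (A := A) (y := y) cf.
rewrite /Jop /=; apply: (le_trans (oint_norm_le oS cS sg dg (fun s ss => hf _ (sg s ss)))).
rewrite /g /weight /= Hs ?seg_r // subrr !mulr0 expR0 -mulrBr normrM normrM.
have -> : `|sgm| = 1 by rewrite /sgm; case: ifP; rewrite ?normrN normr1.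
rewrite mul1r (ger0_norm K0) ler_wpM2l // ger0_norm; first by rewrite gerBl.
rewrite subr_ge0 -expR0 ler_expR; apply: mulr_ge0; first exact: ltW.
by rewrite -Hs ?seg_r.
Qed.

End weight.

Section linear_ode.
Context {R : realType} (k d : R) (A : set (R * R)) (m mu : R -> R) (L : R) (n : nat).
Variable a : R * R -> 'M[R]_n.
Let c y := k * y + d.
Hypotheses (oA : open A) (sA : star c A).
Hypothesis dm : forall p, A p -> is_derive p.1 (1 : R) m (mu p.1).
Hypothesis mu0 : forall p, A p -> 0 <= mu p.1.
Hypothesis L0 : 0 < L.
Hypothesis ca : forall p, A p -> {for p, continuous a}.
Hypothesis ba : forall p, A p -> forall i j, `|a p i j| <= L * mu p.1.

(** An entry of [Z a] has n terms, each at most [K w L mu]; as [2 n L <= Lam], integration contracts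
    by 1/2. The added 1 keeps [L <= Lam], used for the first iterate. *)
Let Lam := (2 * n%:R + 1) * L.
Let w := weight k d m Lam.
Let J := Jop c.

Let Tp (Z : R * R -> 'M[R]_n) (p : R * R) : 'M[R]_n :=
  1%:M + \matrix_(i, j) J (fun q => (Z q *m a q) i j) p.

Let Lam0 : 0 < Lam.
Proof. by rewrite mulr_gt0 //; have := ler0n R n; lra. Qed.

Let mulmx_cont (Z Z' : R * R -> 'M[R]_n) p : {for p, continuous Z} ->
  {for p, continuous Z'} -> forall i j, {for p, continuous (fun q => (Z q *m Z' q) i j)}.
Proof. by move=> cZ cZ'; apply/continuous_mxP/continuous_mulmx. Qed.

Let Tp_cont Z : (forall p, A p -> {for p, continuous Z}) ->
  forall p, A p -> {for p, continuous (Tp Z)}.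
Proof.
move=> cZ p Ap; apply/continuous_mxP => i j.
apply: (@eq_continuous_at _ _ (fun p => (1%:M : 'M[R]_n) i j + J (fun q => (Z q *m a q) i j) p)).
  by move=> q; rewrite !mxE.
apply: cvgD; first exact: cvg_cst.
by apply: (Jop_cont oA sA) => // q Aq; apply: mulmx_cont; [exact: cZ|exact: ca].
Qed.

Let Tp_contract (Z Z' : R * R -> 'M[R]_n) (K : R) : 0 <= K ->
  (forall p, A p -> {for p, continuous Z}) ->
  (forall p, A p -> {for p, continuous Z'}) ->
  (forall p i j, A p -> `|Z p i j - Z' p i j| <= K * w p) ->
  forall p i j, A p -> `|Tp Z p i j - Tp Z' p i j| <= K * 2^-1 * w p.
Proof.
move=> K0 cZ cZ' hK p i j Ap; rewrite !mxE opprD addrACA subrr add0r.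
rewrite (_ : _ - _ = J (fun q => (Z q *m a q) i j - (Z' q *m a q) i j) p); last first.
  case: p Ap => x y Ap; rewrite /J /Jop /= (ointB (slice_open oA y)) //.
  - by move=> s As; apply: (slice_cont (A := A) (f := fun q => (Z q *m a q) i j) _ As) => q Aq;
      apply: mulmx_cont; [exact: cZ|exact: ca].
  - by move=> s As; apply: (slice_cont (A := A) (f := fun q => (Z' q *m a q) i j) _ As) => q Aq;
      apply: mulmx_cont; [exact: cZ'|exact: ca].
  - move=> s; exact: (star_seg sA Ap).
apply: (Jop_weight oA sA dm mu0 Lam0) => //.
- by rewrite mulr_ge0.
- by move=> q Aq; apply: cvgB; apply: mulmx_cont; (exact: cZ || exact: cZ' || exact: ca).
move=> q Aq; rewrite !mxE -sumrB.
have w1 : 1 <= w q by apply: weight_ge1; exact: ltW.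
have mq := mu0 Aq.
apply: (@le_trans _ _ (\sum_(l < n) K * w q * (L * mu q.1))).
  rewrite (le_trans (ler_norm_sum _ _ _)) // ler_sum // => l _.
  by rewrite -mulrBl normrM ler_pM // ?hK ?ba.
rewrite sumr_const card_ord -[X in X <= _]mulr_natr -/w /Lam.
have -> : K * 2^-1 * ((2 * n%:R + 1) * L) * mu q.1 * w q =
   K * w q * (L * mu q.1) * n%:R + K * 2^-1 * (L * mu q.1 * w q) by field.
rewrite lerDl !mulr_ge0 // ?ltW //.
exact: lt_le_trans ltr01 w1.
Qed.

(** Picard iteration in the weighted norm, on all of [A] at once. The explicit growth bound is kept
    because local uniformity in the loop parameter is later drawn from it. *)
Lemma lin_ode_cont : exists Z : R * R -> 'M[R]_n,
  [/\ forall p, A p -> {for p, continuous Z},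
      forall x y, A (x, y) ->
        is_derive x (1 : R) (fun s => Z (s, y)) (Z (x, y) *m a (x, y)),
      forall x y, A (x, y) -> Z (c y, y) = 1%:M
    & forall p i j, A p -> `|Z p i j| <= 3 * w p].
Proof.
pose Zn l := iter l Tp (fun=> 1%:M).
have cZn l p : A p -> {for p, continuous (Zn l)}.
  elim: l p => [|l IH] p Ap; first exact: cvg_cst.
  exact: Tp_cont.
have w1 p : 1 <= w p by apply: weight_ge1; exact: ltW.
have w0 p : 0 <= w p by apply: le_trans (w1 p).
have cw p : A p -> {for p, continuous w} by exact: weight_cont.
have e0 l : 0 <= 2^-1 ^+ l :> R by rewrite exprn_ge0.
have hZ l p i j : A p -> `|Zn l.+1 p i j - Zn l p i j| <= 2^-1 ^+ l * w p.
  elim: l p i j => [|l IH] p i j Ap; last first.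
    rewrite exprSr.
    exact: (@Tp_contract (Zn l.+1) (Zn l) _ (e0 l) (cZn l.+1) (cZn l) IH).
  rewrite /Zn /= !mxE addrAC subrr add0r expr0.
  apply: (Jop_weight oA sA dm mu0 Lam0) => //.
    by move=> q Aq; apply: mulmx_cont; [exact: cvg_cst|exact: ca].
  move=> q Aq; rewrite mul1mx mul1r (le_trans (ba Aq i j)) //.
  have := w1 q; have := mu0 Aq; have := ler0n R n.
  rewrite -/w /Lam => n0 mq wq.
  apply: (@le_trans _ _ (L * mu q.1 * w q)).
    by rewrite ler_peMr // mulr_ge0 // ltW.
  have L1 : L <= (2 * n%:R + 1) * L by move: L0 n0; nra.
  by rewrite ler_wpM2r ?w0 // ler_wpM2r.
pose Z p : 'M[R]_n := \matrix_(i, j) lim (Zn l p i j @[l --> \oo]).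
have hd l p i j : A p -> `|Z p i j - Zn l p i j| <= 2 * 2^-1 ^+ l * w p.
  move=> Ap; rewrite mxE.
  exact: (@iter_lim_dist _ A (fun l p => Zn l p i j) w (fun l q => hZ l q i j) l p Ap).
have cZ p : A p -> {for p, continuous Z}.
  move=> Ap; apply/continuous_mxP => i j.
  apply: (@eq_continuous_at _ _ (fun p => lim (Zn l p i j @[l --> \oo]))).
    by move=> q; rewrite mxE.
  apply: (@iter_lim_cont _ A (fun l p => Zn l p i j) w oA (fun l q => hZ l q i j)) => // l q Aq.
  by move: i j; apply/continuous_mxP; exact: cZn.
have fixZ p i j : A p -> Z p i j = Tp Z p i j.
  move=> Ap; apply/eqP; rewrite -subr_eq0; apply/eqP.
  apply: (@half_pow_0 _ (2 * w p)) => l.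
  rewrite -(subrKA (Zn l.+1 p i j)) (le_trans (ler_normD _ _)) //.
  have h1 := hd l.+1 p i j Ap.
  have h2 : `|Tp (Zn l) p i j - Tp Z p i j| <= 2 * 2^-1 ^+ l * 2^-1 * w p.
    have K0 : 0 <= 2 * 2^-1 ^+ l :> R by rewrite mulr_ge0.
    apply: (Tp_contract K0 (cZn l) cZ) => // q i' j' Aq; by rewrite distrC hd.
  have -> : 2 * w p * 2^-1 ^+ l = 2 * 2^-1 ^+ l.+1 * w p + 2 * 2^-1 ^+ l * 2^-1 * w p.
    by rewrite exprS; field.
  exact: lerD.
exists Z; split=> //.
- move=> x y Ap; apply/is_derive_mxP => i j.
  have cf q : A q -> {for q, continuous (fun q => (Z q *m a q) i j)}.
    by move=> Aq; apply: mulmx_cont; [exact: cZ|exact: ca].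
  have dJ := is_deriveD (is_derive_cst ((i == j)%:R : R) x 1) (Jop_fst oA sA cf Ap).
  rewrite add0r in dJ; apply: near_eq_is_derive dJ.
  apply: filterS (open_nbhs_nbhs (conj (slice_open oA y) Ap)) => s As.
  by rewrite fixZ // !mxE.
- move=> x y Ap; apply/matrixP => i j; rewrite fixZ; last exact: star_base Ap.
  by rewrite !mxE /J Jop_diag addr0.
(* The identity contributes at most [1 <= w], the rest of the iteration at most [2 w]. *)
- move=> p i j Ap; rewrite -(subrK (Zn 0%N p i j) (Z p i j)) (le_trans (ler_normD _ _)) //.
  have := hd 0%N p i j Ap; rewrite expr0 mulr1 => h.
  have : `|Zn 0%N p i j| <= 1.
    by rewrite /Zn /= mxE; case: (i == j); rewrite ?normr1 ?normr0.
  by have := w1 p; lra.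
Qed.

End linear_ode.

Lemma is_derive_mxmulr (R : realType) (V : normedModType R) (a b c : nat)
    (F : V -> 'M[R]_(a, b)) (M : 'M[R]_(b, c)) p v DF :
  is_derive p v F DF -> is_derive p v (fun q => F q *m M) (DF *m M).
Proof.
move=> hF; have := is_derive_mulmx hF (is_derive_cst M p v).
by rewrite mulmx0 addr0.
Qed.

Lemma is_derive_trmx (R : realType) (V : normedModType R) (a b : nat)
    (F : V -> 'M[R]_(a, b)) p v DF :
  is_derive p v F DF -> is_derive p v (fun q => (F q)^T) DF^T.
Proof.
move=> /is_derive_mxP hF; apply/is_derive_mxP => i j; rewrite mxE.
by under eq_fun do rewrite mxE.
Qed.

Lemma continuous_trmx (R : realType) (V : normedModType R) (a b : nat)
    (F : V -> 'M[R]_(a, b)) p :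
  {for p, continuous F} -> {for p, continuous (fun q => (F q)^T)}.
Proof.
move=> /continuous_mxP hF; apply/continuous_mxP => i j.
by apply: eq_continuous_at (hF j i) => q; rewrite mxE.
Qed.

Lemma Ck_trmx (R : realType) (V : normedModType R) (a b n : nat) (A : set V)
    (F : V -> 'M[R]_(a, b)) : open A -> Ck n A F -> Ck n A (fun q => (F q)^T).
Proof.
move=> oA /(Ck_mxP _ _ oA) hF; apply/(Ck_mxP _ _ oA) => i j.
by under eq_fun do rewrite mxE.
Qed.

Lemma CkN_mx (R : realType) (V : normedModType R) (a b n : nat) (A : set V)
    (F : V -> 'M[R]_(a, b)) : open A -> Ck n A F -> Ck n A (fun q => - F q).
Proof.
move=> oA /(Ck_mxP _ _ oA) hF; apply/(Ck_mxP _ _ oA) => i j.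
by under eq_fun do rewrite mxE; apply: CkN.
Qed.

Section smooth_dependence.
Context {R : realType} (k d : R) (A : set (R * R)) (n : nat).
Let c y := k * y + d.
Hypotheses (oA : open A) (sA : star c A).

(** A fundamental solution together with its inverse, which solves the equation with the coefficient
    on the left. Carrying both makes the structure invariant under transposition, so a result on [Z]
    is also one on [W]. *)
Record ode_pair (a Z W : R * R -> 'M[R]_n) : Prop := OdePair {
  op_contl : forall p, A p -> {for p, continuous Z};
  op_contr : forall p, A p -> {for p, continuous W};
  op_derl : forall x y, A (x, y) ->
    is_derive x (1 : R) (fun s => Z (s, y)) (Z (x, y) *m a (x, y));
  op_derr : forall x y, A (x, y) ->
    is_derive x (1 : R) (fun s => W (s, y)) (- (a (x, y) *m W (x, y)));
  op_base : forall x y, A (x, y) -> Z (c y, y) = 1%:M;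
  op_inv : forall p, A p -> Z p *m W p = 1%:M }.

Lemma ode_pair_tr a Z W : ode_pair a Z W ->
  ode_pair (fun p => - (a p)^T) (fun p => (W p)^T) (fun p => (Z p)^T).
Proof.
case=> cZ cW dZ dW bZ iZ; split.
- by move=> p /cW; exact: continuous_trmx.
- by move=> p /cZ; exact: continuous_trmx.
- move=> x y /dW/is_derive_trmx h; apply: is_derive_eq h _.
  by rewrite linearN /= trmx_mul mulmxN.
- move=> x y /dZ/is_derive_trmx h; apply: is_derive_eq h _.
  by rewrite mulNmx opprK trmx_mul.
- move=> x y Ap; have := iZ _ (star_base sA Ap).
  by rewrite (bZ _ _ Ap) mul1mx => ->; rewrite trmx1.
- by move=> p Ap; rewrite -trmx_mul iZ // trmx1.
Qed.

Section pair.
Variables (a Z W : R * R -> 'M[R]_n).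
Hypothesis sa : forall l, Ck l A a.
Hypothesis ZW : ode_pair a Z W.

Let a2 := 'D_(0, 1) a.
Let Kf p := Z p *m a2 p *m W p.

(* Variation of constants, with [W] the inverse of [Z]; the first term comes
   from the moving base point [c y]. *)
Definition ode_dsnd p : 'M[R]_n :=
  (- k *: a (c p.2, p.2) + \matrix_(i, j) Jop c (fun q => Kf q i j) p) *m Z p.

Let ca p : A p -> {for p, continuous a}.
Proof. exact: Ck_cont (sa 0) p. Qed.

Let ca2 p : A p -> {for p, continuous a2}.
Proof. exact: Ck_cont (Ck_der _ (sa 1)) p. Qed.

Let da2 p : A p -> forall i j,
  is_derive p.2 (1 : R) (fun t => a (p.1, t) i j) (a2 p i j).
Proof.
case: p => x y Ap i j; apply/(is_derive_snd (fun q => a q i j)).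
by move: i j; apply/is_derive_mxP; exact: Ck_is_derive (sa 1) Ap.
Qed.

(** Nothing beyond continuity of [Z] in y is known beforehand, so its y-dependence cannot be
    differentiated under the integral. In [Z (x0, t) W (x0, y0) = 1 + E t + H t] this is avoided:
    [E] is an integral over a short segment at the base, and the integrand of [H] contains the
    smooth difference [a (s, t) - a (s, y0)], which vanishes at [t = y0]. *)
Lemma ode_derive_snd x0 y0 : A (x0, y0) ->
  is_derive y0 (1 : R) (fun t => Z (x0, t)) (ode_dsnd (x0, y0)).
Proof.
move=> Ap; have Ac := star_base sA Ap; have [cZ cW dZ dW bZ iZ] := ZW.
have cent (F : R * R -> 'M[R]_n) (cF : forall p, A p -> {for p, continuous F}) i j p :
  A p -> {for p, continuous (fun q => F q i j)}.
  by move=> /cF/continuous_mxP; exact.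
have cZa p : A p -> {for p, continuous (fun p => Z p *m a p)}.
  by move=> Aq; apply: continuous_mulmx; [exact: cZ|exact: ca].
have WZ p : A p -> W p *m Z p = 1%:M by move=> /iZ/mulmx1C.
pose V t := Z (x0, t) *m W (x0, y0).
pose u i j q l p := Z p i l * W (p.1, y0) q j.
pose I i j q l t := oint (fun s => u i j q l (s, t) * (a (s, t) l q - a (s, y0) l q)) (c y0) x0.
pose E t : 'M[R]_n := \matrix_(i, j) oint (fun s => (Z (s, t) *m a (s, t)) i j) (c t) (c y0).
pose H t : 'M[R]_n := \matrix_(i, j) \sum_q \sum_l I i j q l t.
have dE : is_derive y0 (1 : R) E (- k *: a (c y0, y0)).
  apply/is_derive_mxP => i j; under eq_fun do rewrite mxE; rewrite mxE.
  have h := oint_moving_end oA sA (cent _ cZa i j) Ap.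
  by apply: is_derive_eq h _; rewrite (bZ _ _ Ap) mul1mx.
(* [u] takes [Z] at the height of [p] but [W] at height [y0], so both points have to be in [A]. *)
pose B := A `&` [set p | A (p.1, y0)].
have oB : open B.
  apply: openI => //; apply: (@open_comp _ _ (fun p : R * R => (p.1, y0)) A) => // p _.
  apply: (@cvg_pair _ _ _ _ (nbhs p.1) (nbhs y0)); [exact: cvg_fst|exact: cvg_cst].
have cu i j q l p : B p -> {for p, continuous (u i j q l)}.
  move=> [Aq1 Aq2]; apply: cvgM; first exact: cent.
  apply: (@continuous_comp _ _ _ (fun p : R * R => (p.1, y0)) (fun p => W p q j)).
    apply: (@cvg_pair _ _ _ _ (nbhs p.1) (nbhs y0)); [exact: cvg_fst|exact: cvg_cst].
  exact: cent.
have dI i j q l : is_derive y0 (1 : R) (I i j q l)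
    (oint (fun s => u i j q l (s, y0) * a2 (s, y0) l q) (c y0) x0).
  apply: (oint_param_derive oB (cu i j q l) (g := fun p => a p l q) (g2 := fun p => a2 p l q)).
  - by move=> p [Aq _]; apply: cent.
  - by move=> p [Aq _]; apply: cent.
  - by move=> p [Aq _]; apply: da2.
  - by move=> s ss; have := star_seg sA Ap ss; split.
have sy t := slice_open oA t.
have csl (f : R * R -> R) t : (forall p, A p -> {for p, continuous f}) ->
    forall s, A (s, t) -> {for s, continuous (fun s => f (s, t))}.
  by move=> cf s As; exact: (slice_cont cf As).
have dsum (F : 'I_n -> 'I_n -> R -> R) (S : set R) (oS : open S) :
    (forall q l s, S s -> {for s, continuous (F q l)}) ->
    (forall s, seg (c y0) x0 s -> S s) ->
    oint (fun s => \sum_q \sum_l F q l s) (c y0) x0 = \sum_q \sum_l oint (F q l) (c y0) x0.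
  move=> cF sS; rewrite (oint_sum _ oS) //.
    by apply: eq_bigr => q _; rewrite (oint_sum _ oS (cF q) sS).
  move=> q s Ss; rewrite /prop_for /continuous_at.
  by apply: cvg_big => [|l _]; [exact: add_continuous|exact: cF].
have dH : is_derive y0 (1 : R) H (\matrix_(i, j) Jop c (fun q => Kf q i j) (x0, y0)).
  apply/is_derive_mxP => i j; under eq_fun do rewrite mxE; rewrite mxE.
  rewrite (_ : (fun t => _) = \sum_q \sum_l I i j q l); last first.
    by apply/funext => t; rewrite fct_sumE; apply: eq_bigr => q _; rewrite fct_sumE.
  have hs := is_derive_sum (fun q => is_derive_sum (dI i j q)).
  apply: is_derive_eq hs _; rewrite /Jop /Kf /=.
  rewrite (eq_oint (g := fun s => \sum_q \sum_l u i j q l (s, y0) * a2 (s, y0) l q)).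
    apply/esym; apply: (dsum (fun q l s => u i j q l (s, y0) * a2 (s, y0) l q) _ (sy y0) _
      (star_seg sA Ap)) => q l s As.
     apply: cvgM; last exact: (csl _ _ (cent _ ca2 l q) s As).
    exact: (cont_fst (cu i j q l (s, y0) (conj As As))).
  move=> s ss; rewrite mxE; apply: eq_bigr => q _; rewrite mxE big_distrl /=.
  by apply: eq_bigr => l _; rewrite /u /=; ring.
have dV : is_derive y0 (1 : R) V (- k *: a (c y0, y0)
    + \matrix_(i, j) Jop c (fun q => Kf q i j) (x0, y0)).
  have h := is_deriveD (is_derive_cst (1%:M : 'M[R]_n) y0 (1 : R)) (is_deriveD dE dH).
  rewrite add0r in h; apply: near_eq_is_derive h.
  have [r1 r10 h1] := seg_nbhs oA (star_seg sA Ap).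
  have [r2 r20 h2] := Jop_split oA sA (f := fun=> 0) (fun p _ => cvg_cst _) Ap ltr01.
  near=> t.
  have ty1 : `|t - y0| < r1 by rewrite distrC; near: t; exact: (cvgrPdist_lt _ _).1 cvg_id _ r10.
  have ty2 : `|t - y0| < r2 by rewrite distrC; near: t; exact: (cvgrPdist_lt _ _).1 cvg_id _ r20.
  have A1 := h1 t ty1.
  have [|_ _ A2 _ _] := h2 x0 t _ ty2; first by rewrite subrr normr0.
  have At := A1 _ (seg_r _ _).
  apply/matrixP => i j.
  (* The x-equation integrated between the two base points [c t] and [c y0], with [Z = 1] at
     [c t]. *)
  have E1 : Z (c y0, t) i j = (1%:M : 'M[R]_n) i j + E t i j.
    rewrite -(bZ _ _ At) [E t i j]mxE; apply/eqP; rewrite addrC -subr_eq; apply/eqP/esym.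
    apply: (oint_primitive (F := fun s => Z (s, t) i j) (sy t) (csl _ t (cent _ cZa i j)) (fun s ss => (A2 s ss).1)).
    move=> s ss; move: i j; apply/is_derive_mxP; exact: dZ (A2 s ss).1.
  (* The fundamental theorem for [Z (s, t) *m W (s, y0)] as a function of [s]; at [s = c y0] it
     equals [Z (c y0, t)]. *)
  have E2 : H t i j = V t i j - Z (c y0, t) i j.
    pose S := [set s | A (s, t)] `&` [set s | A (s, y0)].
    have oS : open S by exact: openI.
    have SS s : seg (c y0) x0 s -> S s by move=> ss; have := star_seg sA Ap ss; split; first exact: A1.
    have cS q l s : S s -> {for s, continuous (fun s => u i j q l (s, t) * (a (s, t) l q - a (s, y0) l q))}.
      move=> [s1 s2]; apply: cvgM; first exact: (cont_fst (cu i j q l (s, t) (conj s1 s2))).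
      by apply: cvgB; [exact: (csl _ _ (cent _ ca l q) s s1)|exact: (csl _ _ (cent _ ca l q) s s2)].
    rewrite mxE -(dsum _ S) //.
    have := bZ _ _ Ap; have := iZ _ Ac => + h; rewrite h mul1mx => h'.
    rewrite -[Z (c y0, t)]mulmx1 -h'.
    apply: (oint_primitive (F := fun s => (Z (s, t) *m W (s, y0)) i j) oS _ SS).
      move=> s Ss; rewrite /prop_for /continuous_at.
      by apply: cvg_big => [|q _]; [exact: add_continuous|];
        apply: cvg_big => [|l _]; [exact: add_continuous|exact: cS].
    move=> s /SS[s1 s2].
    have /is_derive_mxP/(_ i j) h3 := is_derive_mulmx (dZ _ _ s1) (dW _ _ s2).
    apply: is_derive_eq h3 _; rewrite mulmxN mulmxA -mulmxBl -mulmxBr mxE.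
    apply: eq_bigr => q _; rewrite mxE big_distrl /=.
    by apply: eq_bigr => l _; rewrite /u /= !mxE; ring.
  transitivity ((1%:M : 'M[R]_n) i j + (E t i j + H t i j)).
    by rewrite [LHS]mxE [X in _ + X = _]mxE.
  by rewrite addrA -E1 E2 addrC subrK.
rewrite (_ : (fun t => Z (x0, t)) = fun t => V t *m Z (x0, y0)); last first.
  by apply/funext => t; rewrite /V -mulmxA WZ // mulmx1.
exact: is_derive_mxmulr dV.
Unshelve. all: by end_near. Qed.

(** Neither partial derivative of [Z] contains a derivative of [Z] or [W]: it is [Z a] in x and
    variation of constants in y. So one order is gained at each step. *)
Lemma Ck_ode_step l : Ck l A Z -> Ck l A W -> Ck l.+1 A Z.
Proof.
move=> hZ hW; have [cZ cW dZ dW bZ iZ] := ZW.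
have hK : Ck l A Kf.
  by do 2![apply: Ck_mulmx => //]; exact/Ck_der/sa.
have h1 : Ck l A (fun p => Z p *m a p) by apply: Ck_mulmx => //; exact: sa.
have h2 : Ck l A ode_dsnd.
  apply: Ck_mulmx => //; apply/(Ck_mxP _ _ oA) => i j.
  have ha : Ck l A (fun p => a (c p.2, p.2) i j).
    exact: (Ck_base sA (f := fun p => a p i j) ((Ck_mxP _ _ oA).1 (sa l) i j)).
  have hJ : Ck l A (Jop c (fun q => Kf q i j)).
    exact: (Ck_Jop oA sA ((Ck_mxP _ _ oA).1 hK i j)).
  apply: (Ck_eq oA _ (CkD oA (CkM oA (Ck_cst l (- k) oA) ha) hJ)).
  by move=> p _; rewrite !mxE.
apply/(Ck_mxP _ _ oA) => i j.
apply: (Ck_partials (f1 := fun p => (Z p *m a p) i j) (f2 := fun p => ode_dsnd p i j)) => //.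
- by move=> p Ap; move: i j; apply/continuous_mxP/cZ.
- by move=> [x y] Ap; move: i j; apply/is_derive_mxP/dZ.
- by move=> [x y] Ap; move: i j; apply/is_derive_mxP/ode_derive_snd.
- by move: i j; apply/(Ck_mxP _ _ oA).
- by move: i j; apply/(Ck_mxP _ _ oA).
Qed.

End pair.

Lemma Ck_ode a Z W l : (forall l, Ck l A a) -> ode_pair a Z W ->
  Ck l A Z /\ Ck l A W.
Proof.
move=> sa ZW; elim: l => [|l [hZ hW]].
  by split; (split; last by []); [exact: op_contl ZW|exact: op_contr ZW].
have hZ' := Ck_ode_step sa ZW hZ hW; split; first exact hZ'.
have sa' r : Ck r A (fun p => - (a p)^T) by apply: CkN_mx => //; exact: Ck_trmx.
(* The inverse gains its order from the same lemma, applied to the transposed pair. *)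
have h := Ck_ode_step sa' (ode_pair_tr ZW) (Ck_trmx oA hW) (Ck_trmx oA hZ).
have h' := Ck_trmx oA h.
by refine (Ck_eq oA _ h') => p _; exact: trmxK.
Qed.

End smooth_dependence.

Section linear_ode_smooth.
Context {R : realType} (k d : R) (A : set (R * R)) (m mu : R -> R) (L : R) (n : nat).
Variable a : R * R -> 'M[R]_n.
Let c y := k * y + d.
Hypotheses (oA : open A) (sA : star c A).
Hypothesis dm : forall p, A p -> is_derive p.1 (1 : R) m (mu p.1).
Hypothesis mu0 : forall p, A p -> 0 <= mu p.1.
Hypothesis L0 : 0 < L.
Hypothesis sa : forall l, Ck l A a.
Hypothesis ba : forall p, A p -> forall i j, `|a p i j| <= L * mu p.1.

(** The inverse is the transpose of the solution with coefficient [- a^T]: the product [Z W] is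
    constant along horizontals and equal to 1 at the base. *)
Theorem lin_ode : exists Z W : R * R -> 'M[R]_n,
  [/\ ode_pair k d A a Z W, smooth A Z, smooth A W
    & forall p i j, A p -> `|Z p i j| <= 3 * weight k d m ((2 * n%:R + 1) * L) p].
Proof.
have ca p : A p -> {for p, continuous a} by exact: Ck_cont (sa 0) p.
have [Z [cZ dZ bZ nZ]] := lin_ode_cont oA sA dm mu0 L0 ca ba.
have ca' p : A p -> {for p, continuous (fun p => - (a p)^T)}.
  by move=> Ap; apply: cvgN; apply: continuous_trmx; exact: ca.
have ba' p : A p -> forall i j, `|(- (a p)^T) i j| <= L * mu p.1.
  by move=> Ap i j; rewrite !mxE normrN ba.
have [V [cV dV bV _]] := lin_ode_cont oA sA dm mu0 L0 ca' ba'.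
pose W p := (V p)^T.
have dW x y : A (x, y) -> is_derive x (1 : R) (fun s => W (s, y)) (- (a (x, y) *m W (x, y))).
  move=> Ap; have h := is_derive_trmx (dV _ _ Ap); apply: is_derive_eq h _.
  by rewrite mulmxN linearN /= trmx_mul trmxK.
have ZW : ode_pair k d A a Z W.
  have cW p : A p -> {for p, continuous W}.
    by move=> Ap; apply: continuous_trmx; exact: cV.
  refine (OdePair cZ cW dZ dW bZ _) => -[x y] Ap; apply/matrixP => i j.
  have -> : (1%:M : 'M[R]_n) = Z (c y, y) *m W (c y, y).
    by rewrite (bZ _ _ Ap) /W (bV _ _ Ap) trmx1 mulmx1.
  apply: (@seg_cst _ (fun s => (Z (s, y) *m W (s, y)) i j)) => s ss.
  have As := star_seg sA Ap ss.
  have /is_derive_mxP/(_ i j) h := is_derive_mulmx (dZ _ _ As) (dW _ _ As).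
  by apply: is_derive_eq h _; rewrite mulmxN mulmxA subrr mxE.
have h := Ck_ode oA sA _ sa ZW.
by exists Z, W; split; [exact: ZW|apply/smoothP => l; exact: (h l).1|
  apply/smoothP => l; exact: (h l).2|exact: nZ].
Qed.

End linear_ode_smooth.

(** * Exponential, sine and cosine *)

Section one_variable.
Context {R : realType}.

Lemma is_derive_dir (f : R -> R) (x v d : R) :
  is_derive x (1 : R) f d -> is_derive x v f (v * d).
Proof.
move=> df; rewrite mulrC.
exact: (@is_derive_chain _ _ f id x v d v df (is_derive_id x v)).
Qed.

Lemma Ck_build1 n (A : set R) (f f1 : R -> R) : open A ->
  (forall x, A x -> is_derive x (1 : R) f (f1 x)) -> Ck n A f1 -> Ck n.+1 A f.
Proof.
move=> oA df h1; apply: (@Ck_build _ _ _ n A f (fun v x : R => v * f1 x) oA).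
- by move=> x /df/is_derive_cont.
- by move=> v x /df/is_derive_dir; exact.
- by move=> v; apply: CkM => //; exact: Ck_cst.
Qed.

Lemma Ck_expR n : Ck n setT (@expR R).
Proof.
elim: n => [|n IH]; first by split=> // x _; exact: continuous_expR.
by apply: Ck_build1 (openT) _ IH => x _; exact: is_derive_expR.
Qed.

Lemma Ck_trigo n : Ck n setT (@cos R) /\ Ck n setT (@sin R).
Proof.
elim: n => [|n [IHc IHs]].
  by split; split=> // x _; [exact: continuous_cos|exact: continuous_sin].
split.
  apply: Ck_build1 (openT) _ (CkN openT IHs) => x _; exact: is_derive_cos.
apply: Ck_build1 (openT) _ IHc => x _; exact: is_derive_sin.
Qed.

(** The radius 2 is that of the exponents [2 * phi] for [|phi| <= 1]. *)
Lemma expR_lip (x y : R) : `|x| <= 2 -> `|y| <= 2 ->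
  `|expR x - expR y| <= expR 2 * `|x - y|.
Proof.
move=> x2 y2; have [s ss ->] := @mvt_seg _ expR expR y x (fun s _ => is_derive_expR s).
rewrite normrM ler_wpM2r // ger0_norm ?expR_ge0 // ler_expR.
by move: x2 y2 ss; rewrite !ler_norml /seg => /andP[? ?] /andP[? ?]; lra.
Qed.

Lemma expR_le2 (x : R) : `|x| <= 2 -> expR x <= expR 2.
Proof. by move=> x2; rewrite ler_expR (le_trans (ler_norm _)). Qed.

End one_variable.

(** * The Goursat problem *)

Section goursat.
Context {R : realType} (I : set R) (m mu b0 B1 B2 c1 c2 : R -> R).
Implicit Types (f g phi psi : R * R -> R) (p : R * R).
Hypotheses (oI : open I) (iI : is_interval I).
Hypothesis dm : forall x, I x -> is_derive x (1 : R) m (mu x).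
Hypothesis b0_le : forall x, I x -> `|b0 x| <= mu x.
Hypothesis B_le : forall x, I x -> `|B1 x| + `|B2 x| <= mu x.
Hypothesis c_le : forall x, I x -> `|c1 x| + `|c2 x| <= mu x.
Hypotheses (sb0 : smooth I b0) (sB1 : smooth I B1) (sB2 : smooth I B2).
Hypotheses (sc1 : smooth I c1) (sc2 : smooth I c2).

Let E : R := expR 2.
(* The iterates satisfy [|phi| <= 1], so [E = e^2] bounds the exponentials, and
   [E * eps = 1/4] makes Picard iteration on the strip a contraction. *)
Let eps : R := (4 * E)^-1.

(** The width is measured by [m], so it shrinks where the data are large: along every horizontal or
    vertical segment from the diagonal the integral of [mu] stays below [eps], even if [mu] is
    unbounded on [I]. *)
Definition strip : set (R * R) :=
  [set p | [/\ I p.1, I p.2 & `|m p.1 - m p.2| < (4 * expR 2)^-1]].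

Let E1 : 1 <= E.
Proof. by rewrite /E -expR0 ler_expR. Qed.

Let eps0 : 0 < eps.
Proof. by rewrite invr_gt0 mulr_gt0 // expR_gt0. Qed.

Let Eeps : E * eps = 4^-1.
Proof. by rewrite /eps; field; have := E1; lra. Qed.

Let eps_le : eps <= 4^-1.
Proof. by have := E1; have := eps0; have := Eeps; nra. Qed.

Lemma mu_ge0 x : I x -> 0 <= mu x.
Proof. by move=> /b0_le; apply: le_trans. Qed.

Lemma I_seg x y s : I x -> I y -> seg x y s -> I s.
Proof. by move=> Ix Iy /orP[]; [exact: iI Ix Iy _|exact: iI Iy Ix _]. Qed.

Lemma m_seg x y s : I x -> I y -> seg x y s -> `|m s - m x| <= `|m y - m x|.
Proof.
move=> Ix Iy; have Ixy t : seg x y t -> I t by exact: I_seg.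
apply: (@seg_mono _ m mu) => t /Ixy; [exact: dm|exact: mu_ge0].
Qed.

(** The diagonal, in the shape [k * y + d] of the results on [Jop]. *)
Let c (y : R) : R := 1 * y + 0.
Let cE y : c y = y. Proof. by rewrite /c mul1r addr0. Qed.

Let m_cont x : I x -> {for x, continuous m}.
Proof. by move=> /dm/is_derive_cont. Qed.

Lemma strip_open : open strip.
Proof.
rewrite openE => -[x y] [Ix Iy xy]; rewrite /interior /=.
have mx : {for (x, y), continuous (fun p : R * R => m p.1 - m p.2)}.
  apply: cvgB.
    by apply: (@continuous_comp _ _ _ (fun p : R * R => p.1) m); [exact: cvg_fst|exact: m_cont].
  by apply: (@continuous_comp _ _ _ (fun p : R * R => p.2) m); [exact: cvg_snd|exact: m_cont].
have nm : {for (x, y), continuous (fun p : R * R => `|m p.1 - m p.2|)}.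
  by apply: (@continuous_comp _ _ _ (fun p : R * R => m p.1 - m p.2) Num.norm) => //;
    exact: norm_continuous.
near=> p; split; near: p.
- exact: (cvg_fst (open_nbhs_nbhs (conj oI Ix))).
- exact: (cvg_snd (open_nbhs_nbhs (conj oI Iy))).
- exact: (cvgr_lt _ nm).
Unshelve. all: by end_near. Qed.

Lemma strip_sym x y : strip (x, y) -> strip (y, x).
Proof. by case=> Ix Iy h; split; rewrite //= distrC. Qed.

Lemma strip_star : star c strip.
Proof.
move=> x y s [Ix Iy xy]; rewrite cE => ss; split=> //=; first exact: (I_seg Iy Ix ss).
by apply: le_lt_trans (m_seg Iy Ix ss) _.
Qed.

Lemma strip_diag x : I x -> strip (x, x).
Proof. by move=> Ix; split=> //=; rewrite subrr normr0. Qed.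

(** The strip is symmetric, so integration in y from the diagonal is integration in x conjugated by
    the reflection. *)
Let swap (p : R * R) := (p.2, p.1).
Let Jx := Jop c.
Let Jy (f : R * R -> R) p := Jop c (f \o swap) (swap p).

Let swap_cont : continuous swap.
Proof. by move=> p; apply: (@cvg_pair _ _ _ _ (nbhs p.2) (nbhs p.1)); [exact: cvg_snd|exact: cvg_fst]. Qed.

Let strip_swap p : strip p -> strip (swap p).
Proof. by case: p => x y; exact: strip_sym. Qed.

Let cont_swap f : (forall p, strip p -> {for p, continuous f}) ->
  forall p, strip p -> {for p, continuous (f \o swap)}.
Proof.
move=> cf p sp; apply: continuous_comp; first exact: swap_cont.
exact/cf/strip_swap.
Qed.

Let Ck_swap n f : Ck n strip f -> Ck n strip (f \o swap).
Proof.
move=> hf; apply: (Ck_sub strip_swap).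
by apply: (Ck_affine (DL := swap)) => //; exact: swap_cont.
Qed.

Let Ck_Jy n f : Ck n strip f -> Ck n strip (Jy f).
Proof. by move=> hf; apply/Ck_swap/(Ck_Jop strip_open strip_star)/Ck_swap. Qed.

Let Jy_snd f x y : (forall p, strip p -> {for p, continuous f}) -> strip (x, y) ->
  is_derive y (1 : R) (fun t => Jy f (x, t)) (f (x, y)).
Proof.
move=> cf sp; exact: (Jop_fst strip_open strip_star (cont_swap cf) (strip_sym sp)).
Qed.

Let Jx_bound f K x y : 0 <= K -> (forall p, strip p -> {for p, continuous f}) ->
  (forall s, strip (s, y) -> `|f (s, y)| <= K * mu s) -> strip (x, y) ->
  `|Jx f (x, y)| <= K * eps.
Proof.
move=> K0 cf hf sp; rewrite /Jx /Jop /=.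
have sg := star_seg strip_star sp; have [Ix Iy h] := sp.
apply: (@le_trans _ _ `|K * m x - K * m (c y)|).
  apply: (oint_norm_le (g := fun s => K * m s) (dg := fun s => K * mu s)
    (slice_open strip_open y) (slice_cont cf (y := y)) sg).
    by move=> s /sg[Is _ _]; exact: is_deriveZ (dm Is).
  by move=> s /sg; exact: hf.
by rewrite cE -mulrBr normrM ger0_norm // ler_wpM2l // ltW.
Qed.

Let Jy_bound f K x y : 0 <= K -> (forall p, strip p -> {for p, continuous f}) ->
  (forall t, strip (x, t) -> `|f (x, t)| <= K * mu t) -> strip (x, y) ->
  `|Jy f (x, y)| <= K * eps.
Proof.
move=> K0 cf hf sp; apply: (Jx_bound K0 (cont_swap cf)); last exact: strip_sym.
by move=> s /strip_sym; exact: hf.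
Qed.

Definition goursat_rhs (phi : R * R -> R) (p : R * R) : R :=
  B2 p.1 * c1 p.2 * expR (2 * phi p) - B1 p.1 * c2 p.2 * expR (- (2 * phi p)).

(** The x-derivative of the next iterate: integration in y from the diagonal builds in the value
    [b0] of phi_x there, and the integration in x that follows builds in the value 0 of phi. *)
Let Bop phi p := b0 p.1 + Jy (goursat_rhs phi) p.
Let Tp phi := Jx (Bop phi).

Lemma Ck_fst n (f : R -> R) : smooth I f -> Ck n strip (fun p => f p.1).
Proof.
move=> /smoothP/(_ n) hf; apply: (@Ck_sub _ _ _ _ _ (fst @^-1` I)); first by move=> p [].
by apply: (Ck_affine (L := fst) (DL := fst)) => // p; exact: cvg_fst.
Qed.

Lemma Ck_snd n (f : R -> R) : smooth I f -> Ck n strip (fun p => f p.2).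
Proof.
move=> /smoothP/(_ n) hf; apply: (@Ck_sub _ _ _ _ _ (snd @^-1` I)); first by move=> p [].
by apply: (Ck_affine (L := snd) (DL := snd)) => // p; exact: cvg_snd.
Qed.

Let oS := strip_open.

Let Ck_rhs n phi : Ck n strip phi -> Ck n strip (goursat_rhs phi).
Proof.
move=> hphi; have h2 : Ck n strip (fun p => 2 * phi p) by apply: CkM => //; exact: Ck_cst.
apply: CkB => //; apply: CkM => //; try by apply: CkM => //; (exact: Ck_fst || exact: Ck_snd).
  by apply: (Ck_comp oS (Ck_expR n)).
by apply: (Ck_comp oS (Ck_expR n)); exact: CkN.
Qed.

Let Ck_Bop n phi : Ck n strip phi -> Ck n strip (Bop phi).
Proof. by move=> h; apply: CkD => //; [exact: Ck_fst|exact/Ck_Jy/Ck_rhs]. Qed.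

Let C0 phi : (forall p, strip p -> {for p, continuous phi}) <-> Ck 0 strip phi.
Proof. by split=> [|[]]. Qed.

Let rhs_bound phi p : strip p -> `|phi p| <= 1 ->
  `|goursat_rhs phi p| <= E * mu p.1 * mu p.2.
Proof.
move=> [I1 I2 _] hphi; have h2 : `|2 * phi p| <= 2 by rewrite normrM ger0_norm //; lra.
have e1 := expR_le2 h2; have e2 : expR (- (2 * phi p)) <= E by rewrite expR_le2 ?normrN.
rewrite (le_trans (ler_normB _ _)) // !normrM !(ger0_norm (expR_ge0 _)).
apply: (@le_trans _ _ (E * ((`|B1 p.1| + `|B2 p.1|) * (`|c1 p.2| + `|c2 p.2|)))).
  have n1 := normr_ge0 (B1 p.1); have n2 := normr_ge0 (B2 p.1).
  have n3 := normr_ge0 (c1 p.2); have n4 := normr_ge0 (c2 p.2).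
  have k1 := mulr_ge0 n2 n3; have k2 := mulr_ge0 n1 n4.
  have k3 := mulr_ge0 n1 n3; have k4 := mulr_ge0 n2 n4.
  have k5 := ler_wpM2l k1 e1; have k6 := ler_wpM2l k2 e2.
  have k7 : 0 <= E * (`|B1 p.1| * `|c1 p.2|) by rewrite mulr_ge0 // expR_ge0.
  have k8 : 0 <= E * (`|B2 p.1| * `|c2 p.2|) by rewrite mulr_ge0 // expR_ge0.
  rewrite -/E in k5; lra.
rewrite -mulrA ler_wpM2l ?expR_ge0 // ler_pM ?addr_ge0 //; [exact: B_le|exact: c_le].
Qed.

Let rhs_lip phi psi p K : strip p -> `|phi p| <= 1 -> `|psi p| <= 1 ->
  `|phi p - psi p| <= K ->
  `|goursat_rhs phi p - goursat_rhs psi p| <= 2 * E * K * mu p.1 * mu p.2.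
Proof.
move=> [I1 I2 _] h1 h2 hK; have K0 : 0 <= K by exact: le_trans hK.
have h1' : `|2 * phi p| <= 2 by rewrite normrM ger0_norm //; lra.
have h2' : `|2 * psi p| <= 2 by rewrite normrM ger0_norm //; lra.
have e0 : 2 * `|phi p - psi p| = `|2 * phi p - 2 * psi p|.
  by rewrite -mulrBr normrM ger0_norm.
have e1 : `|expR (2 * phi p) - expR (2 * psi p)| <= 2 * E * K.
  apply: le_trans (expR_lip h1' h2') _; rewrite -e0 -/E; have := E1; nra.
have e2 : `|expR (- (2 * phi p)) - expR (- (2 * psi p))| <= 2 * E * K.
  apply: le_trans (expR_lip _ _) _; rewrite ?normrN // -opprD normrN -e0 -/E; have := E1; nra.
rewrite /goursat_rhs (_ : _ - _ = B2 p.1 * c1 p.2 * (expR (2 * phi p) - expR (2 * psi p))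
   - B1 p.1 * c2 p.2 * (expR (- (2 * phi p)) - expR (- (2 * psi p)))); last by ring.
rewrite (le_trans (ler_normB _ _)) // !normrM.
apply: (@le_trans _ _ (2 * E * K * ((`|B1 p.1| + `|B2 p.1|) * (`|c1 p.2| + `|c2 p.2|)))).
  have n1 := normr_ge0 (B1 p.1); have n2 := normr_ge0 (B2 p.1).
  have n3 := normr_ge0 (c1 p.2); have n4 := normr_ge0 (c2 p.2).
  have k1 := mulr_ge0 n2 n3; have k2 := mulr_ge0 n1 n4.
  have k3 := mulr_ge0 n1 n3; have k4 := mulr_ge0 n2 n4.
  have k5 := ler_wpM2l k1 e1; have k6 := ler_wpM2l k2 e2.
  have k0 : 0 <= 2 * E * K by rewrite !mulr_ge0 // expR_ge0.
  have k7 := mulr_ge0 k0 k3; have k8 := mulr_ge0 k0 k4.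
  lra.
have k0 : 0 <= 2 * E * K by rewrite !mulr_ge0 // expR_ge0.
by rewrite -[X in _ <= X]mulrA ler_wpM2l ?ler_pM ?addr_ge0 ?B_le ?c_le.
Qed.

(** [b0] contributes [mu] and the integral in y at most [E * eps * mu = mu / 4]. Integration in x
    then gives at most [2 * eps], so [|phi| <= 1] is preserved. *)
Let Bop_bound phi p : (forall q, strip q -> {for q, continuous phi}) ->
  (forall q, strip q -> `|phi q| <= 1) -> strip p -> `|Bop phi p| <= 2 * mu p.1.
Proof.
move=> /C0 cphi hphi; case: p => x y sp; have [Ix Iy _] := sp.
have m0 := mu_ge0 Ix.
have h : `|Jy (goursat_rhs phi) (x, y)| <= E * mu x * eps.
  apply: Jy_bound => //.
  - by rewrite mulr_ge0 // expR_ge0.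
  - exact/C0/Ck_rhs.
  - by move=> t st; apply: rhs_bound st (hphi _ st).
rewrite /Bop (le_trans (ler_normD _ _)) //=.
have := b0_le Ix; have : E * mu x * eps = 4^-1 * mu x by rewrite mulrAC Eeps.
lra.
Qed.

Let Tp_bound phi p : (forall q, strip q -> {for q, continuous phi}) ->
  (forall q, strip q -> `|phi q| <= 1) -> strip p -> `|Tp phi p| <= 1.
Proof.
move=> cphi hphi; case: p => x y sp.
have h : `|Tp phi (x, y)| <= 2 * eps.
  apply: Jx_bound => //; first exact/C0/Ck_Bop/C0.
  by move=> s ss; exact: (Bop_bound cphi hphi ss).
by apply: le_trans h _; have := eps_le; lra.
Qed.

Let Jop_sub f g x y : (forall q, strip q -> {for q, continuous f}) ->
  (forall q, strip q -> {for q, continuous g}) -> strip (x, y) ->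
  Jx f (x, y) - Jx g (x, y) = Jx (fun q => f q - g q) (x, y).
Proof.
move=> cf cg sp; rewrite /Jx /Jop /= (ointB (slice_open oS y)) //.
- by move=> s Ss; exact: (slice_cont cf Ss).
- by move=> s Ss; exact: (slice_cont cg Ss).
- exact: (star_seg strip_star sp).
Qed.

(** Integration in y turns the Lipschitz bound into [2 * E * eps * K * mu = K * mu / 2], integration
    in x adds a factor [eps]. *)
Let Tp_contract phi psi K p : 0 <= K ->
  (forall q, strip q -> {for q, continuous phi}) ->
  (forall q, strip q -> {for q, continuous psi}) ->
  (forall q, strip q -> `|phi q| <= 1) -> (forall q, strip q -> `|psi q| <= 1) ->
  (forall q, strip q -> `|phi q - psi q| <= K) ->
  strip p -> `|Tp phi p - Tp psi p| <= K * 2^-1.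
Proof.
move=> K0 c1' c2' h1 h2 hK; case: p => x y sp.
have k1 : Ck 0 strip (goursat_rhs phi) by apply/Ck_rhs/C0.
have k2 : Ck 0 strip (goursat_rhs psi) by apply/Ck_rhs/C0.
have k3 : Ck 0 strip (Bop phi) by apply/Ck_Bop/C0.
have k4 : Ck 0 strip (Bop psi) by apply/Ck_Bop/C0.
rewrite /Tp Jop_sub //; [|exact/C0|exact/C0].
apply: (@le_trans _ _ (2^-1 * K * eps)); last first.
  by have := eps_le; have := eps0; nra.
apply: Jx_bound => //; first by rewrite mulr_ge0.
  by apply/C0; exact: CkB.
move=> s ss; have [Is _ _] := ss; have m0 := mu_ge0 Is.
rewrite /Bop opprD addrACA subrr add0r.
have -> : Jy (goursat_rhs phi) (s, y) - Jy (goursat_rhs psi) (s, y)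
   = Jy (fun q => goursat_rhs phi q - goursat_rhs psi q) (s, y).
  by apply: Jop_sub; [apply/cont_swap/C0|apply/cont_swap/C0|exact: strip_sym].
apply: (@le_trans _ _ (2 * E * K * mu s * eps)); last first.
  have -> : 2 * E * K * mu s * eps = 2 * (E * eps) * K * mu s by ring.
  rewrite Eeps; have := mulr_ge0 K0 m0; lra.
apply: Jy_bound => //.
- by rewrite !mulr_ge0 // expR_ge0.
- by apply/C0; exact: CkB.
- by move=> t st; apply: rhs_lip; auto.
Qed.

(** For the fixed point, phi_x is [Bop phi], and phi_y follows from Leibniz' rule, with the term
    [- b (y, y)] from the moving base point. Both are of the same class as phi, so its regularity
    increases step by step. *)
Theorem goursat : exists phi b : R * R -> R,
  [/\ smooth strip phi /\ smooth strip b,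
      forall x y, strip (x, y) -> is_derive x (1 : R) (fun s => phi (s, y)) (b (x, y)),
      forall x y, strip (x, y) ->
        is_derive y (1 : R) (fun t => b (x, t)) (goursat_rhs phi (x, y)),
      forall x, I x -> phi (x, x) = 0 /\ b (x, x) = b0 x
    & forall p, strip p -> `|phi p| <= 1 /\ `|b p| <= 2 * mu p.1].
Proof.
pose un l := iter l Tp (fun=> 0).
have inv l : (forall q, strip q -> {for q, continuous (un l)}) /\
    (forall q, strip q -> `|un l q| <= 1).
  elim: l => [|l [IH1 IH2]].
    by split=> q _; [exact: cvg_cst|rewrite normr0].
  split=> q sq; last exact: Tp_bound.
  by apply: (Jop_cont strip_open strip_star _ sq); exact/C0/Ck_Bop/C0.
have e0 l : 0 <= 2^-1 ^+ l :> R by rewrite exprn_ge0.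
have hu l p : strip p -> `|un l.+1 p - un l p| <= 2^-1 ^+ l * (fun=> 1) p.
  rewrite mulr1; elim: l p => [|l IH] p sp; first by rewrite subr0 expr0; exact: (inv 1%N).2.
  rewrite exprSr; exact: (Tp_contract (e0 l) (inv l.+1).1 (inv l).1 (inv l.+1).2 (inv l).2 IH sp).
pose phi p := lim (un l p @[l --> \oo]).
have hd l p : strip p -> `|phi p - un l p| <= 2 * 2^-1 ^+ l.
  by move=> sp; have := iter_lim_dist hu l sp; rewrite mulr1.
have cphi p : strip p -> {for p, continuous phi}.
  move=> sp; apply: (iter_lim_cont oS hu) => // [q _|l]; first exact: cvg_cst.
  exact: (inv l).1.
have bphi p : strip p -> `|phi p| <= 1.
  move=> sp; apply/ler_addgt0Pl => e e0'.
  have [l hl] := half_pow_lt 2 e0'.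
  have h1 := hd l p sp; have h2 := (inv l).2 p sp.
  rewrite -(subrK (un l p) (phi p)) (le_trans (ler_normD _ _)) // lerD //.
  by rewrite (le_trans h1) // ltW.
have fixphi p : strip p -> phi p = Tp phi p.
  move=> sp; apply/eqP; rewrite -subr_eq0; apply/eqP.
  apply: (@half_pow_0 _ 2) => l.
  rewrite -(subrKA (un l.+1 p)) (le_trans (ler_normD _ _)) //.
  have h1 := hd l.+1 p sp.
  have h2 : `|Tp (un l) p - Tp phi p| <= 2 * 2^-1 ^+ l * 2^-1.
    apply: (Tp_contract _ (inv l).1 cphi (inv l).2 bphi _ sp); first by rewrite mulr_ge0.
    by move=> q sq; rewrite distrC hd.
  have -> : 2 * 2^-1 ^+ l = 2 * 2^-1 ^+ l.+1 + 2 * 2^-1 ^+ l * 2^-1 :> R.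
    by rewrite exprS; field.
  exact: lerD.
pose b := Bop phi.
have sb l : Ck l strip phi -> Ck l strip b by exact: Ck_Bop.
have cb p : strip p -> {for p, continuous b} by move: p; apply/C0/sb/C0.
have cg p : strip p -> {for p, continuous (goursat_rhs phi)}.
  by move: p; apply/C0/Ck_rhs/C0.
have dx x y : strip (x, y) -> is_derive x (1 : R) (fun s => phi (s, y)) (b (x, y)).
  move=> sp; have h := Jop_fst oS strip_star cb sp.
  apply: near_eq_is_derive h.
  by apply: filterS (open_nbhs_nbhs (conj (slice_open oS y) sp)) => s /fixphi.
have dby x y : strip (x, y) ->
    is_derive y (1 : R) (fun t => b (x, t)) (goursat_rhs phi (x, y)).
  move=> sp; have := is_deriveD (is_derive_cst (b0 x) y (1 : R)) (Jy_snd cg sp).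
  by rewrite add0r.
have dy x y : strip (x, y) -> is_derive y (1 : R) (fun t => phi (x, t))
    (Jx (goursat_rhs phi) (x, y) - 1 * b (c y, y)).
  have dB p : strip p -> is_derive p.2 (1 : R) (fun t => b (p.1, t)) (goursat_rhs phi p).
    by case: p => ? ? /dby.
  move=> sp; have h := Jop_snd oS strip_star cb cg dB sp.
  apply: near_eq_is_derive h.
  by apply: filterS (open_nbhs_nbhs (conj (open_snd (x := x) oS) sp)) => s /fixphi.
have sphi l : Ck l strip phi.
  elim: l => [|l IH]; first exact/C0.
  have hb := sb _ IH.
  have h2 : Ck l strip (fun p => Jx (goursat_rhs phi) p - 1 * b (c p.2, p.2)).
    apply: (CkB oS (Ck_Jop oS strip_star (Ck_rhs IH))).
    exact: (CkM oS (Ck_cst l (1 : R) oS) (Ck_base strip_star hb)).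
  have hx q : strip q -> is_derive q.1 (1 : R) (fun s => phi (s, q.2)) (b q) by case: q.
  have hy q : strip q -> is_derive q.2 (1 : R) (fun t => phi (q.1, t))
    (Jx (goursat_rhs phi) q - 1 * b (c q.2, q.2)) by case: q.
  exact: (Ck_partials oS cphi hx hy hb h2).
exists phi, b; split=> //.
- by split; apply/smoothP => // l; exact: sb.
- move=> x Ix; have sx := strip_diag Ix; split.
    by rewrite fixphi // /Tp /Jx -{1}(cE x) Jop_diag.
  by rewrite /b /Bop /Jy /swap /= -{2}(cE x) Jop_diag addr0.
- by move=> p sp; split; [exact: bphi|exact: Bop_bound].
Qed.

End goursat.

(** * Complex matrices and equations in SL(2) *)

Section complex_parts.
Context {R : realType}.
Local Notation C := R[i].
Local Notation re := (@complex.Re R).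
Local Notation im := (@complex.Im R).
Implicit Types (x y : C) (A B : 'M[C]_2).

Lemma cReD x y : re (x + y) = re x + re y. Proof. by case: x y => ? ? []. Qed.
Lemma cImD x y : im (x + y) = im x + im y. Proof. by case: x y => ? ? []. Qed.
Lemma cReN x : re (- x) = - re x. Proof. by case: x. Qed.
Lemma cImN x : im (- x) = - im x. Proof. by case: x. Qed.
Lemma cReM x y : re (x * y) = re x * re y - im x * im y.
Proof. by case: x y => ? ? []. Qed.
Lemma cImM x y : im (x * y) = re x * im y + im x * re y.
Proof. by case: x y => ? ? []. Qed.

Lemma eqC x y : re x = re y -> im x = im y -> x = y.
Proof. by case: x y => ? ? [? ?] /= -> ->. Qed.

Lemma eq_reim A B : reM A = reM B -> imM A = imM B -> A = B.
Proof.
move=> /matrixP hr /matrixP hi; apply/matrixP => i j.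
by apply: eqC; [move: (hr i j)|move: (hi i j)]; rewrite !mxE.
Qed.

Definition mkC (U V : 'M[R]_2) : 'M[C]_2 := \matrix_(i, j) (U i j +i* V i j).

Lemma reM_mkC U V : reM (mkC U V) = U.
Proof. by apply/matrixP => i j; rewrite !mxE. Qed.
Lemma imM_mkC U V : imM (mkC U V) = V.
Proof. by apply/matrixP => i j; rewrite !mxE. Qed.

Lemma mkCE A : toC (reM A) + 'i%C *: toC (imM A) = A.
Proof.
apply: eq_reim; apply/matrixP => i j; rewrite !mxE.
  by rewrite cReD cReM /= mul0r mul1r subr0 ?subrr ?oppr0 addr0.
by rewrite cImD cImM /= mul0r mul1r !add0r.
Qed.

Lemma reM_mul A B : reM (A *m B) = reM A *m reM B - imM A *m imM B.
Proof.
apply/matrixP => i j; rewrite !mxE !big_ord_recl !big_ord0 !mxE /= !cReD !cReM /=; ring.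
Qed.

Lemma imM_mul A B : imM (A *m B) = reM A *m imM B + imM A *m reM B.
Proof.
apply/matrixP => i j; rewrite !mxE !big_ord_recl !big_ord0 !mxE /= !cImD !cImM /=; ring.
Qed.

Lemma reMD A B : reM (A + B) = reM A + reM B.
Proof. by apply/matrixP => i j; rewrite !mxE cReD. Qed.
Lemma imMD A B : imM (A + B) = imM A + imM B.
Proof. by apply/matrixP => i j; rewrite !mxE cImD. Qed.
Lemma reMN A : reM (- A) = - reM A.
Proof. by apply/matrixP => i j; rewrite !mxE cReN. Qed.
Lemma imMN A : imM (- A) = - imM A.
Proof. by apply/matrixP => i j; rewrite !mxE cImN. Qed.
Lemma reMZ x A : reM (x *: A) = re x *: reM A - im x *: imM A.
Proof. by apply/matrixP => i j; rewrite !mxE cReM. Qed.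
Lemma imMZ x A : imM (x *: A) = re x *: imM A + im x *: reM A.
Proof. by apply/matrixP => i j; rewrite !mxE cImM. Qed.
Lemma reM_toC (U : 'M[R]_2) : reM (toC U) = U.
Proof. by apply/matrixP => i j; rewrite !mxE. Qed.
Lemma imM_toC (U : 'M[R]_2) : imM (toC U) = 0.
Proof. by apply/matrixP => i j; rewrite !mxE. Qed.
Lemma reM1 : reM (1%:M : 'M[C]_2) = 1%:M.
Proof. by apply/matrixP => i j; rewrite !mxE; case: (i == j). Qed.
Lemma imM1 : imM (1%:M : 'M[C]_2) = 0.
Proof. by apply/matrixP => i j; rewrite !mxE; case: (i == j). Qed.

Lemma toC_mul (U V : 'M[R]_2) : toC (U *m V) = toC U *m toC V.
Proof. exact: map_mxM. Qed.

Section cder.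
Context {V : normedModType R}.
Implicit Types (f g : V -> 'M[C]_2) (p v : V).

(** A relation that also asserts existence, whereas [cderive] has a value even where the derivatives
    do not exist. *)
Definition cder f p v (D : 'M[C]_2) : Prop :=
  is_derive p v (@reM R \o f) (reM D) /\ is_derive p v (@imM R \o f) (imM D).

Lemma cder_val f p v D : cder f p v D -> cderive f p v = D.
Proof. by case=> [[_ h1] [_ h2]]; rewrite /cderive h1 h2 mkCE. Qed.

Lemma cder_smooth (A : set V) f p v : csmooth A f -> A p -> cder f p v (cderive f p v).
Proof.
case=> /smoothP/(_ 1%N) h1 /smoothP/(_ 1%N) h2 Ap.
have E (U W : 'M[R]_2) : reM (toC U + 'i%C *: toC W) = U /\
    imM (toC U + 'i%C *: toC W) = W.
  rewrite reMD imMD reMZ imMZ !reM_toC !imM_toC /= !scale0r !scale1r.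
  by rewrite subr0 addr0 !add0r.
split; rewrite /cderive.
  by rewrite (E _ _).1; exact: Ck_is_derive h1 Ap.
by rewrite (E _ _).2; exact: Ck_is_derive h2 Ap.
Qed.

Lemma cder_cst (D : 'M[C]_2) p v : cder (fun=> D) p v 0.
Proof.
split.
  by apply: is_derive_eq (is_derive_cst (reM D) p v) _; apply/matrixP => i j; rewrite !mxE.
by apply: is_derive_eq (is_derive_cst (imM D) p v) _; apply/matrixP => i j; rewrite !mxE.
Qed.

Lemma cder_mul f g p v Df Dg : cder f p v Df -> cder g p v Dg ->
  cder (fun q => f q *m g q) p v (Df *m g p + f p *m Dg).
Proof.
move=> [fr fi] [gr gi].
have h1 := is_deriveB (is_derive_mulmx fr gr) (is_derive_mulmx fi gi).
have h2 := is_deriveD (is_derive_mulmx fr gi) (is_derive_mulmx fi gr).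
split.
  rewrite (_ : _ \o _ = (fun q => reM (f q) *m reM (g q)) - (fun q => imM (f q) *m imM (g q))).
    by apply: is_derive_eq h1 _; rewrite reMD !reM_mul /= opprD addrACA.
  by apply/funext => q /=; rewrite reM_mul.
rewrite (_ : _ \o _ = (fun q => reM (f q) *m imM (g q)) + (fun q => imM (f q) *m reM (g q))).
  by apply: is_derive_eq h2 _; rewrite imMD !imM_mul /= addrACA.
by apply/funext => q /=; rewrite imM_mul.
Qed.

Lemma cder_entries f p v D i j : cder f p v D ->
  is_derive p v (fun q => re (f q i j)) (re (D i j)) /\
  is_derive p v (fun q => im (f q i j)) (im (D i j)).
Proof.
move=> [/is_derive_mxP/(_ i j) h1 /is_derive_mxP/(_ i j) h2]; split.
  have E : (fun q => (@reM R \o f) q i j) = (fun q => re (f q i j)).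
    by apply/funext => q; rewrite mxE.
  by move: h1; rewrite E mxE.
have E : (fun q => (@imM R \o f) q i j) = (fun q => im (f q i j)).
  by apply/funext => q; rewrite mxE.
by move: h2; rewrite E mxE.
Qed.

Lemma cder_eq f p v D D' : cder f p v D -> D = D' -> cder f p v D'.
Proof. by move=> h <-. Qed.

Lemma cderD f g p v Df Dg : cder f p v Df -> cder g p v Dg ->
  cder (fun q => f q + g q) p v (Df + Dg).
Proof.
move=> [fr fi] [gr gi]; split.
  by rewrite (_ : _ \o _ = (@reM R \o f) + (@reM R \o g)) ?reMD;
    [exact: is_deriveD|apply/funext => q /=; rewrite reMD].
by rewrite (_ : _ \o _ = (@imM R \o f) + (@imM R \o g)) ?imMD;
  [exact: is_deriveD|apply/funext => q /=; rewrite imMD].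
Qed.

Lemma cderN f p v Df : cder f p v Df -> cder (fun q => - f q) p v (- Df).
Proof.
move=> [fr fi]; split.
  by rewrite (_ : _ \o _ = - (@reM R \o f)) ?reMN;
    [exact: is_deriveN|apply/funext => q /=; rewrite reMN].
by rewrite (_ : _ \o _ = - (@imM R \o f)) ?imMN;
  [exact: is_deriveN|apply/funext => q /=; rewrite imMN].
Qed.

Lemma cderMl (D : 'M[C]_2) f p v Df : cder f p v Df ->
  cder (fun q => D *m f q) p v (D *m Df).
Proof.
by move=> h; apply: cder_eq (cder_mul (cder_cst D p v) h) _; rewrite mul0mx add0r.
Qed.

Lemma cderMr (D : 'M[C]_2) f p v Df : cder f p v Df ->
  cder (fun q => f q *m D) p v (Df *m D).
Proof.
by move=> h; apply: cder_eq (cder_mul h (cder_cst D p v)) _; rewrite mulmx0 addr0.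
Qed.

Lemma cderZ (x : C) f p v Df : cder f p v Df -> cder (fun q => x *: f q) p v (x *: Df).
Proof.
move=> h; rewrite (_ : (fun q => _) = fun q => x%:M *m f q).
  by apply: cder_eq (cderMl _ h) _; rewrite mul_scalar_mx.
by apply/funext => q; rewrite mul_scalar_mx.
Qed.

End cder.

Lemma cder_seg_cst (f : R -> 'M[C]_2) a b :
  (forall s, seg a b s -> cder f s 1 0) -> f b = f a.
Proof.
move=> h; apply: eq_reim; apply/matrixP => i j.
  apply: (@seg_cst _ (fun s => (reM (f s)) i j)) => s /h[h1 _].
  have /is_derive_mxP/(_ i j) := h1; by rewrite !mxE.
apply: (@seg_cst _ (fun s => (imM (f s)) i j)) => s /h[_ h1].
have /is_derive_mxP/(_ i j) := h1; by rewrite !mxE.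
Qed.

End complex_parts.

(** * The adjugate as inverse in SL(2) *)

Section sharp.
Context {K : comUnitRingType}.
Implicit Types (A B : 'M[K]_2).

(** The adjugate, which is the inverse when the determinant is 1. Being linear in the entries for 2
    by 2 matrices, it commutes with derivatives and with real and imaginary parts. *)
Definition sharp A : 'M[K]_2 := mx2 (A 1 1) (- A 0 1) (- A 1 0) (A 0 0).

Lemma mx2P A B : A 0 0 = B 0 0 -> A 0 1 = B 0 1 -> A 1 0 = B 1 0 -> A 1 1 = B 1 1 ->
  A = B.
Proof.
move=> h00 h01 h10 h11; apply/matrixP => i j.
have z (k : 'I_2) : k = 0 \/ k = 1.
  by case: k => [[|[|//]] hk]; [left|right]; apply/val_inj.
by case: (z i) => ->; case: (z j) => ->.
Qed.

Lemma mulmx2E A B i j : (A *m B) i j = A i 0 * B 0 j + A i 1 * B 1 j.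
Proof.
rewrite mxE !big_ord_recl big_ord0 addr0; congr (_ * B _ _ + A _ _ * B _ _);
  by [|apply/val_inj].
Qed.

Lemma det2E A : \det A = A 0 0 * A 1 1 - A 0 1 * A 1 0.
Proof.
rewrite (expand_det_row _ 0) !big_ord_recl big_ord0 addr0 /cofactor !det_mx11 !mxE.
rewrite (_ : lift 0 0 = 1 :> 'I_2); last exact/val_inj.
rewrite (_ : lift 1 0 = 0 :> 'I_2); last exact/val_inj.
by rewrite /= expr0 expr1; ring.
Qed.

Lemma tr2 A : \tr A = A 0 0 + A 1 1.
Proof.
rewrite /mxtrace !big_ord_recl big_ord0 addr0.
by rewrite (_ : lift ord0 ord0 = 1) //; exact/val_inj.
Qed.

Lemma mul_sharp A : A *m sharp A = (\det A)%:M.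
Proof.
by rewrite det2E; apply: mx2P; rewrite mulmx2E !mxE /= ?mulr1n ?mulr0n; ring.
Qed.

Lemma sharpM A B : sharp (A *m B) = sharp B *m sharp A.
Proof. by apply: mx2P; rewrite mulmx2E ![sharp _ _ _]mxE /= !mulmx2E; ring. Qed.

Lemma sharpN A : \tr A = 0 -> sharp A = - A.
Proof.
rewrite tr2 => h; apply: mx2P; rewrite !mxE //=.
  by apply/eqP; rewrite -addr_eq0 addrC; apply/eqP.
by apply/eqP; rewrite -addr_eq0; apply/eqP.
Qed.

Lemma sharp_inv A : \det A = 1 -> A^-1 = sharp A.
Proof.
move=> dA; have h : A * sharp A = 1 by rewrite -mulmxE mul_sharp dA.
have uA : A \is a GRing.unit by rewrite -[_ \is a _]/(A \in unitmx) unitmxE dA unitr1.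
by rewrite -[LHS]mulr1 -h mulKr.
Qed.

Lemma mulKsharp A B : \det A = 1 -> A *m (sharp A *m B) = B.
Proof. by move=> dA; rewrite mulmxA mul_sharp dA mul1mx. Qed.

Lemma sharp_mul A : \det A = 1 -> sharp A *m A = 1%:M.
Proof. by move=> dA; apply: mulmx1C; rewrite mul_sharp dA. Qed.

Lemma sharp1 : sharp 1%:M = 1%:M.
Proof. by apply: mx2P; rewrite !mxE /= ?oppr0. Qed.

Lemma e3_sqr : e3 *m e3 = 1%:M :> 'M[K]_2.
Proof. by apply: mx2P; rewrite mulmx2E !mxE /=; ring. Qed.

Lemma e3_inv : (e3 : 'M[K]_2)^-1 = e3.
Proof.
have h : e3 * e3 = 1 :> 'M[K]_2 by exact: e3_sqr.
have u : (e3 : 'M[K]_2) \is a GRing.unit by apply/unitrP; exists e3.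
by apply: (mulrI u); rewrite divrr // h.
Qed.

Lemma Ad_e3 A :
  Ad e3 A = mx2 (A 0 0) (- A 0 1) (- A 1 0) (A 1 1).
Proof.
rewrite /Ad e3_inv; apply: mx2P; rewrite !mulmx2E !mxE /=; ring.
Qed.

Lemma det_sharp A : \det (sharp A) = \det A.
Proof. by rewrite !det2E !mxE /=; ring. Qed.

Lemma sharpK A : sharp (sharp A) = A.
Proof. by apply: mx2P; rewrite !mxE //= opprK. Qed.

End sharp.

Section sharp_calculus.
Context {R : realType} {V : normedModType R}.
Implicit Types (A : set V) (f : V -> 'M[R]_2).

Lemma Ck_sharp n A f : open A -> Ck n A f -> Ck n A (fun p => sharp (f p)).
Proof.
move=> oA /(Ck_mxP _ _ oA) h; apply/(Ck_mxP _ _ oA) => i j.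
case: i => [[|[|//]] hi]; case: j => [[|[|//]] hj].
- by apply: (Ck_eq oA _ (h 1 1)) => p _; rewrite mxE.
- by apply: (Ck_eq oA _ (CkN oA (h 0 1))) => p _; rewrite mxE.
- by apply: (Ck_eq oA _ (CkN oA (h 1 0))) => p _; rewrite mxE.
- by apply: (Ck_eq oA _ (h 0 0)) => p _; rewrite mxE.
Qed.

Lemma is_derive_sharp f p v D : is_derive p v f D ->
  is_derive p v (fun q => sharp (f q)) (sharp D).
Proof.
move=> /is_derive_mxP h; apply/is_derive_mxP => i j.
case: i => [[|[|//]] hi]; case: j => [[|[|//]] hj].
- rewrite (_ : (fun q => _) = fun q => f q 1 1); last by apply/funext => q; rewrite mxE.
  by apply: is_derive_eq (h 1 1) _; rewrite mxE.
- rewrite (_ : (fun q => _) = - fun q => f q 0 1); last by apply/funext => q; rewrite mxE.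
  by apply: is_derive_eq (is_deriveN (h 0 1)) _; rewrite mxE.
- rewrite (_ : (fun q => _) = - fun q => f q 1 0); last by apply/funext => q; rewrite mxE.
  by apply: is_derive_eq (is_deriveN (h 1 0)) _; rewrite mxE.
- rewrite (_ : (fun q => _) = fun q => f q 0 0); last by apply/funext => q; rewrite mxE.
  by apply: is_derive_eq (h 0 0) _; rewrite mxE.
Qed.

End sharp_calculus.

Lemma reM_sharp (R : realType) (M : 'M[R[i]]_2) : reM (sharp M) = sharp (reM M).
Proof. by apply: mx2P; rewrite !mxE //= ?cReN ?mxE. Qed.

Lemma imM_sharp (R : realType) (M : 'M[R[i]]_2) : imM (sharp M) = sharp (imM M).
Proof. by apply: mx2P; rewrite !mxE //= ?cImN ?mxE. Qed.

Section complex_ode.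
Context {R : realType} (k d : R) (A : set (R * R)) (m mu : R -> R) (L : R).
Local Notation C := R[i].
Variable a : R * R -> 'M[C]_2.
Let c y := k * y + d.
Hypotheses (oA : open A) (sA : star c A).
Hypothesis dm : forall p, A p -> is_derive p.1 (1 : R) m (mu p.1).
Hypothesis mu0 : forall p, A p -> 0 <= mu p.1.
Hypothesis L0 : 0 < L.
Hypothesis sa : csmooth A a.
Hypothesis ba : forall p, A p -> forall i j,
  `|complex.Re (a p i j)| <= L * mu p.1 /\ `|complex.Im (a p i j)| <= L * mu p.1.

(* Row vectors u + i v of C^2 are identified with real rows (u, v). *)
Theorem complex_lin_ode : exists E : R * R -> 'M[C]_2,
  [/\ csmooth A E,
      forall x y, A (x, y) -> cder (fun s => E (s, y)) x 1 (E (x, y) *m a (x, y)),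
      forall x y, A (x, y) -> E (c y, y) = 1%:M
    & forall p i j, A p ->
        `|complex.Re (E p i j)| <= 3 * weight k d m (9 * L) p /\
        `|complex.Im (E p i j)| <= 3 * weight k d m (9 * L) p].
Proof.
pose rho p : 'M[R]_(2 + 2) :=
  block_mx (reM (a p)) (imM (a p)) (- imM (a p)) (reM (a p)).
have sr l : Ck l A (fun p => reM (a p)) by have [/smoothP] := sa.
have si l : Ck l A (fun p => imM (a p)) by have [_ /smoothP] := sa.
have srho l : Ck l A rho.
  apply/(Ck_mxP _ _ oA) => i j.
  have hr i' j' := (Ck_mxP l (fun p => reM (a p)) oA).1 (sr l) i' j'.
  have hi i' j' := (Ck_mxP l (fun p => imM (a p)) oA).1 (si l) i' j'.
  rewrite /rho; case: (split_ordP i) => i' ->; case: (split_ordP j) => j' ->.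
  - apply: (Ck_eq oA _ (hr i' j')) => p _; by rewrite block_mxEul.
  - apply: (Ck_eq oA _ (hi i' j')) => p _; by rewrite block_mxEur.
  - apply: (Ck_eq oA _ (CkN oA (hi i' j'))) => p _; by rewrite block_mxEdl [RHS]mxE.
  - apply: (Ck_eq oA _ (hr i' j')) => p _; by rewrite block_mxEdr.
have brho p : A p -> forall i j, `|rho p i j| <= L * mu p.1.
  move=> Ap i j; rewrite /rho.
  case: (split_ordP i) => i' ->; case: (split_ordP j) => j' ->;
    rewrite ?block_mxEul ?block_mxEur ?block_mxEdl ?block_mxEdr !mxE ?normrN;
    by have [] := ba Ap i' j'.
have [Z [W [[_ _ dZ _ bZ _] sZ _ nZ]]] := lin_ode oA sA dm mu0 L0 srho brho.
pose E p := mkC (ulsubmx (Z p)) (ursubmx (Z p)).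
exists E; split.
- move/smoothP : sZ => sZ; split; apply/smoothP => l; apply/(Ck_mxP _ _ oA) => i j.
    apply: (Ck_eq oA _ ((Ck_mxP _ _ oA).1 (sZ l) (lshift 2 i) (lshift 2 j))) => p _.
    by rewrite /= /E reM_mkC !mxE.
  apply: (Ck_eq oA _ ((Ck_mxP _ _ oA).1 (sZ l) (lshift 2 i) (rshift 2 j))) => p _.
  by rewrite /= /E imM_mkC !mxE.
- move=> x y Ap; have /is_derive_mxP h := dZ _ _ Ap.
  have ZE : Z (x, y) *m rho (x, y) = block_mx
     (reM (E (x, y) *m a (x, y))) (imM (E (x, y) *m a (x, y)))
     (dlsubmx (Z (x, y) *m rho (x, y))) (drsubmx (Z (x, y) *m rho (x, y))).
    have ZB := esym (submxK (Z (x, y))).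
    rewrite -[LHS]submxK; congr block_mx; rewrite {1}ZB mulmx_block.
      by rewrite block_mxKul reM_mul /E reM_mkC imM_mkC mulmxN.
    by rewrite block_mxKur imM_mul /E reM_mkC imM_mkC.
  split; apply/is_derive_mxP => i j.
    have := h (lshift 2 i) (lshift 2 j); rewrite ZE block_mxEul.
    rewrite (_ : (fun s => Z (s, y) _ _) = fun s => (@reM R \o (fun s => E (s, y))) s i j) //.
    by apply/funext => s; rewrite /= /E reM_mkC !mxE.
  have := h (lshift 2 i) (rshift 2 j); rewrite ZE block_mxEur.
  rewrite (_ : (fun s => Z (s, y) _ _) = fun s => (@imM R \o (fun s => E (s, y))) s i j) //.
  by apply/funext => s; rewrite /= /E imM_mkC !mxE.
- move=> x y Ap; rewrite /E (bZ _ _ Ap).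
  apply: eq_reim; rewrite ?reM_mkC ?imM_mkC ?reM1 ?imM1.
    by apply/matrixP => i j; rewrite !mxE eq_lshift.
  by apply/matrixP => i j; rewrite !mxE eq_lrshift.
(* The real system has size 4, whence [2 * 4 + 1 = 9]. *)
- have e9 : (2 * (2 + 2)%:R + 1) * L = 9 * L by congr (_ * L); ring.
  rewrite e9 in nZ; move=> p i j Ap; rewrite !mxE /=.
  by split; exact: nZ.
Qed.

End complex_ode.

Section sl2_ode.
Context {R : realType}.
Local Notation C := R[i].
Implicit Types (E a : R -> 'M[C]_2).

Lemma cder_sharp (V : normedModType R) (f : V -> 'M[C]_2) p v D :
  cder f p v D -> cder (fun q => sharp (f q)) p v (sharp D).
Proof.
move=> [/is_derive_sharp h1 /is_derive_sharp h2]; split; rewrite ?reM_sharp ?imM_sharp.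
  by apply: is_derive_eq; [rewrite (_ : _ \o _ = fun q => sharp (reM (f q)));
    [exact: h1|apply/funext => q /=; rewrite reM_sharp]|].
by apply: is_derive_eq; [rewrite (_ : _ \o _ = fun q => sharp (imM (f q)));
  [exact: h2|apply/funext => q /=; rewrite imM_sharp]|].
Qed.

(* The adjugate of a trace-free [a] is [- a], so the derivative vanishes. *)
Lemma sl2_ode_cst E1 E2 a x0 x :
  (forall s, seg x0 x s -> \tr (a s) = 0) ->
  (forall s, seg x0 x s -> cder E1 s 1 (E1 s *m a s)) ->
  (forall s, seg x0 x s -> cder E2 s 1 (E2 s *m a s)) ->
  E1 x *m sharp (E2 x) = E1 x0 *m sharp (E2 x0).
Proof.
move=> ta h1 h2.
apply: (@cder_seg_cst _ (fun s => E1 s *m sharp (E2 s))) => s ss.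
apply: cder_eq (cder_mul (h1 s ss) (cder_sharp (h2 s ss))) _.
by rewrite sharpM (sharpN (ta s ss)) mulNmx mulmxN mulmxA subrr.
Qed.

(** The case [E1 = E2]: a matrix times its adjugate is its determinant. *)
Lemma sl2_ode_det E a x0 x : (forall s, seg x0 x s -> \tr (a s) = 0) ->
  (forall s, seg x0 x s -> cder E s 1 (E s *m a s)) ->
  \det (E x) = \det (E x0).
Proof.
move=> ta h; have := sl2_ode_cst ta h h; rewrite !mul_sharp => /matrixP/(_ 0 0).
by rewrite !mxE /= !mulr1n.
Qed.

Lemma sl2_ode_unique E1 E2 a x0 x : (forall s, seg x0 x s -> \tr (a s) = 0) ->
  (forall s, seg x0 x s -> cder E1 s 1 (E1 s *m a s)) ->
  (forall s, seg x0 x s -> cder E2 s 1 (E2 s *m a s)) ->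
  \det (E2 x0) = 1 -> E1 x0 = E2 x0 -> E1 x = E2 x.
Proof.
move=> ta h1 h2 d2 e; have d2x : \det (E2 x) = 1 by rewrite (sl2_ode_det ta h2).
rewrite -[LHS]mulmx1 -(sharp_mul d2x) mulmxA (sl2_ode_cst ta h1 h2).
by rewrite e mul_sharp d2 mul1mx.
Qed.

End sl2_ode.

(** * Dependence on the loop parameter *)

Section mx_derivable.
Context {K : numFieldType}.

Definition mx_derivable (g : K -> 'M[K]_2) (z : K) : Prop := derivable g z 1.

Lemma mx_derivable_ball (g : K -> 'M[K]_2) z (D : 'M[K]_2) :
  (forall e : K, 0 < e -> exists2 d : K, 0 < d & forall h, h != 0 -> `|h| < d ->
    forall i j, `|h^-1 * (g (z + h) i j - g z i j) - D i j| < e) -> mx_derivable g z.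
Proof.
move=> hg; apply/cvg_ex; exists D; apply/cvg_ballP => e e0.
have [d d0 hd] := hg e e0; apply/nbhs_ballP; exists d => // h.
rewrite /ball /= sub0r normrN => hhd h0; split=> // i j.
by rewrite /ball /= distrC [h *: 1]mulr1 [h + z]addrC !mxE hd.
Qed.

Lemma mx_derivable_cont (g : K -> 'M[K]_2) z : mx_derivable g z -> {for z, continuous g}.
Proof. by move=> dg; exact/differentiable_continuous/derivable1_diffP. Qed.

End mx_derivable.

(** * Entrywise estimates and complex differentiability *)

Section entry_bounds.
Context {R : realType}.
Local Notation C := R[i].
Implicit Types (A B : 'M[C]_2) (a b r : R).

(** Real bounds on real and imaginary parts reduce complex estimates to the real integrals above, at
    the price of numerical factors in products. *)
Definition cbd A b := forall i j,
  `|complex.Re (A i j)| <= b /\ `|complex.Im (A i j)| <= b.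

Lemma cbd_ge0 A b : cbd A b -> 0 <= b.
Proof. by move=> /(_ 0 0)[h _]; exact: le_trans h. Qed.

(** The real or imaginary part of an entry of the product is a sum of four real products. *)
Lemma cbd_mul A B a b : cbd A a -> cbd B b -> cbd (A *m B) (4 * a * b).
Proof.
move=> hA hB i j; have a0 := cbd_ge0 hA; have b0 := cbd_ge0 hB.
have pr (x y z t : R) : `|x| <= a -> `|y| <= b -> `|z| <= a -> `|t| <= b ->
    - (2 * (a * b)) <= x * y + z * t <= 2 * (a * b) /\
    - (2 * (a * b)) <= x * y - z * t <= 2 * (a * b).
  move=> hx hy hz ht.
  have h1 : `|x * y| <= a * b by rewrite normrM ler_pM.
  have h2 : `|z * t| <= a * b by rewrite normrM ler_pM.
  by move: h1 h2; rewrite !ler_norml => /andP[? ?] /andP[? ?]; split; lra.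
rewrite mulmx2E !cReD !cImD !cReM !cImM.
have [a1 a2] := hA i 0; have [a3 a4] := hA i 1.
have [b1 b2] := hB 0 j; have [b3 b4] := hB 1 j.
have [_ p1] := pr _ _ _ _ a1 b1 a2 b2; have [_ p2] := pr _ _ _ _ a3 b3 a4 b4.
have [p3 _] := pr _ _ _ _ a1 b2 a2 b1; have [p4 _] := pr _ _ _ _ a3 b4 a4 b3.
by rewrite !ler_norml; split; lra.
Qed.

Lemma cbdZ (h : C) A r b : `|complex.Re h| <= r -> `|complex.Im h| <= r -> cbd A b ->
  cbd (h *: A) (2 * r * b).
Proof.
move=> h1 h2 hA i j; have [a1 a2] := hA i j; rewrite !mxE cReM cImM.
have k (x y : R) : `|x| <= r -> `|y| <= b -> `|x * y| <= r * b.
  by move=> hx hy; rewrite normrM ler_pM.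
move: (k _ _ h1 a1) (k _ _ h2 a2) (k _ _ h1 a2) (k _ _ h2 a1); rewrite !ler_norml.
move=> /andP[? ?] /andP[? ?] /andP[? ?] /andP[? ?]; split; lra.
Qed.

Lemma cbd_sharp A a : cbd A a -> cbd (sharp A) a.
Proof.
move=> hA i j; rewrite mxE.
by case: ifP => _; case: ifP => _; rewrite ?cReN ?cImN ?normrN.
Qed.

Lemma cbd_toC (U : 'M[R]_2) a : (forall i j, `|U i j| <= a) -> cbd (toC U) a.
Proof. by move=> h i j; rewrite mxE /= normr0; split=> //; apply: le_trans (h i j). Qed.

Lemma cbd_seg (f D : R -> 'M[C]_2) (m mu : R -> R) x0 x K : 0 <= K ->
  (forall s, seg x0 x s -> is_derive s (1 : R) m (mu s)) ->
  (forall s, seg x0 x s -> cder f s 1 (D s)) ->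
  (forall s, seg x0 x s -> cbd (D s) (K * mu s)) ->
  cbd (f x - f x0) (K * `|m x - m x0|).
Proof.
move=> K0 dm df hD i j.
have dK s : seg x0 x s -> is_derive s (1 : R) (K \*: m) (K * mu s).
  by move=> /dm h; exact: is_deriveZ.
have -> : K * `|m x - m x0| = `|(K \*: m) x - (K \*: m) x0|.
  by rewrite -[(K \*: m) x]/(K * m x) -[(K \*: m) x0]/(K * m x0) -mulrBr normrM ger0_norm.
rewrite !mxE cReD cImD cReN cImN; split.
  by apply: (seg_le (fun s ss => (cder_entries i j (df s ss)).1) dK) => s /hD/(_ i j)[].
by apply: (seg_le (fun s ss => (cder_entries i j (df s ss)).2) dK) => s /hD/(_ i j)[].
Qed.

Lemma norm_reim (w : C) (b : R) : `|complex.Re w| <= b -> `|complex.Im w| <= b ->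
  `|w| <= (2 * b)%:C.
Proof.
move=> h1 h2; rewrite normc_def lecR.
have b0 : 0 <= b by exact: le_trans h1.
rewrite -(@ger0_norm _ (2 * b)) ?mulr_ge0 // -sqrtr_sqr ler_wsqrtr //.
rewrite -[_ ^+ 2]real_normK ?num_real // -[X in _ + X]real_normK ?num_real //.
have := normr_ge0 (complex.Re w); have := normr_ge0 (complex.Im w); nra.
Qed.

Lemma normc_reim (w : C) : `|w| = (Num.sqrt ((complex.Re w)^+2 + (complex.Im w)^+2))%:C /\
  (let r := Num.sqrt ((complex.Re w)^+2 + (complex.Im w)^+2) in
   `|complex.Re w| <= r /\ `|complex.Im w| <= r).
Proof.
split; first exact: normc_def.
by split; rewrite -sqrtr_sqr ler_wsqrtr // ?lerDl ?lerDr sqr_ge0.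
Qed.

(** Complex differentiability with a quadratic remainder: the form in which real estimates deliver
    it, and one that is inherited by the adjugate. *)
Definition quad_diff (g : C -> 'M[C]_2) (z : C) : Prop := exists D K,
  forall h r, `|h| = r%:C -> `|complex.Re h| <= r -> `|complex.Im h| <= r -> r <= 1 ->
    cbd (g (z + h) - g z - h *: D) (K * r ^+ 2).

Lemma quad_diff_sharp g z : quad_diff g z -> quad_diff (fun l => sharp (g l)) z.
Proof.
move=> [D [K hg]]; exists (sharp D), K => h r e1 e2 e3 e4.
rewrite (_ : _ - _ = sharp (g (z + h) - g z - h *: D)); first exact/cbd_sharp/hg.
by apply: mx2P; rewrite !mxE //=; ring.
Qed.

Lemma quad_diff_derivable g z : quad_diff g z -> mx_derivable g z.
Proof.
move=> [D [K hg]]; apply: (@mx_derivable_ball _ g z D) => e e0.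
(* From the displacement [h = 1] with [r = 1]. *)
have K0 : 0 <= K.
  have := hg 1 1; rewrite normr1 /= normr1 normr0 => /(_ erefl (lexx _) ler01 (lexx _)).
  by move=> /cbd_ge0; rewrite expr1n mulr1.
(* In the order of the complex numbers a positive [e] is real. *)
have eE : e = (complex.Re e)%:C by case: e e0 => er ei; rewrite ltcE /= => /andP[/eqP ->].
have er0 : 0 < complex.Re e by move: e0; rewrite eE ltcR.
pose d := Num.min 1 (complex.Re e / (2 * K + 1)).
have d0 : 0 < d by rewrite lt_min ltr01 divr_gt0 //; lra.
exists d%:C; first by rewrite ltcR.
move=> h h0 hd i j.
have [hr [h1 h2]] := normc_reim h; set r := Num.sqrt _ in hr h1 h2.
have rd : r < d by move: hd; rewrite hr ltcR.
move: rd; rewrite /d lt_min ltr_pdivlMr; last lra.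
move=> /andP[r1 rK].
have hb := hg h r hr h1 h2 (ltW r1).
have r0 : 0 < r by rewrite -ltcR -hr normr_gt0.
have -> : h^-1 * (g (z + h) i j - g z i j) - D i j = h^-1 * (g (z + h) - g z - h *: D) i j.
  by rewrite !mxE; field; exact: h0.
have [b1 b2] := hb i j.
rewrite normrM normfV hr.
apply: (@le_lt_trans _ _ (r^-1 * (2 * (K * r ^+ 2)))%:C).
  by rewrite rmorphM /= fmorphV ler_wpM2l ?norm_reim // -fmorphV /= ler0c invr_ge0 ltW.
rewrite eE ltcR (_ : r^-1 * _ = r * (2 * K)); first nra.
by rewrite expr2; field; rewrite gt_eqF.
Qed.

End entry_bounds.

Lemma cder_cont_entries (R : realType) (f : R -> 'M[R[i]]_2) s D i j : cder f s 1 D ->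
  {for s, continuous (fun s => complex.Re (f s i j))} /\
  {for s, continuous (fun s => complex.Im (f s i j))}.
Proof.
by move=> /(cder_entries i j)[/is_derive_cont h1 /is_derive_cont h2].
Qed.

Lemma complex_primitive (R : realType) (S : set R) (f : R -> 'M[R[i]]_2) c0 :
  open S -> (forall x s, S x -> seg c0 x s -> S s) ->
  (forall s, S s -> exists D, cder f s 1 D) ->
  exists D0, D0 c0 = 0 /\ forall s, S s -> cder D0 s 1 (f s).
Proof.
move=> oS stS df.
pose D0 x := mkC (\matrix_(i, j) oint (fun s => complex.Re (f s i j)) c0 x)
                 (\matrix_(i, j) oint (fun s => complex.Im (f s i j)) c0 x).
exists D0; split; first by apply/matrixP => i j; rewrite !mxE !oint_id.
move=> s Ss; split; apply/is_derive_mxP => i j; rewrite mxE.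
  rewrite (_ : (fun q => _) = oint (fun s => complex.Re (f s i j)) c0); last first.
    by apply/funext => t; rewrite /= /D0 reM_mkC mxE.
  apply: (oint_derive oS) => [t /df[D]|t]; last exact: stS.
  by move=> /(cder_cont_entries i j)[].
rewrite (_ : (fun q => _) = oint (fun s => complex.Im (f s i j)) c0); last first.
  by apply/funext => t; rewrite /= /D0 imM_mkC mxE.
apply: (oint_derive oS) => [t /df[D]|t]; last exact: stS.
by move=> /(cder_cont_entries i j)[].
Qed.

(** * Linear systems affine in the loop parameter *)

Section pencil.
Context {R : realType} (S : set R) (c0 : R) (m mu : R -> R) (L0 : R) (P Q : R -> 'M[R]_2).
Local Notation C := R[i].
Variable E : C -> R -> 'M[C]_2.
Hypotheses (oS : open S) (stS : forall x s, S x -> seg c0 x s -> S s).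
Hypothesis dm : forall s, S s -> is_derive s (1 : R) m (mu s).
Hypothesis mu0 : forall s, S s -> 0 <= mu s.
Hypothesis L00 : 0 < L0.
Hypotheses (sP : smooth S P) (sQ : smooth S Q).
Hypothesis bP : forall s, S s -> forall i j, `|P s i j| <= L0 * mu s.
Hypothesis bQ : forall s, S s -> forall i j, `|Q s i j| <= L0 * mu s.
Hypothesis diagP : forall s, S s -> [/\ P s 0 1 = 0, P s 1 0 = 0 & P s 0 0 + P s 1 1 = 0].
Hypothesis offQ : forall s, S s -> Q s 0 0 = 0 /\ Q s 1 1 = 0.

(** Serves both factors: along x with [P = b e3] and [Q = beta_1], along y with [P = 0], [Q = gamma]
    and the inverse of the loop parameter in the place of [l]. *)
Definition pencil (l : C) (s : R) : 'M[C]_2 := toC (P s) + l *: toC (Q s).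

Hypothesis dE : forall l s, S s -> cder (E l) s 1 (E l s *m pencil l s).
Hypothesis E0 : forall l, E l c0 = 1%:M.

Lemma pencil_tr l s : S s -> \tr (pencil l s) = 0.
Proof.
move=> Ss; have [_ _ hP] := diagP Ss; have [q1 q2] := offQ Ss.
rewrite tr2 !mxE q1 q2 !mulr0 !addr0.
by rewrite -(rmorphD (real_complex R)) hP.
Qed.

Variable x : R.
Hypothesis Sx : S x.

Let trx l s : seg c0 x s -> \tr (pencil l s) = 0.
Proof. by move=> /(stS Sx); exact: pencil_tr. Qed.

Let dEx l s : seg c0 x s -> cder (E l) s 1 (E l s *m pencil l s).
Proof. by move=> /(stS Sx); exact: dE. Qed.

(** The source of the reality and twisting conditions: the transformed solution solves the equation
    with parameter [l] and the same initial value. *)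
Let uniqE (f : R -> 'M[C]_2) l : f c0 = 1%:M ->
  (forall s, seg c0 x s -> cder f s 1 (f s *m pencil l s)) -> f x = E l x.
Proof.
move=> f0 df; apply: (sl2_ode_unique (trx l) df (dEx l)); first by rewrite E0 det1.
by rewrite f0 E0.
Qed.

Let detE l s : S s -> \det (E l s) = 1.
Proof.
move=> Ss; rewrite (@sl2_ode_det _ _ (pencil l) c0 s) ?E0 ?det1 // => t /(stS Ss).
  exact: pencil_tr.
exact: dE.
Qed.

Lemma pencil_det l : \det (E l x) = 1.
Proof. exact: detE. Qed.

Lemma pencil_conj l : map_mx conjc (E (conjc l) x) = E l x.
Proof.
have dconj (f : R -> 'M[C]_2) s D : cder f s 1 D ->
    cder (fun s => map_mx conjc (f s)) s 1 (map_mx conjc D).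
  have hr (M : 'M[C]_2) : reM (map_mx conjc M) = reM M.
    by apply/matrixP => i j; rewrite !mxE; case: (M i j).
  have hi (M : 'M[C]_2) : imM (map_mx conjc M) = - imM M.
    by apply/matrixP => i j; rewrite !mxE; case: (M i j).
  move=> [h1 h2]; split; rewrite ?hr ?hi.
    by rewrite (_ : _ \o _ = @reM R \o f) //; apply/funext => t /=; rewrite hr.
  by rewrite (_ : _ \o _ = - (@imM R \o f)); [exact: is_deriveN|apply/funext => t /=; rewrite hi].
apply: (uniqE (f := fun s => map_mx conjc (E (conjc l) s))).
  by rewrite E0 map_mx1.
move=> s ss; apply: cder_eq (dconj _ _ _ (dEx (conjc l) ss)) _.
rewrite map_mxM; congr (_ *m _); apply/matrixP => i j; rewrite !mxE.
by rewrite rmorphD rmorphM /= conjcK !oppr0.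
Qed.

(** Conjugation by [e3] fixes diagonal entries and negates the others, so in the coefficient it
    amounts to changing [l] into [- l]. *)
Lemma pencil_twist l : E (- l) x = Ad e3 (E l x).
Proof.
have e33 : (e3 : 'M[C]_2) *m e3 = 1%:M by exact: e3_sqr.
rewrite /Ad e3_inv; apply/esym; apply: (uniqE (f := fun s => e3 *m E l s *m e3)).
  by rewrite E0 mulmx1 e33.
move=> s ss; apply: cder_eq (cderMr e3 (cderMl e3 (dEx l ss))) _.
have [p1 p2 p3] := diagP (stS Sx ss); have [q1 q2] := offQ (stS Sx ss).
have -> : pencil l s = e3 *m pencil (- l) s *m e3.
  by apply: mx2P; rewrite !mulmx2E !mxE /= ?p1 ?p2 ?q1 ?q2; ring.
by rewrite !mulmxA -(mulmxA _ e3 e3) e33 mulmx1.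
Qed.

(** The second coordinate is a parameter: the angle of [l] in [pencil_circle], a dummy in [E_bd]. *)
Let SR : set (R * R) := [set p | S p.1].

Let oSR : open SR.
Proof. by apply: (@open_comp _ _ (fst : R * R -> R) S) => // p _; exact: cvg_fst. Qed.

Let stSR : star (fun y => 0 * y + c0) SR.
Proof. by move=> s t u; rewrite mul0r add0r; exact: stS. Qed.

Let CkS n (f : R -> R) : Ck n S f -> Ck n SR (fun p => f p.1).
Proof.
by apply: (Ck_affine (L := fst) (DL := fst)) => // p; exact: cvg_fst.
Qed.

Let smooth_pencil (u v : R -> R) : (forall n, Ck n setT u) -> (forall n, Ck n setT v) ->
  csmooth SR (fun p => pencil (u p.2 +i* v p.2) p.1).
Proof.
move=> su sv.
have hu n : Ck n SR (fun p => u p.2).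
  apply: (@Ck_sub _ _ _ _ _ (snd @^-1` setT)) => //.
  by apply: (Ck_affine (L := snd) (DL := snd)) => // p; exact: cvg_snd.
have hv n : Ck n SR (fun p => v p.2).
  apply: (@Ck_sub _ _ _ _ _ (snd @^-1` setT)) => //.
  by apply: (Ck_affine (L := snd) (DL := snd)) => // p; exact: cvg_snd.
have hP n i j : Ck n SR (fun p => P p.1 i j).
  exact: (CkS ((Ck_mxP n P oS).1 ((smoothP _ _).1 sP n) i j)).
have hQ n i j : Ck n SR (fun p => Q p.1 i j).
  exact: (CkS ((Ck_mxP n Q oS).1 ((smoothP _ _).1 sQ n) i j)).
split; apply/smoothP => n; apply/(Ck_mxP _ _ oSR) => i j.
  apply: (Ck_eq oSR _ (CkD oSR (hP n i j) (CkM oSR (hu n) (hQ n i j)))) => p _.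
  by rewrite !mxE cReD cReM /= mulr0 subr0.
apply: (Ck_eq oSR _ (CkM oSR (hv n) (hQ n i j))) => p _.
by rewrite !mxE cImD cImM /= mulr0 !add0r.
Qed.

Let pencil_bd l r s i j : S s -> 0 <= r -> `|complex.Re l| <= r -> `|complex.Im l| <= r ->
  `|complex.Re (pencil l s i j)| <= (1 + r) * L0 * mu s /\
  `|complex.Im (pencil l s i j)| <= (1 + r) * L0 * mu s.
Proof.
move=> Ss r0 h1 h2; rewrite !mxE cReD cReM cImD cImM /= !mulr0 subr0 !add0r.
have hp := bP Ss i j; have hq := bQ Ss i j.
have k (w : R) : `|w| <= r -> `|w * Q s i j| <= r * (L0 * mu s).
  by move=> hw; rewrite normrM ler_pM.
have k1 := k _ h1; have k2 := k _ h2.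
have -> : (1 + r) * L0 * mu s = L0 * mu s + r * (L0 * mu s) by ring.
split; first by rewrite (le_trans (ler_normD _ _)) // lerD.
by rewrite (le_trans k2) // lerDr (le_trans _ hp).
Qed.

Let Sdm p : SR p -> is_derive p.1 (1 : R) m (mu p.1).
Proof. exact: dm. Qed.
Let Smu p : SR p -> 0 <= mu p.1.
Proof. exact: mu0. Qed.

Let w r s := 3 * weight 0 c0 m (9 * ((1 + r) * L0)) (s, 0 : R).

Let L1 r : 0 <= r -> 0 < (1 + r) * L0.
Proof. by move=> r0; rewrite mulr_gt0 //; lra. Qed.

(** By uniqueness [E l] is the solution constructed by iteration, whose growth bound depends on [l]
    only through [r]. *)
Let E_bd l r s : 0 <= r -> `|complex.Re l| <= r -> `|complex.Im l| <= r ->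
  S s -> cbd (E l s) (w r s).
Proof.
move=> r0 h1 h2 Ss.
have cs (u : R) n : Ck n setT (fun _ : R => u) by exact: (Ck_cst n u openT).
have sa := smooth_pencil (fun n => cs (complex.Re l) n) (fun n => cs (complex.Im l) n).
have ba p : SR p -> forall i j,
   `|complex.Re (pencil (complex.Re l +i* complex.Im l) p.1 i j)| <= (1 + r) * L0 * mu p.1 /\
   `|complex.Im (pencil (complex.Re l +i* complex.Im l) p.1 i j)| <= (1 + r) * L0 * mu p.1.
  by move=> Sp i j; exact: pencil_bd.
have [E' [_ dE' E'0 bE']] := complex_lin_ode oSR stSR Sdm Smu (L1 r0) sa ba.
suff -> : E l s = E' (s, 0) by move=> i j; exact: bE'.
have tr' t : seg c0 s t -> \tr (pencil l t) = 0 by move=> /(stS Ss); exact: pencil_tr.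
have le : complex.Re l +i* complex.Im l = l by case: (l).
have := E'0 s 0 Ss; rewrite mul0r add0r => e0.
apply: (sl2_ode_unique tr' _ (E2 := fun s => E' (s, 0))).
- by move=> t /(stS Ss); exact: dE.
- by move=> t /(stS Ss) St; have := dE' t 0 St; rewrite /= le.
- by rewrite e0 det1.
- by rewrite e0 E0.
Qed.

(** Smooth dependence on parameters, the parameter being the angle. *)
Lemma pencil_circle : csmooth [set: R] (fun t : R => E (cos t +i* sin t) x).
Proof.
have sa := smooth_pencil (fun n => (Ck_trigo n).1) (fun n => (Ck_trigo n).2).
have ba p : SR p -> forall i j,
   `|complex.Re (pencil (cos p.2 +i* sin p.2) p.1 i j)| <= (1 + 1) * L0 * mu p.1 /\
   `|complex.Im (pencil (cos p.2 +i* sin p.2) p.1 i j)| <= (1 + 1) * L0 * mu p.1.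
  move=> Sp i j; apply: pencil_bd => //=.
    by rewrite ler_norml cos_geN1 cos_le1.
  by rewrite ler_norml sin_geN1 sin_le1.
have [E' [[s1 s2] dE' E'0 _]] := complex_lin_ode oSR stSR Sdm Smu (L1 ler01) sa ba.
have EE t : E (cos t +i* sin t) x = E' (x, t).
  apply/esym; apply: (uniqE (f := fun s => E' (s, t))).
    by have := E'0 x t Sx; rewrite mul0r add0r.
  by move=> s /(stS Sx) Ss; exact: (dE' s t Ss).
have cL : continuous (fun t : R => (x, t)) by exact: continuous_pairr.
have hL (h p v : R) : (x, h *: v + p) = h *: (0, v) + (x, p) :> R * R.
  by rewrite -[RHS]/(h * 0 + x, h *: v + p) mulr0 add0r.
split; apply/smoothP => n.
  have h := Ck_affine cL hL ((smoothP _ _).1 s1 n).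
  apply: Ck_eq openT _ (Ck_sub _ h) => [t _|t _]; last exact: Sx.
  by rewrite /= EE.
have h := Ck_affine cL hL ((smoothP _ _).1 s2 n).
apply: Ck_eq openT _ (Ck_sub _ h) => [t _|t _]; last exact: Sx.
by rewrite /= EE.
Qed.

(** Variation of constants in [l]. The quotient [N] of the solutions at [z + h] and [z] has
    derivative [h N G] with [G = E Q E^-1] at [z], so [N - 1] is of order [h]. If [D0] is the
    primitive of [G], then [F = N - 1 - h D0] has derivative [h (N - 1) G], of order [h^2]. The
    derivative in [l] is therefore [D0 E]. *)
Lemma pencil_quad z : quad_diff (fun l => E l x) z.
Proof.
(* The summand 1 leaves room for all displacements with [r <= 1]. *)
pose r0 := `|complex.Re z| + `|complex.Im z| + 1.
have nz1 := normr_ge0 (complex.Re z); have nz2 := normr_ge0 (complex.Im z).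
have r00 : 0 <= r0 by rewrite /r0; lra.
have segS s : seg c0 x s -> S s by exact: stS.
have dmx s : seg c0 x s -> is_derive s (1 : R) m (mu s) by move=> /segS/dm.
have mum s : seg c0 x s -> `|m s - m c0| <= `|m x - m c0|.
  by apply: (seg_mono dmx) => t /segS/mu0.
have zr1 : `|complex.Re z| <= r0 by rewrite /r0; lra.
have zr2 : `|complex.Im z| <= r0 by rewrite /r0; lra.
have [M M0 EM] : exists2 M, 0 <= M & forall l s, `|complex.Re l| <= r0 ->
    `|complex.Im l| <= r0 -> seg c0 x s -> cbd (E l s) M.
  exists (w r0 x); first exact: cbd_ge0 (E_bd r00 zr1 zr2 Sx).
  move=> l s h1 h2 ss; have wM : w r0 s <= w r0 x.
    rewrite /w /weight /= mul0r add0r ler_pM2l // ler_expR ler_pM2l ?mum //.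
    by rewrite mulr_gt0 // L1.
  move=> i j; have [e1 e2] := E_bd r00 h1 h2 (segS s ss) i j.
  by split; [exact: le_trans e1 wM|exact: le_trans e2 wM].
pose G l s := E l s *m toC (Q s) *m sharp (E z s).
have [D0 [D00 dD0]] : exists D0, D0 c0 = 0 /\ forall s, S s -> cder D0 s 1 (G z s).
  apply: (complex_primitive oS stS) => s Ss.
  have [dQ] : exists D, cder (fun s => toC (Q s)) s 1 D.
    have dQ : derivable Q s 1.
      by have [_ /(_ 1)[h _]] := (smoothP _ _).1 sQ 1%N; exact: h.
    exists (toC ('D_1 Q s)); split.
      rewrite reM_toC (_ : _ \o _ = Q); first exact: derivableP.
      by apply/funext => t; rewrite /= reM_toC.
    rewrite imM_toC (_ : _ \o _ = fun=> 0); first exact: is_derive_cst.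
    by apply/funext => t; rewrite /= imM_toC.
  move=> hQ; eexists.
  exact: (cder_mul (cder_mul (dE z Ss) hQ) (cder_sharp (dE z Ss))).
have bQs s : seg c0 x s -> cbd (toC (Q s)) (L0 * mu s) by move=> /segS Ss; exact/cbd_toC/bQ.
have bG l s : `|complex.Re l| <= r0 -> `|complex.Im l| <= r0 -> seg c0 x s ->
    cbd (G l s) (4 * (4 * M * (L0 * mu s)) * M).
  move=> h1 h2 ss; apply: cbd_mul; first by apply: cbd_mul; [exact: EM|exact: bQs].
  by apply: cbd_sharp; exact: EM.
pose dd := `|m x - m c0|.
have dd0 : 0 <= dd by exact: normr_ge0.
(* The numerical factors are those of [cbdZ] and [cbd_mul]: [32 = 2 * 4 * 4] for [h G], and
   [128 = 2 * 4 * 4 * 4] for [h (N - 1) G]. *)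
pose K1 := 32 * M ^+ 2 * L0 * dd.
have K10 : 0 <= K1 by rewrite /K1 !mulr_ge0 ?exprn_ge0 // ltW.
pose K2 := 128 * K1 * M ^+ 2 * L0 * dd.
exists (D0 x *m E z x), (4 * K2 * M) => h r hr h1 h2 r1.
have rr0 : 0 <= r by exact: le_trans h1.
have zh1 : `|complex.Re (z + h)| <= r0.
  by rewrite cReD (le_trans (ler_normD _ _)) // /r0; lra.
have zh2 : `|complex.Im (z + h)| <= r0.
  by rewrite cImD (le_trans (ler_normD _ _)) // /r0; lra.
pose N s := E (z + h) s *m sharp (E z s).
have dN s : seg c0 x s -> cder N s 1 (h *: G (z + h) s).
  move=> ss; apply: cder_eq (cder_mul (dEx (z + h) ss) (cder_sharp (dEx z ss))) _.
  rewrite sharpM (sharpN (trx z ss)) mulNmx mulmxN mulmxA -mulmxBl -mulmxBr.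
  rewrite (_ : pencil (z + h) s - pencil z s = h *: toC (Q s)).
    by rewrite -scalemxAr -scalemxAl.
  by rewrite /pencil scalerDl opprD addrACA subrr add0r addrAC subrr add0r.
have N0 : N c0 = 1%:M by rewrite /N !E0 sharp1 mulmx1.
have bN s : seg c0 x s -> cbd (N s - 1%:M) (r * K1).
  move=> ss; rewrite -N0.
  have ss' t : seg c0 s t -> seg c0 x t by exact: seg_sub (seg_l _ _) ss.
  have k : 0 <= 2 * r * (16 * M ^+ 2 * L0) by rewrite !mulr_ge0 ?exprn_ge0 // ltW.
  have := cbd_seg k (fun t tt => dmx t (ss' t tt)) (fun t tt => dN t (ss' t tt)).
  have hb t : seg c0 s t -> cbd (h *: G (z + h) t) (2 * r * (16 * M ^+ 2 * L0) * mu t).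
    move=> /ss' tt; have := cbdZ h1 h2 (bG (z + h) t zh1 zh2 tt).
    by rewrite (_ : 2 * r * _ = 2 * r * (16 * M ^+ 2 * L0) * mu t) //; ring.
  move=> /(_ hb) hc i j; have [c1 c2] := hc i j.
  have le : 2 * r * (16 * M ^+ 2 * L0) * `|m s - m c0| <= r * K1.
    have -> : r * K1 = 2 * r * (16 * M ^+ 2 * L0) * dd by rewrite /K1; ring.
    by rewrite ler_wpM2l // mum.
  by split; [exact: le_trans c1 le|exact: le_trans c2 le].
pose F s := N s - (1%:M + h *: D0 s).
have dF s : seg c0 x s -> cder F s 1 (h *: ((N s - 1%:M) *m G z s)).
  move=> ss.
  have := cderD (dN s ss) (cderN (cderD (cder_cst 1%:M s 1) (cderZ h (dD0 s (segS s ss))))).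
  move/cder_eq; apply; rewrite add0r -scalerBr mulmxBl mul1mx; congr (_ *: (_ - _)).
  rewrite /G /N !mulmxA; congr (_ *m _ *m _).
  by rewrite -mulmxA sharp_mul ?mulmx1 // detE //; exact: segS.
have F0 : F c0 = 0 by rewrite /F N0 D00 scaler0 addr0 subrr.
have bF : cbd (F x) (r ^+ 2 * K2).
  have k : 0 <= 128 * r ^+ 2 * K1 * M ^+ 2 * L0 by rewrite !mulr_ge0 ?exprn_ge0 // ltW.
  have hb t : seg c0 x t -> cbd (h *: ((N t - 1%:M) *m G z t))
      (128 * r ^+ 2 * K1 * M ^+ 2 * L0 * mu t).
    move=> tt; have := cbdZ h1 h2 (cbd_mul (bN t tt) (bG z t zr1 zr2 tt)).
    by rewrite (_ : 2 * r * _ = 128 * r ^+ 2 * K1 * M ^+ 2 * L0 * mu t) //; ring.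
  have := cbd_seg k dmx dF hb; rewrite F0 subr0.
  have -> : r ^+ 2 * K2 = 128 * r ^+ 2 * K1 * M ^+ 2 * L0 * `|m x - m c0|.
    by rewrite /K2 /dd; ring.
  exact.
have -> : E (z + h) x - E z x - h *: (D0 x *m E z x) = F x *m E z x.
  rewrite /F mulmxBl mulmxDl mul1mx -scalemxAl opprD addrA; congr (_ - _ - _).
  by rewrite /N -mulmxA sharp_mul ?mulmx1 // detE.
have := cbd_mul bF (EM z x zr1 zr2 (seg_r _ _)).
have -> : 4 * K2 * M * r ^+ 2 = 4 * (r ^+ 2 * K2) * M by ring.
exact.
Qed.

End pencil.

(** * Exchange of mixed partial derivatives *)

Section mixed_partials.
Context {R : realType}.
Implicit Types (f : R * R -> R) (A : set (R * R)).

(** Schwarz' theorem including the existence of the second mixed derivative: [f] is the integral of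
    [f1] from [x0]; differentiation in y under the integral sign writes [f2] as an integral of
    [f12], which is then differentiated in x. *)
Lemma mixed_partials A f f1 f2 f12 x0 y0 : open A -> A (x0, y0) ->
  (forall p, A p -> is_derive p.1 (1 : R) (fun s => f (s, p.2)) (f1 p)) ->
  (forall p, A p -> is_derive p.2 (1 : R) (fun t => f (p.1, t)) (f2 p)) ->
  (forall p, A p -> is_derive p.2 (1 : R) (fun t => f1 (p.1, t)) (f12 p)) ->
  (forall p, A p -> {for p, continuous f1}) ->
  (forall p, A p -> {for p, continuous f12}) ->
  is_derive x0 (1 : R) (fun s => f2 (s, y0)) (f12 (x0, y0)).
Proof.
move=> oA Ap d1 d2 d12 cf1 cf12.
have [r r0 hr] := (box_nbhs _ _ _).1 (open_nbhs_nbhs (conj oA Ap)).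
pose B := [set p : R * R | `|p.1 - x0| < r /\ `|p.2 - y0| < r].
have BA p : B p -> A p by case: p => x y [? ?]; exact: hr.
have oB : open B.
  have cn (g : R * R -> R) (z : R) : continuous g -> open [set p : R * R | `|g p - z| < r].
    move=> cg; apply: (@open_comp _ _ (fun p => `|g p - z|) [set u | u < r]); last exact: open_lt.
    move=> p _; apply: (@continuous_comp _ _ _ (fun p => g p - z) Num.norm); last exact: norm_continuous.
    by apply: cvgB; [exact: cg|exact: cvg_cst].
  rewrite (_ : B = [set p : R * R | `|p.1 - x0| < r] `&` [set p : R * R | `|p.2 - y0| < r]) //.
  by apply: openI; apply: cn => p; [exact: cvg_fst|exact: cvg_snd].
pose c y : R := 0 * y + x0.
have cE y : c y = x0 by rewrite /c mul0r add0r.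
have sB : star c B.
  move=> x y s [h1 h2]; rewrite cE => /seg_dist h; split => //=; exact: le_lt_trans h1.
have B0 y : `|y - y0| < r -> B (x0, y) by move=> h; split; rewrite //= subrr normr0.
have cB1 p : B p -> {for p, continuous f1} by move=> /BA/cf1.
have cB12 p : B p -> {for p, continuous f12} by move=> /BA/cf12.
have fE x y : B (x, y) -> f (x, y) = f (x0, y) + Jop c f1 (x, y).
  move=> Bp; rewrite /Jop /= cE.
  have -> : oint (fun s => f1 (s, y)) x0 x = f (x, y) - f (x0, y); last by rewrite addrC subrK.
  have sg s : seg x0 x s -> B (s, y) by move=> ss; apply: (star_seg sB Bp); rewrite -/(c y) cE.
  apply: (oint_primitive (F := fun s => f (s, y)) (slice_open oB y) (slice_cont (A := B) (y := y) cB1) sg).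
  by move=> s /sg/BA/d1.
have f2E x : B (x, y0) -> f2 (x, y0) = f2 (x0, y0) + Jop c f12 (x, y0).
  move=> Bp; have h1 := d2 _ (BA _ Bp).
  have dB p : B p -> is_derive p.2 (1 : R) (fun t => f1 (p.1, t)) (f12 p) by move=> /BA/d12.
  have Bp0 : B (x0, y0) by apply: B0; rewrite subrr normr0.
  have h2 := is_deriveD (d2 _ (BA _ Bp0)) (Jop_snd oB sB cB1 cB12 dB Bp).
  have h3 : is_derive y0 (1 : R) (fun t => f (x, t)) (f2 (x0, y0) + (Jop c f12 (x, y0) - 0 * f1 (c y0, y0))).
    apply: near_eq_is_derive h2.
    by apply: filterS (open_nbhs_nbhs (conj (open_snd (x := x) oB) Bp)) => t /fE ->.
  by case: h1 h3 => _ <- [_ ->]; rewrite mul0r subr0.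
have Bp0 : B (x0, y0) by apply: B0; rewrite subrr normr0.
have h := is_deriveD (is_derive_cst (f2 (x0, y0)) x0 (1 : R)) (Jop_fst oB sB cB12 Bp0).
rewrite add0r in h; apply: near_eq_is_derive h.
by apply: filterS (open_nbhs_nbhs (conj (slice_open oB y0) Bp0)) => s /f2E ->.
Qed.

End mixed_partials.

(** * Smooth maps with values in complex matrices *)

Section csmooth.
Context {R : realType}.
Local Notation C := R[i].

Lemma reM_cderive (V : normedModType R) (f : V -> 'M[C]_2) p v :
  reM (cderive f p v) = 'D_v (@reM R \o f) p.
Proof.
rewrite /cderive reMD reMZ !reM_toC !imM_toC.
by rewrite scaler0 subr0 -[complex.Re _]/(0 : R) scale0r addr0.
Qed.

Lemma imM_cderive (V : normedModType R) (f : V -> 'M[C]_2) p v :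
  imM (cderive f p v) = 'D_v (@imM R \o f) p.
Proof.
rewrite /cderive imMD imMZ !reM_toC !imM_toC.
by rewrite scaler0 !add0r -[complex.Im _]/(1 : R) scale1r.
Qed.

Lemma is_derive_fst_mx (f : R * R -> 'M[R]_2) (x y : R) (D : 'M[R]_2) :
  is_derive (x, y) (1, 0) f D <-> is_derive x (1 : R) (fun s => f (s, y)) D.
Proof.
by split=> /is_derive_mxP h; apply/is_derive_mxP => i j;
  apply/(is_derive_fst (fun q => f q i j)).
Qed.

Lemma is_derive_snd_mx (f : R * R -> 'M[R]_2) (x y : R) (D : 'M[R]_2) :
  is_derive (x, y) (0, 1) f D <-> is_derive y (1 : R) (fun t => f (x, t)) D.
Proof.
by split=> /is_derive_mxP h; apply/is_derive_mxP => i j;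
  apply/(is_derive_snd (fun q => f q i j)).
Qed.

Lemma cder_fst (f : R * R -> 'M[C]_2) (x y : R) (D : 'M[C]_2) :
  cder f (x, y) (1, 0) D <-> cder (fun s => f (s, y)) x 1 D.
Proof.
by split=> -[h1 h2]; split;
  (exact: (is_derive_fst_mx (@reM R \o f) _ _ _).1 || exact: (is_derive_fst_mx (@imM R \o f) _ _ _).1
  || exact: (is_derive_fst_mx (@reM R \o f) _ _ _).2 || exact: (is_derive_fst_mx (@imM R \o f) _ _ _).2).
Qed.

Lemma cder_snd (f : R * R -> 'M[C]_2) (x y : R) (D : 'M[C]_2) :
  cder f (x, y) (0, 1) D <-> cder (fun t => f (x, t)) y 1 D.
Proof.
by split=> -[h1 h2]; split;
  (exact: (is_derive_snd_mx (@reM R \o f) _ _ _).1 || exact: (is_derive_snd_mx (@imM R \o f) _ _ _).1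
  || exact: (is_derive_snd_mx (@reM R \o f) _ _ _).2 || exact: (is_derive_snd_mx (@imM R \o f) _ _ _).2).
Qed.

Lemma cder_unique (V : normedModType R) (f : V -> 'M[C]_2) p v D D' :
  cder f p v D -> cder f p v D' -> D = D'.
Proof. by move=> /cder_val <- /cder_val. Qed.

Lemma near_eq_cder (V : normedModType R) (f g : V -> 'M[C]_2) p v D :
  {near p, f =1 g} -> cder f p v D -> cder g p v D.
Proof.
move=> fg [h1 h2]; split.
  by apply: near_eq_is_derive h1; apply: filterS fg => q /= ->.
by apply: near_eq_is_derive h2; apply: filterS fg => q /= ->.
Qed.

Lemma csmooth_mul (V : normedModType R) (A : set V) (f g : V -> 'M[C]_2) : open A ->
  csmooth A f -> csmooth A g -> csmooth A (fun p => f p *m g p).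
Proof.
move=> oA [/smoothP fr /smoothP fi] [/smoothP gr /smoothP gi].
split; apply/smoothP => n; apply/(Ck_mxP _ _ oA) => i j.
  have h1 := (Ck_mxP _ _ oA).1 (Ck_mulmx oA (fr n) (gr n)) i j.
  have h2 := (Ck_mxP _ _ oA).1 (Ck_mulmx oA (fi n) (gi n)) i j.
  apply: (Ck_eq oA _ (CkB oA h1 h2)) => p _.
  by rewrite /= reM_mul [RHS]mxE [X in _ = _ + X]mxE.
have h1 := (Ck_mxP _ _ oA).1 (Ck_mulmx oA (fr n) (gi n)) i j.
have h2 := (Ck_mxP _ _ oA).1 (Ck_mulmx oA (fi n) (gr n)) i j.
apply: (Ck_eq oA _ (CkD oA h1 h2)) => p _.
by rewrite /= imM_mul [RHS]mxE.
Qed.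

Lemma csmooth_affine (V V' : normedModType R) (A : set V) (f : V -> 'M[C]_2)
    (h : V' -> V) (Dh : V' -> V) : continuous h ->
  (forall t p v, h (t *: v + p) = t *: Dh v + h p) -> csmooth A f -> csmooth (h @^-1` A) (f \o h).
Proof.
move=> ch hh [/smoothP fr /smoothP fi]; split; apply/smoothP => n.
  exact: (Ck_affine ch hh (fr n)).
exact: (Ck_affine ch hh (fi n)).
Qed.

Lemma csmooth_sub (V : normedModType R) (A B : set V) (f : V -> 'M[C]_2) :
  A `<=` B -> csmooth B f -> csmooth A f.
Proof.
move=> AB [/smoothP fr /smoothP fi]; split; apply/smoothP => n.
  exact: (Ck_sub AB (fr n)).
exact: (Ck_sub AB (fi n)).
Qed.

Lemma csmooth_cst (V : normedModType R) (A : set V) (D : 'M[C]_2) : open A ->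
  csmooth A (fun=> D).
Proof. by move=> oA; split; apply/smoothP => n; exact: Ck_cst. Qed.

Lemma csmooth_toC (V : normedModType R) (A : set V) (f : V -> 'M[R]_2) : open A ->
  smooth A f -> csmooth A (fun p => toC (f p)).
Proof.
move=> oA /smoothP sf; split; apply/smoothP => n.
  by apply: (Ck_eq oA _ (sf n)) => p _; rewrite /= reM_toC.
by apply: (Ck_eq oA _ (Ck_cst n 0 oA)) => p _; rewrite /= imM_toC.
Qed.

Lemma csmoothD (V : normedModType R) (A : set V) (f g : V -> 'M[C]_2) : open A ->
  csmooth A f -> csmooth A g -> csmooth A (fun p => f p + g p).
Proof.
move=> oA [/smoothP fr /smoothP fi] [/smoothP gr /smoothP gi]; split; apply/smoothP => n.
  by apply: (Ck_eq oA _ (CkD oA (fr n) (gr n))) => p _; rewrite /= reMD.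
by apply: (Ck_eq oA _ (CkD oA (fi n) (gi n))) => p _; rewrite /= imMD.
Qed.

Lemma csmoothZ (V : normedModType R) (A : set V) (x : C) (f : V -> 'M[C]_2) : open A ->
  csmooth A f -> csmooth A (fun p => x *: f p).
Proof.
move=> oA sf; rewrite (_ : (fun p => _) = fun p => x%:M *m f p).
  by apply: csmooth_mul => //; exact: csmooth_cst.
by apply/funext => p; rewrite mul_scalar_mx.
Qed.

Lemma csmooth_sharp (V : normedModType R) (A : set V) (f : V -> 'M[C]_2) : open A ->
  csmooth A f -> csmooth A (fun p => sharp (f p)).
Proof.
move=> oA [/smoothP fr /smoothP fi].
split; apply/smoothP => n.
  by apply: (Ck_eq oA _ (Ck_sharp oA (fr n))) => p _; rewrite /= reM_sharp.
by apply: (Ck_eq oA _ (Ck_sharp oA (fi n))) => p _; rewrite /= imM_sharp.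
Qed.

Section plane_maps.
Variables (A : set (R * R)) (f : R * R -> 'M[C]_2).
Hypotheses (oA : open A) (sf : csmooth A f).

Let mixed (g : R * R -> 'M[R]_2) p : smooth A g -> A p ->
  is_derive p (1, 0) ('D_(0, 1) g) ('D_(0, 1) ('D_(1, 0) g) p).
Proof.
case: p => x y /smoothP sg Ap; apply/is_derive_fst_mx/is_derive_mxP => i j.
have d1 := Ck_der ((1, 0) : R * R) (sg 2%N); have d12 := Ck_der ((0, 1) : R * R) d1.
have sl (h : R * R -> 'M[R]_2) q v D : is_derive q v h D -> is_derive q v (fun q => h q i j) (D i j).
  by move=> /is_derive_mxP.
apply: (mixed_partials (f := fun q => g q i j) (f1 := fun q => 'D_(1, 0) g q i j)
  (f2 := fun q => 'D_(0, 1) g q i j) (f12 := fun q => 'D_(0, 1) ('D_(1, 0) g) q i j) oA Ap).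
- by case=> s t As; apply/(is_derive_fst (fun q => g q i j))/sl; exact: Ck_is_derive (sg 1%N) As.
- by case=> s t As; apply/(is_derive_snd (fun q => g q i j))/sl; exact: Ck_is_derive (sg 1%N) As.
- by case=> s t As; apply/(is_derive_snd (fun q => 'D_(1, 0) g q i j))/sl; exact: Ck_is_derive d1 As.
- by move=> q Aq; move: i j {sl}; apply/continuous_mxP; exact: Ck_cont d1 q Aq.
- by move=> q Aq; move: i j {sl}; apply/continuous_mxP; exact: Ck_cont d12 q Aq.
Qed.

Lemma cder_mixed fx p w : A p -> (forall q, A q -> cder f q (1, 0) (fx q)) ->
  cder fx p (0, 1) w -> cder (fun q => cderive f q (0, 1)) p (1, 0) w.
Proof.
move=> Ap hfx [w1 w2]; have [sr si] := sf.
have nA : {near p, forall q, A q} by exact: open_nbhs_nbhs.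
split.
  rewrite (_ : _ \o _ = 'D_(0, 1) (@reM R \o f)); last first.
    by apply/funext => q; rewrite /= reM_cderive.
  apply: is_derive_eq (mixed sr Ap) _; case: w1 => _ <-; apply: near_eq_derive.
  by apply: filterS nA => q /hfx[[_ ->]].
rewrite (_ : _ \o _ = 'D_(0, 1) (@imM R \o f)); last first.
  by apply/funext => q; rewrite /= imM_cderive.
apply: is_derive_eq (mixed si Ap) _; case: w2 => _ <-; apply: near_eq_derive.
by apply: filterS nA => q /hfx[_ [_ ->]].
Qed.

(** The derivative along the diagonal is the one in direction [(1, 1)], hence the sum of the
    partials. *)
Lemma cder_diag x : A (x, x) -> cder (fun t => f (t, t)) x 1
  (cderive f (x, x) (1, 0) + cderive f (x, x) (0, 1)).
Proof.
move=> Ap; have [/smoothP sr /smoothP si] := sf.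
have key (g : R * R -> 'M[R]_2) : (forall n, Ck n A g) ->
    is_derive x (1 : R) (fun t => g (t, t)) ('D_(1, 0) g (x, x) + 'D_(0, 1) g (x, x)).
  move=> sg; apply/is_derive_mxP => i j.
  have ci v q : A q -> {for q, continuous (fun q => 'D_v g q i j)}.
    by move=> Aq; move: i j; apply/continuous_mxP; exact: Ck_cont (Ck_der v (sg 1%N)) q Aq.
  have di v q : A q -> is_derive q v (fun q => g q i j) ('D_v g q i j).
    by move=> Aq; exact: ((is_derive_mxP _ _ _ _).1 (Ck_is_derive v (sg 1%N) Aq) i j).
  have h1 q : A q -> is_derive q.1 (1 : R) (fun s => g (s, q.2) i j) ('D_(1, 0) g q i j).
    by case: q => s t As; apply/(is_derive_fst (fun q => g q i j)); exact: di.
  have h2 q : A q -> is_derive q.2 (1 : R) (fun t => g (q.1, t) i j) ('D_(0, 1) g q i j).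
    by case: q => s t As; apply/(is_derive_snd (fun q => g q i j)); exact: di.
  have hp : is_derive (x, x) ((1, 1) : R * R) (fun q => g q i j)
      ('D_(1, 0) g (x, x) i j + 'D_(0, 1) g (x, x) i j).
    apply: is_derive_eq (is_derive_partials _ oA Ap h1 h2 (ci _ _ Ap) (ci _ _ Ap)) _.
    by congr (_ + _); exact: mul1r.
  rewrite mxE; apply/is_derive_ball => e e0.
  have [r r0 hr] := (is_derive_ball _ _ _ _).1 hp e e0; by exists r.
split.
  have h := key (@reM R \o f) sr.
  apply: is_derive_eq h _.
  by rewrite reMD; congr (_ + _); apply/esym; exact: reM_cderive.
have h := key (@imM R \o f) si.
apply: is_derive_eq h _.
by rewrite imMD; congr (_ + _); apply/esym; exact: imM_cderive.
Qed.

End plane_maps.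

End csmooth.

(** * The extended frame and its factorization *)

Section loops.
Context {R : realType}.
Local Notation C := R[i].
Implicit Types g : C -> 'M[C]_2.

Lemma cder_toC (f : R -> 'M[R]_2) s D : is_derive s (1 : R) f D ->
  cder (fun s => toC (f s)) s 1 (toC D).
Proof.
move=> h; split.
  by rewrite reM_toC (_ : _ \o _ = f) //; apply/funext => t; rewrite /= reM_toC.
rewrite imM_toC (_ : _ \o _ = fun=> 0); first exact: is_derive_cst.
by apply/funext => t; rewrite /= imM_toC.
Qed.

Lemma holomorphic_disc_quad g : (forall z, quad_diff g z) -> holomorphic_disc g.
Proof.
move=> hg; split; last by move=> z _; exact (quad_diff_derivable (hg z)).
apply: continuous_subspaceT => z.
exact (mx_derivable_cont (quad_diff_derivable (hg z))).
Qed.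

Lemma G_sigma_sharp g : G_sigma g -> G_sigma (fun l => sharp (g l)).
Proof.
move=> [sg hg]; split; first exact: (csmooth_sharp (@openT _) sg).
move=> l hl; have [h1 h2 h3] := hg l hl; split.
- by rewrite det_sharp.
- by rewrite -[in RHS]h2; apply: mx2P; rewrite !mxE //= rmorphN.
- by rewrite h3 !Ad_e3; apply: mx2P; rewrite !mxE //= opprK.
Qed.

(** On the circle inversion changes the angle [t] into [- t], and it commutes with conjugation and
    with the sign. *)
Lemma G_sigma_invz g : G_sigma g -> G_sigma (fun l => g l^-1).
Proof.
move=> [sg hg]; split.
  have h : csmooth [set: R] ((fun t : R => g (cos t +i* sin t)) \o -%R).
    apply: (csmooth_affine (h := -%R) (Dh := -%R) _ _ sg).
      exact: opp_continuous.
    by move=> t p v; rewrite opprD scalerN.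
  have -> : (fun t : R => g (cos t +i* sin t)^-1) =
      (fun t : R => g (cos t +i* sin t)) \o -%R.
    apply/funext => t; rewrite /= cosN sinN; congr g.
    have e : (cos t +i* sin t) * (cos t +i* - sin t) = 1 :> C.
      by apply: eqC; rewrite ?cReM ?cImM /= ?mulrN ?opprK -?expr2 ?cos2Dsin2 // mulrC addNr.
    exact (mulr1_eq e).
  exact h.
move=> l hl; have hl' : `|l^-1| = 1 by rewrite normfV hl invr1.
have [h1 h2 h3] := hg _ hl'; split=> //.
- by rewrite -conjc_inv.
- by rewrite invrN.
Qed.

End loops.

Section construction.
Context {R : realType} (I : set R) (x0 : R).
Local Notation C := R[i].
Variables (b0 : R -> R) (be ga : R -> 'M[R]_2) (A0 : 'M[R]_2).
Hypotheses (oI : open I) (iI : is_interval I) (Ix0 : I x0).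
Hypotheses (sb0 : smooth I b0) (sbe : smooth I be) (sga : smooth I ga).
Hypothesis be_off : forall x, I x -> be x 0 0 = 0 /\ be x 1 1 = 0.
Hypothesis ga_off : forall x, I x -> ga x 0 0 = 0 /\ ga x 1 1 = 0.
Hypothesis detA0 : \det A0 = 1.

Definition potential (l : C) (x : R) : 'M[C]_2 :=
  toC (b0 x *: e3) + l *: toC (be x) + l^-1 *: toC (ga x).

Let B1 x := be x 0 1.
Let B2 x := be x 1 0.
Let c1 x := ga x 0 1.
Let c2 x := ga x 1 0.

(** In general [mu] is merely continuous and [m] merely of class C^1; they enter the estimates and
    the shape of the domain, never the equations. *)
Let mu x := 1 + `|b0 x| + (`|B1 x| + `|B2 x|) + (`|c1 x| + `|c2 x|).
Let m := oint mu x0.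

Let entry_smooth (F : R -> 'M[R]_2) i j : smooth I F -> smooth I (fun x => F x i j).
Proof. by move=> /smoothP sF; apply/smoothP => n; exact: ((Ck_mxP n F oI).1 (sF n) i j). Qed.

Let mu1 x : 1 <= mu x.
Proof.
rewrite /mu; have := normr_ge0 (b0 x); have := normr_ge0 (B1 x); have := normr_ge0 (B2 x).
by have := normr_ge0 (c1 x); have := normr_ge0 (c2 x); lra.
Qed.

Let mu0 x : 0 <= mu x. Proof. exact: le_trans ler01 (mu1 x). Qed.

Let b0_le x : `|b0 x| <= mu x.
Proof.
rewrite /mu; have := normr_ge0 (B1 x); have := normr_ge0 (B2 x).
by have := normr_ge0 (c1 x); have := normr_ge0 (c2 x); lra.
Qed.

Let B_le x : `|B1 x| + `|B2 x| <= mu x.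
Proof.
rewrite /mu; have := normr_ge0 (b0 x).
by have := normr_ge0 (c1 x); have := normr_ge0 (c2 x); lra.
Qed.

Let c_le x : `|c1 x| + `|c2 x| <= mu x.
Proof.
rewrite /mu; have := normr_ge0 (b0 x).
by have := normr_ge0 (B1 x); have := normr_ge0 (B2 x); lra.
Qed.

Let norm_cont (f : R -> R) x : smooth I f -> I x -> {for x, continuous (fun x => `|f x|)}.
Proof.
move=> /smoothP/(_ 0%N)[cf _] Ix.
by apply: (@continuous_comp _ _ _ f Num.norm); [exact: cf|exact: norm_continuous].
Qed.

Let mu_cont x : I x -> {for x, continuous mu}.
Proof.
move=> Ix; apply: cvgD.
  apply: cvgD; first by apply: cvgD; [exact: cvg_cst|exact: norm_cont].
  by apply: cvgD; apply: norm_cont => //; exact: entry_smooth.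
by apply: cvgD; apply: norm_cont => //; exact: entry_smooth.
Qed.

Let I_seg' x y s : I x -> I y -> seg x y s -> I s.
Proof. by move=> Ix Iy /orP[]; [exact: iI Ix Iy _|exact: iI Iy Ix _]. Qed.

Let dm x : I x -> is_derive x (1 : R) m (mu x).
Proof. by move=> Ix; apply: (oint_derive oI mu_cont) => s; exact: I_seg'. Qed.

Let Om := strip I m.

Let goursat_sol := goursat oI iI dm (fun x _ => b0_le x) (fun x _ => B_le x)
  (fun x _ => c_le x) sb0 (entry_smooth 0 1 sbe) (entry_smooth 1 0 sbe)
  (entry_smooth 0 1 sga) (entry_smooth 1 0 sga).

Let oOm : open Om. Proof. exact: (strip_open oI dm). Qed.

Let cbdD (M N : 'M[C]_2) (p q : R) : cbd M p -> cbd N q -> cbd (M + N) (p + q).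
Proof.
move=> hM hN i j; have [m1 m2] := hM i j; have [n1 n2] := hN i j.
rewrite mxE cReD cImD.
by split; rewrite (le_trans (ler_normD _ _)) // lerD.
Qed.

Let rl (l : C) : R := `|complex.Re l| + `|complex.Im l|.

Let cbd_scale l (U : 'M[R]_2) q : (forall i j, `|U i j| <= q) ->
  cbd (l *: toC U) (2 * rl l * q).
Proof.
by move=> h; apply: cbdZ (cbd_toC h); rewrite /rl ?lerDl ?lerDr normr_ge0.
Qed.

Let off_le (U : 'M[R]_2) (q : R) : U 0 0 = 0 -> U 1 1 = 0 -> `|U 0 1| + `|U 1 0| <= q ->
  forall i j, `|U i j| <= q.
Proof.
move=> h0 h1 hq i j; have n1 := normr_ge0 (U 0 1); have n2 := normr_ge0 (U 1 0).
have z (k : 'I_2) : k = 0 \/ k = 1.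
  by case: k => [[|[|//]] hk]; [left|right]; apply/val_inj.
by case: (z i) => ->; case: (z j) => ->; rewrite ?h0 ?h1 ?normr0; lra.
Qed.

Let e3_le (u q : R) : `|u| <= q -> forall i j, `|(u *: e3 : 'M[R]_2) i j| <= q.
Proof.
move=> hu i j; have q0 : 0 <= q by exact: le_trans hu.
rewrite !mxE; case: ifP => _; case: ifP => _.
- by rewrite mulrN1 normrN.
- by rewrite mulr0 normr0.
- by rewrite mulr0 normr0.
- by rewrite mulr1.
Qed.

Let be_le x : I x -> forall i j, `|be x i j| <= mu x.
Proof. by move=> /be_off[h1 h2]; apply: off_le => //; exact: B_le. Qed.

Let ga_le x : I x -> forall i j, `|ga x i j| <= mu x.
Proof. by move=> /ga_off[h1 h2]; apply: off_le => //; exact: c_le. Qed.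

Let IR : set (R * R) := [set p | I p.1].
Let oIR : open IR.
Proof. by apply: (@open_comp _ _ (fst : R * R -> R) I) => // p _; exact: cvg_fst. Qed.

Let csmooth_fst (F : R -> 'M[C]_2) : csmooth I F -> csmooth IR (fun p => F p.1).
Proof.
move=> sF; apply: (csmooth_affine (h := fst) (Dh := fst) _ _ sF) => //.
by move=> p; exact: cvg_fst.
Qed.

Let csmooth_slice1 (A : set (R * R)) (F : R * R -> 'M[C]_2) y : csmooth A F ->
  csmooth [set s | A (s, y)] (fun s => F (s, y)).
Proof.
move=> sF.
apply: (csmooth_affine (h := fun s : R => (s, y)) (Dh := fun s : R => (s, 0 : R)) _ _ sF).
  exact: continuous_pairl.
by move=> t p v; rewrite -[RHS]/(t *: v + p, t * 0 + y) mulr0 add0r.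
Qed.

Let smooth_e3 (V : normedModType R) (A : set V) (f : V -> R) : open A -> smooth A f ->
  smooth A (fun p => f p *: (e3 : 'M[R]_2)).
Proof.
move=> oA /smoothP sf; apply/smoothP => n; apply/(Ck_mxP _ _ oA) => i j.
apply: (Ck_eq oA _ (CkM oA (sf n) (Ck_cst n ((e3 : 'M[R]_2) i j) oA))) => p _.
by rewrite [RHS]mxE.
Qed.

Let potential_tr l x : I x -> \tr (potential l x) = 0.
Proof.
move=> Ix; have [h1 h2] := be_off Ix; have [h3 h4] := ga_off Ix.
rewrite /potential !mxtraceD !mxtraceZ !trace_map_mx mxtraceZ !tr2 h1 h2 h3 h4.
by rewrite !addr0 !rmorph0 !mulr0 !addr0 !mxE /= addNr mulr0 rmorph0.
Qed.

Let potential_smooth l : csmooth I (potential l).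
Proof.
apply: csmoothD => //; last by apply: csmoothZ => //; exact: csmooth_toC.
apply: csmoothD => //; first by apply: csmooth_toC => //; exact: smooth_e3.
by apply: csmoothZ => //; exact: csmooth_toC.
Qed.

(** Every [l] is treated by itself and the solutions are collected by choice. At [l = 0] the
    convention [0^-1 = 0] leaves a smooth potential. *)
Lemma potential_frame : exists X : R -> C -> 'M[C]_2, forall l,
  [/\ csmooth I (fun x => X x l), forall x, I x -> \det (X x l) = 1,
      forall x, I x -> cder (fun x => X x l) x 1 (X x l *m potential l x)
    & X x0 l = toC A0].
Proof.
suff ex l : exists Xl : R -> 'M[C]_2, [/\ csmooth I Xl, forall x, I x -> \det (Xl x) = 1,
      forall x, I x -> cder Xl x 1 (Xl x *m potential l x) & Xl x0 = toC A0].
  by have [X hX] := choice ex; exists (fun x l => X l x).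
have st : star (fun y => 0 * y + x0) IR.
  by move=> s t u; rewrite mul0r add0r => Is; exact: (I_seg' Ix0 Is).
pose L := 1 + 2 * rl l + 2 * rl l^-1.
have r0 l' : 0 <= rl l' by rewrite addr_ge0.
have L0 : 0 < L by rewrite /L; have := r0 l; have := r0 l^-1; lra.
have sa : csmooth IR (fun p => potential l p.1) by exact: csmooth_fst (potential_smooth l).
have ba p : IR p -> cbd (potential l p.1) (L * mu p.1).
  move=> Ip; have -> : L * mu p.1 = mu p.1 + 2 * rl l * mu p.1 + 2 * rl l^-1 * mu p.1.
    by rewrite /L; ring.
  exact (cbdD (cbdD (cbd_toC (e3_le (b0_le p.1))) (cbd_scale l (be_le Ip)))
    (cbd_scale l^-1 (ga_le Ip))).
have [E [sE dE E0 _]] := complex_lin_ode oIR st (fun p Ip => dm Ip) (fun p _ => mu0 p.1) L0 sa ba.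
have E00 : E (x0, 0) = 1%:M by have := E0 x0 0 Ix0; rewrite mul0r add0r.
have dX x : I x -> cder (fun x => toC A0 *m E (x, 0)) x 1
    (toC A0 *m E (x, 0) *m potential l x).
  by move=> Ix; apply: cder_eq (cderMl (toC A0) (dE x 0 Ix)) _; rewrite mulmxA.
exists (fun x => toC A0 *m E (x, 0)); split.
- apply: csmooth_mul => //; first exact: csmooth_cst.
  exact: (csmooth_slice1 0 sE).
- move=> x Ix; rewrite (sl2_ode_det (E := fun x => toC A0 *m E (x, 0)) (a := potential l) (x0 := x0)).
  + by rewrite E00 mulmx1 det_map_mx detA0 rmorph1.
  + by move=> s ss; apply: potential_tr; exact: (I_seg' Ix0 Ix ss).
  + by move=> s ss; apply: dX; exact: (I_seg' Ix0 Ix ss).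
- exact: dX.
- by rewrite E00 mulmx1.
Qed.

Section frame.
Variables (phi b : R * R -> R) (X : R -> C -> 'M[C]_2).
Hypotheses (sphi : smooth Om phi) (sb : smooth Om b).
Hypothesis dphi : forall x y, Om (x, y) ->
  is_derive x (1 : R) (fun s => phi (s, y)) (b (x, y)).
Hypothesis db : forall x y, Om (x, y) ->
  is_derive y (1 : R) (fun t => b (x, t)) (goursat_rhs B1 B2 c1 c2 phi (x, y)).
Hypothesis phi_diag : forall x, I x -> phi (x, x) = 0 /\ b (x, x) = b0 x.
Hypothesis phi_le : forall p, Om p -> `|phi p| <= 1 /\ `|b p| <= 2 * mu p.1.
Hypothesis hX : forall l, [/\ csmooth I (fun x => X x l), forall x, I x -> \det (X x l) = 1,
      forall x, I x -> cder (fun x => X x l) x 1 (X x l *m potential l x)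
    & X x0 l = toC A0].

Definition gam (p : R * R) : 'M[R]_2 :=
  mx2 0 (c1 p.2 * expR (2 * phi p)) (c2 p.2 * expR (- (2 * phi p))) 0.

Definition conn_x (l : C) (p : R * R) : 'M[C]_2 := toC (b p *: e3) + l *: toC (be p.1).
Definition conn_y (l : C) (p : R * R) : 'M[C]_2 := l^-1 *: toC (gam p).

Let Om_star : star (fun y => 1 * y + 0) Om.
Proof. exact: (strip_star iI dm (fun x _ => b0_le x)). Qed.

Let Om_sym x y : Om (x, y) -> Om (y, x). Proof. exact: strip_sym. Qed.

Let Om_seg x y s : Om (x, y) -> seg y x s -> Om (s, y).
Proof. by move=> Op ss; apply: (star_seg Om_star Op); rewrite mul1r addr0. Qed.

Let Om_seg2 x y t : Om (x, y) -> seg x y t -> Om (x, t).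
Proof. by move=> /Om_sym Op ss; apply: Om_sym; exact: Om_seg Op ss. Qed.

Let Om_diag x : I x -> Om (x, x). Proof. exact: strip_diag. Qed.

Let gam_smooth : smooth Om gam.
Proof.
apply/smoothP => n; apply/(Ck_mxP _ _ oOm) => i j.
have hphi : Ck n Om phi by exact: (smoothP _ _).1 sphi n.
have h2 : Ck n Om (fun p => 2 * phi p) by exact: (CkM oOm (Ck_cst n (2 : R) oOm) hphi).
have e1 : Ck n Om (fun p => expR (2 * phi p)) by exact: (Ck_comp oOm (Ck_expR n) h2).
have e2 : Ck n Om (fun p => expR (- (2 * phi p))).
  exact: (Ck_comp oOm (Ck_expR n) (CkN oOm h2)).
have k1 := CkM oOm (Ck_snd m n (entry_smooth 0 1 sga)) e1.
have k2 := CkM oOm (Ck_snd m n (entry_smooth 1 0 sga)) e2.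
have k0 := Ck_cst n (0 : R) oOm.
case: i => [[|[|//]] hi]; case: j => [[|[|//]] hj].
- by apply: (Ck_eq oOm _ k0) => p _; rewrite mxE.
- by apply: (Ck_eq oOm _ k1) => p _; rewrite mxE.
- by apply: (Ck_eq oOm _ k2) => p _; rewrite mxE.
- by apply: (Ck_eq oOm _ k0) => p _; rewrite mxE.
Qed.

Let gam_le p : Om p -> forall i j, `|gam p i j| <= expR 2 * mu p.2.
Proof.
move=> Op; have [h1 _] := phi_le Op; have h2 : `|2 * phi p| <= 2 by rewrite normrM ger0_norm //; lra.
have e1 := expR_le2 h2; have e2 : expR (- (2 * phi p)) <= expR 2 by rewrite expR_le2 ?normrN.
apply: off_le; rewrite ?mxE //= !normrM !(ger0_norm (expR_ge0 _)).
have n1 := normr_ge0 (c1 p.2); have n2 := normr_ge0 (c2 p.2).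
have k1 := ler_wpM2l n1 e1; have k2 := ler_wpM2l n2 e2.
have k3 := ler_wpM2l (expR_ge0 (2 : R)) (c_le p.2).
lra.
Qed.

Let conn_x_tr l p : Om p -> \tr (conn_x l p) = 0.
Proof.
move=> [Ix _ _]; have [h1 h2] := be_off Ix.
rewrite /conn_x !mxtraceD !mxtraceZ !trace_map_mx mxtraceZ !tr2 h1 h2.
by rewrite !addr0 !rmorph0 !mulr0 !addr0 !mxE /= addNr mulr0 rmorph0.
Qed.

Let be_smooth_Om : smooth Om (fun p => be p.1).
Proof.
apply/smoothP => n; apply/(Ck_mxP _ _ oOm) => i j.
exact: (Ck_fst m n (entry_smooth i j sbe)).
Qed.

Let conn_x_smooth l : csmooth Om (conn_x l).
Proof.
apply: csmoothD => //; first by apply: csmooth_toC => //; exact: smooth_e3.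
by apply: csmoothZ => //; exact: csmooth_toC.
Qed.

Lemma frame_x : exists G : C -> R * R -> 'M[C]_2, forall l,
  [/\ csmooth Om (G l),
      forall x y, Om (x, y) -> cder (fun s => G l (s, y)) x 1 (G l (x, y) *m conn_x l (x, y))
    & forall y, I y -> G l (y, y) = 1%:M].
Proof.
suff ex l : exists Gl : R * R -> 'M[C]_2, [/\ csmooth Om Gl,
      forall x y, Om (x, y) -> cder (fun s => Gl (s, y)) x 1 (Gl (x, y) *m conn_x l (x, y))
    & forall y, I y -> Gl (y, y) = 1%:M].
  by have [G hG] := choice ex; exists G.
pose L := 2 + 2 * rl l.
have L0 : 0 < L by rewrite /L /rl; have := normr_ge0 (complex.Re l); have := normr_ge0 (complex.Im l); lra.
have ba p : Om p -> cbd (conn_x l p) (L * mu p.1).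
  move=> Op; have [I1 _ _] := Op; have [_ hb] := phi_le Op.
  have -> : L * mu p.1 = 2 * mu p.1 + 2 * rl l * mu p.1 by rewrite /L; ring.
  exact (cbdD (cbd_toC (e3_le hb)) (cbd_scale l (be_le I1))).
have dmO p : Om p -> is_derive p.1 (1 : R) m (mu p.1) by case=> I1 _ _; exact: dm.
have [E [sE dE E0 _]] := complex_lin_ode oOm Om_star dmO (fun p _ => mu0 p.1) L0 (conn_x_smooth l) ba.
exists E; split=> // y Iy.
by have := E0 y y (Om_diag Iy); rewrite mul1r addr0.
Qed.

(** The parameter stands for the inverse of the loop parameter, so the point at infinity becomes
    [l = 0]. *)
Lemma frame_y x : I x -> exists H : C -> R -> 'M[C]_2, forall l,
  (forall t, Om (x, t) -> cder (H l) t 1 (H l t *m pencil (fun=> 0) (fun t => gam (x, t)) l t))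
  /\ H l x = 1%:M.
Proof.
move=> Ix.
suff ex l : exists Hl : R -> 'M[C]_2, (forall t, Om (x, t) ->
    cder Hl t 1 (Hl t *m pencil (fun=> 0) (fun t => gam (x, t)) l t)) /\ Hl x = 1%:M.
  by have [H hH] := choice ex; exists H.
pose A : set (R * R) := [set q | Om (x, q.1)].
have oA : open A.
  apply: (@open_comp _ _ (fun q : R * R => (x, q.1)) Om) => // p _.
  apply: (@cvg_pair _ _ _ _ (nbhs x) (nbhs p.1)); [exact: cvg_cst|exact: cvg_fst].
have stA : star (fun y => 0 * y + x) A.
  by move=> s t u; rewrite mul0r add0r => Os; exact: (Om_seg2 Os).
pose L := 1 + 2 * rl l * expR 2.
have rl0 : 0 <= rl l by rewrite addr_ge0.
have e20 := expR_ge0 (2 : R).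
have L0 : 0 < L by rewrite /L; have := mulr_ge0 rl0 e20; lra.
have dmA p : A p -> is_derive p.1 (1 : R) m (mu p.1) by case=> _ I1 _; exact: dm.
have ba p : A p -> cbd (pencil (fun=> 0) (fun t => gam (x, t)) l p.1) (L * mu p.1).
  move=> Ap; have -> : L * mu p.1 = mu p.1 + 2 * rl l * (expR 2 * mu p.1) by rewrite /L; ring.
  apply: cbdD (cbd_scale l (gam_le Ap)); apply: cbd_toC => i j.
  by rewrite mxE normr0.
have sa : csmooth A (fun q => pencil (fun=> 0) (fun t => gam (x, t)) l q.1).
  apply: csmoothD => //.
    by apply: csmooth_toC => //; apply/smoothP => n; exact: Ck_cst.
  apply: csmoothZ => //.
  apply: (csmooth_affine (h := fun q : R * R => (x, q.1)) (Dh := fun q : R * R => (0 : R, q.1))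
    _ _ (csmooth_toC oOm gam_smooth)).
    move=> p; apply: (@cvg_pair _ _ _ _ (nbhs x) (nbhs p.1)); [exact: cvg_cst|exact: cvg_fst].
  by move=> t p v; rewrite -[RHS]/(t * 0 + x, t *: v.1 + p.1) mulr0 add0r.
have [E [_ dE E0 _]] := complex_lin_ode oA stA dmA (fun p _ => mu0 p.1) L0 sa ba.
exists (fun t => E (t, 0)); split; first by move=> t Ot; exact: (dE t 0 Ot).
by have := E0 x 0 (Om_diag Ix); rewrite mul0r add0r.
Qed.

Variable G : C -> R * R -> 'M[C]_2.
Hypothesis hG : forall l,
  [/\ csmooth Om (G l),
      forall x y, Om (x, y) -> cder (fun s => G l (s, y)) x 1 (G l (x, y) *m conn_x l (x, y))
    & forall y, I y -> G l (y, y) = 1%:M].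

Definition Fhat (p : R * R) (l : C) : 'M[C]_2 := X p.2 l *m G l p.

Let sG l : csmooth Om (G l). Proof. by have [] := hG l. Qed.
Let dG l x y : Om (x, y) ->
  cder (fun s => G l (s, y)) x 1 (G l (x, y) *m conn_x l (x, y)).
Proof. by have [_ h _] := hG l; exact: h. Qed.
Let G1 l y : I y -> G l (y, y) = 1%:M. Proof. by have [_ _ h] := hG l; exact: h. Qed.

Let detG l p : Om p -> \det (G l p) = 1.
Proof.
case: p => x y Op; have [Ix Iy _] := Op.
rewrite (sl2_ode_det (E := fun s => G l (s, y)) (a := fun s => conn_x l (s, y)) (x0 := y)).
- by rewrite G1 // det1.
- by move=> s ss; apply: conn_x_tr; exact: Om_seg Op ss.
- by move=> s ss; apply: dG; exact: Om_seg Op ss.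
Qed.

Lemma Fhat_smooth l : csmooth Om (fun p => Fhat p l).
Proof.
have [sX _ _ _] := hX l; apply: csmooth_mul => //.
apply: (@csmooth_sub _ _ _ (snd @^-1` I)); first by move=> p [].
by apply: (csmooth_affine (h := snd) (Dh := snd) _ _ sX) => // p; exact: cvg_snd.
Qed.

Lemma Fhat_det l p : Om p -> \det (Fhat p l) = 1.
Proof.
move=> Op; have [_ Iy _] := Op; have [_ dX _ _] := hX l.
by rewrite /Fhat det_mulmx dX // detG // mulr1.
Qed.

Lemma Fhat_diag l x : I x -> Fhat (x, x) l = X x l.
Proof. by move=> Ix; rewrite /Fhat G1 // mulmx1. Qed.

Lemma Fhat_dx l x y : Om (x, y) ->
  cder (fun p => Fhat p l) (x, y) (1, 0) (Fhat (x, y) l *m conn_x l (x, y)).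
Proof.
move=> Op; apply/cder_fst; apply: cder_eq (cderMl (X y l) (dG l Op)) _.
by rewrite mulmxA.
Qed.

Let dconn_x l x y : Om (x, y) -> cder (conn_x l) (x, y) (0, 1)
  (toC (goursat_rhs B1 B2 c1 c2 phi (x, y) *: e3)).
Proof.
move=> Op; apply/cder_snd; rewrite -[toC _]addr0.
apply: cderD; last exact (cder_cst (l *: toC (be x)) y (1 : R)).
have h : is_derive y (1 : R) (fun t => b (x, t) *: (e3 : 'M[R]_2)) (goursat_rhs B1 B2 c1 c2 phi (x, y) *: e3).
  apply/is_derive_mxP => i j; rewrite mxE.
  have h1 := is_deriveM (db Op) (is_derive_cst ((e3 : 'M[R]_2) i j) y (1 : R)).
  rewrite (_ : (fun q => _) = (fun t => b (x, t)) * cst ((e3 : 'M[R]_2) i j)).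
    by apply: is_derive_eq h1 _; rewrite scaler0 add0r; exact: mulrC.
  by apply/funext => t; rewrite mxE.
split.
  by rewrite reM_toC (_ : _ \o _ = (fun t => b (x, t) *: (e3 : 'M[R]_2))) //;
    apply/funext => t; rewrite /= reM_toC.
rewrite imM_toC (_ : _ \o _ = fun=> 0); first exact: is_derive_cst.
by apply/funext => t; rewrite /= imM_toC.
Qed.

(* The p-part of the zero curvature equation. *)
Let dgam_x x y : Om (x, y) ->
  is_derive x (1 : R) (fun s => gam (s, y)) (- (b (x, y)) *: lie e3 (gam (x, y))).
Proof.
move=> Op; have hp := dphi Op.
have h2 : is_derive x (1 : R) (fun s => 2 * phi (s, y)) (2 * b (x, y)).
  exact (is_deriveZ (2 : R) hp).
have e1 := is_deriveZ (c1 y : R) (is_derive1_comp (g := fun s => 2 * phi (s, y))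
  (is_derive_expR (2 * phi (x, y))) h2).
have e2 := is_deriveZ (c2 y : R) (is_derive1_comp (g := - (fun s => 2 * phi (s, y)))
  (is_derive_expR (- (2 * phi (x, y)))) (is_deriveN h2)).
have k0 := is_derive_cst (0 : R) x (1 : R).
apply/is_derive_mxP => i j; case: i => [[|[|//]] hi]; case: j => [[|[|//]] hj].
- apply: is_derive_eq.
    by rewrite (_ : (fun s => _) = cst 0); [exact: k0|apply/funext => s; rewrite mxE].
  by rewrite !mxE !big_ord_recl !big_ord0 !mxE /=; ring.
- apply: is_derive_eq.
    by rewrite (_ : (fun s => _) = c1 y \*: (expR \o (fun s => 2 * phi (s, y))));
      [exact: e1|apply/funext => s; rewrite mxE].
  rewrite !mxE !big_ord_recl !big_ord0 !mxE /=.
  rewrite -[LHS]/(c1 y * (expR (2 * phi (x, y)) * (2 * b (x, y)))); ring.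
- apply: is_derive_eq.
    by rewrite (_ : (fun s => _) = c2 y \*: (expR \o (- (fun s => 2 * phi (s, y)))));
      [exact: e2|apply/funext => s; rewrite mxE].
  rewrite !mxE !big_ord_recl !big_ord0 !mxE /=.
  rewrite -[LHS]/(c2 y * (expR (- (2 * phi (x, y))) * (- (2 * b (x, y))))); ring.
- apply: is_derive_eq.
    by rewrite (_ : (fun s => _) = cst 0); [exact: k0|apply/funext => s; rewrite mxE].
  by rewrite !mxE !big_ord_recl !big_ord0 !mxE /=; ring.
Qed.

(** Since [l * l^-1 = 1], the bracket of beta_1 and gamma is free of [l] and equals the right-hand
    side of the scalar equation times [e3]; the bracket of [b e3] and gamma is the term in
    [l^-1]. *)
Let curvature l p : l != 0 -> Om p ->
  toC (goursat_rhs B1 B2 c1 c2 phi p *: e3) - l^-1 *: toC (- (b p) *: lie e3 (gam p)) =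
  conn_x l p *m conn_y l p - conn_y l p *m conn_x l p.
Proof.
move=> l0 [Ix _ _]; have [h1 h2] := be_off Ix.
have -> : goursat_rhs B1 B2 c1 c2 phi p *: e3 = be p.1 *m gam p - gam p *m be p.1.
  apply: mx2P; rewrite [LHS]mxE [RHS]mxE [X in _ = _ + X]mxE !mulmx2E !mxE /= ?h1 ?h2;
  by rewrite /goursat_rhs /B1 /B2 /c1 /c2; ring.
have -> : lie e3 (gam p) = e3 *m gam p - gam p *m e3 by [].
rewrite /conn_x /conn_y mulmxDl mulmxDr -!scalemxAl -!scalemxAr !scalerA.
rewrite mulfV // mulVf // !scale1r -!toC_mul -!scalemxAl -!scalemxAr.
rewrite /toC !map_mxZ !rmorphN /= !map_mxB !scaleNr !scalerN opprK !scalerBr.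
have za (V : zmodType) (p' q' u v : V) : p' - q' + (u - v) = u + p' - (v + q').
  by rewrite addrACA [p' + u]addrC -opprD [q' + v]addrC.
exact (za _ _ _ _ _).
Qed.

(** The defect [E] of the y-equation satisfies the x-equation of [Fhat], by flatness and exchange of
    derivatives, and it vanishes on the diagonal. *)
Lemma Fhat_dy l p : l != 0 -> Om p ->
  cder (fun p => Fhat p l) p (0, 1) (Fhat p l *m conn_y l p).
Proof.
move=> l0; case: p => x y Op; have Iy : I y by case: Op.
have sF := Fhat_smooth l.
pose D p := cderive (fun p => Fhat p l) p (0, 1).
have dF p : Om p -> cder (fun p => Fhat p l) p (0, 1) (D p).
  by move=> Oq; exact: (cder_smooth _ sF Oq).
pose E s := D (s, y) - Fhat (s, y) l *m conn_y l (s, y).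
have dE s : seg y x s -> cder E s 1 (E s *m conn_x l (s, y)).
  move=> ss; have Os := Om_seg Op ss.
  have dfx q : Om q -> cder (fun p => Fhat p l) q (1, 0) (Fhat q l *m conn_x l q).
    by case: q => u v; exact: Fhat_dx.
  have h1 := cder_mixed oOm sF Os dfx (cder_mul (dF _ Os) (dconn_x l Os)).
  have h2 := cderZ l^-1 (cder_toC (dgam_x Os)).
  have h3 := (cder_fst _ _ _ _).1 (Fhat_dx l Os).
  apply: cder_eq (cderD ((cder_fst _ _ _ _).1 h1) (cderN (cder_mul h3 h2))) _.
  have hc := curvature l0 Os; rewrite /E.
  have -> : l^-1 *: toC (- (b (s, y)) *: lie e3 (gam (s, y))) =
     toC (goursat_rhs B1 B2 c1 c2 phi (s, y) *: e3)
       - (conn_x l (s, y) *m conn_y l (s, y) - conn_y l (s, y) *m conn_x l (s, y)).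
    by rewrite -hc opprB addrC subrK.
  rewrite mulmxBl !mulmxBr !mulmxA.
  have za (V : zmodType) (d r p q : V) : d + r - (p + (r - (p - q))) = d - q.
    by rewrite opprB addrCA [p + _]addrC subrK opprD addrA addrK.
  exact (za _ _ _ _ _).
(* Along the diagonal [Fhat] is [X], whose coefficient is there the sum of [conn_x] and [conn_y];
   cancelling the x-part leaves the y-equation. *)
have E0 : E y = 0.
  have Oy := Om_diag Iy; have [_ _ dX _] := hX l.
  have h1 := cder_diag oOm sF Oy.
  have h2 : cder (fun t => Fhat (t, t) l) y 1 (X y l *m potential l y).
    apply: near_eq_cder (dX y Iy).
    by apply: filterS (open_nbhs_nbhs (conj oI Iy)) => t It; rewrite Fhat_diag.
  have := cder_unique h1 h2; rewrite (cder_val (Fhat_dx l Oy)) Fhat_diag // -/(D (y, y)).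
  have [p1 p2] := phi_diag Iy.
  have -> : potential l y = conn_x l (y, y) + conn_y l (y, y).
    rewrite /potential /conn_x /conn_y /= p2; congr (_ + _ *: toC _).
    have [g1 g2] := ga_off Iy.
    by apply: mx2P; rewrite !mxE //= p1 mulr0 ?oppr0 expR0 mulr1.
  rewrite [X in _ = X]mulmxDr => /addrI h3.
  by rewrite /E h3 Fhat_diag // subrr.
(* A vanishing [E] is singular, so it is compared with [G], of determinant 1: the product of [E]
   with the adjugate of [G] is constant along the segment. *)
have h := sl2_ode_cst (E1 := E) (E2 := fun s => G l (s, y)) (a := fun s => conn_x l (s, y))
  (fun s ss => conn_x_tr l (Om_seg Op ss)) dE (fun s ss => dG l (Om_seg Op ss)).
have Ex : E x = 0.
  by rewrite -[LHS]mulmx1 -(sharp_mul (detG l Op)) mulmxA h E0 !mul0mx.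
apply: cder_eq (dF _ Op) _; apply/eqP; rewrite -subr_eq0; apply/eqP; exact: Ex.
Qed.

Let smooth_slice1 (F : R * R -> 'M[R]_2) y : smooth Om F ->
  smooth [set s | Om (s, y)] (fun s => F (s, y)).
Proof.
move=> /smoothP sF; apply/smoothP => n.
apply: (Ck_affine (L := fun s : R => (s, y)) (DL := fun s : R => (s, 0 : R)) _ _ (sF n)).
  exact: continuous_pairl.
by move=> t p v; rewrite -[RHS]/(t *: v + p, t * 0 + y) mulr0 add0r.
Qed.

Let smooth_slice2 (F : R * R -> 'M[R]_2) x : smooth Om F ->
  smooth [set t | Om (x, t)] (fun t => F (x, t)).
Proof.
move=> /smoothP sF; apply/smoothP => n.
apply: (Ck_affine (L := fun t : R => (x, t)) (DL := fun t : R => (0 : R, t)) _ _ (sF n)).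
  exact: continuous_pairr.
by move=> t p v; rewrite -[RHS]/(t * 0 + x, t *: v + p) mulr0 add0r.
Qed.

(** * Loop properties of the positive factor *)

Section slice_x.
Variables (x y : R).
Hypothesis Op : Om (x, y).
Let S : set R := [set s | Om (s, y)].
Let P s : 'M[R]_2 := b (s, y) *: e3.
Let E l s := G l (s, y).
Let oS : open S. Proof. exact: slice_open. Qed.
Let stS s t : S s -> seg y s t -> S t. Proof. exact: Om_seg. Qed.
Let dmS s : S s -> is_derive s (1 : R) m (mu s). Proof. by case=> Is _ _; exact: dm. Qed.
Let sP : smooth S P. Proof. exact: (smooth_slice1 y (smooth_e3 oOm sb)). Qed.
Let sQ : smooth S be.
Proof.
by move/smoothP : sbe => h; apply/smoothP => n; apply: Ck_sub (h n) => s [].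
Qed.
Let bP s : S s -> forall i j, `|P s i j| <= 2 * mu s.
Proof. by move=> Ss; apply: e3_le; have [] := phi_le Ss. Qed.
Let bQ s : S s -> forall i j, `|be s i j| <= 2 * mu s.
Proof. by move=> [Is _ _] i j; apply: le_trans (be_le Is i j) _; have := mu0 s; lra. Qed.
Let diagP s : S s -> [/\ P s 0 1 = 0, P s 1 0 = 0 & P s 0 0 + P s 1 1 = 0].
Proof. by move=> _; split; rewrite !mxE /= ?mulr0 // mulrN1 mulr1 addNr. Qed.
Let offQ s : S s -> be s 0 0 = 0 /\ be s 1 1 = 0. Proof. by case=> /be_off. Qed.
Let dE l s : S s -> cder (E l) s 1 (E l s *m pencil P be l s).
Proof. exact: dG. Qed.
Let E0 l : E l y = 1%:M. Proof. by have [_ Iy _] := Op; exact: G1. Qed.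

Lemma G_conj l : map_mx conjc (G (conjc l) (x, y)) = G l (x, y).
Proof. exact: (pencil_conj stS diagP offQ dE E0 Op). Qed.

Lemma G_twist l : G (- l) (x, y) = Ad e3 (G l (x, y)).
Proof. exact: (pencil_twist stS diagP offQ dE E0 Op). Qed.

Lemma G_circle : csmooth [set: R] (fun t : R => G (cos t +i* sin t) (x, y)).
Proof.
exact: (pencil_circle oS stS dmS (fun s _ => mu0 s) (ltr0n R 2) sP sQ bP bQ diagP offQ dE E0 Op).
Qed.

Lemma G_quad z : quad_diff (fun l => G l (x, y)) z.
Proof.
exact: (pencil_quad oS stS dmS (fun s _ => mu0 s) (ltr0n R 2) sP sQ bP bQ diagP offQ dE E0 Op).
Qed.

End slice_x.

Lemma G_loop p : Om p -> G_sigma_plus (fun l => sharp (G l p)).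
Proof.
case: p => x y Op; split.
- apply: G_sigma_sharp; split; first exact: G_circle.
  by move=> l _; split; [exact: detG|exact: G_conj|exact: G_twist].
- by apply: holomorphic_disc_quad => z; apply: quad_diff_sharp; exact: G_quad.
- by move=> l _; rewrite det_sharp detG.
Qed.

(** * Loop properties of the negative factor *)

Section slice_y.
Variables (x y : R) (H : C -> R -> 'M[C]_2).
Hypothesis Op : Om (x, y).
Let S : set R := [set t | Om (x, t)].
Let P (t : R) : 'M[R]_2 := 0.
Let Q t := gam (x, t).
Hypothesis dH : forall l t, S t -> cder (H l) t 1 (H l t *m pencil P Q l t).
Hypothesis H0 : forall l, H l x = 1%:M.
Let oS : open S. Proof. exact: (open_snd (x := x) oOm). Qed.
Let stS s t : S s -> seg x s t -> S t. Proof. exact: Om_seg2. Qed.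
Let dmS s : S s -> is_derive s (1 : R) m (mu s). Proof. by case=> _ Is _; exact: dm. Qed.
Let sP : smooth S P. Proof. by apply/smoothP => n; exact: Ck_cst. Qed.
Let sQ : smooth S Q. Proof. exact: (smooth_slice2 x gam_smooth). Qed.
Let bP s : S s -> forall i j, `|P s i j| <= expR 2 * mu s.
Proof. by move=> _ i j; rewrite mxE normr0 mulr_ge0 ?expR_ge0. Qed.
Let bQ s : S s -> forall i j, `|Q s i j| <= expR 2 * mu s.
Proof. by move=> Ss; exact: (gam_le Ss). Qed.
Let diagP s : S s -> [/\ P s 0 1 = 0, P s 1 0 = 0 & P s 0 0 + P s 1 1 = 0].
Proof. by move=> _; rewrite !mxE addr0. Qed.
Let offQ s : S s -> Q s 0 0 = 0 /\ Q s 1 1 = 0. Proof. by move=> _; rewrite !mxE. Qed.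

Let H_det l : \det (H l y) = 1.
Proof. exact (pencil_det stS diagP offQ dH H0 Op l). Qed.

(** At parameter 0 the coefficient vanishes; this is the normalization at l = oo. *)
Let H_at0 : H 0 y = 1%:M.
Proof.
apply: (sl2_ode_unique (E1 := H 0) (E2 := fun=> 1%:M) (a := fun=> 0) (x0 := x)) => //.
- by move=> s _; exact: mxtrace0.
- move=> s ss; apply: cder_eq (dH _ (stS Op ss)) _.
  by rewrite /pencil /P scale0r addr0 /toC map_mx0.
- by move=> s _; rewrite mulmx0; exact: cder_cst.
- exact: det1.
Qed.

Lemma H_loop : G_sigma_minus_star (fun l => H l^-1 y).
Proof.
split.
- apply: (G_sigma_invz (g := fun l => H l y)); split.
    exact (pencil_circle oS stS dmS (fun s _ => mu0 s) (expR_gt0 2) sP sQ bP bQ diagP offQ dH H0 Op).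
  move=> l _; split; first exact: H_det.
    exact (pencil_conj stS diagP offQ dH H0 Op l).
  exact (pencil_twist stS diagP offQ dH H0 Op l).
- have -> : at_infinity 1 (fun l => H l^-1 y) = fun l => H l y.
    apply/funext => w; rewrite /at_infinity; case: eqP => [->|_]; last by rewrite invrK.
    by rewrite H_at0.
  apply: holomorphic_disc_quad => z.
  exact (pencil_quad oS stS dmS (fun s _ => mu0 s) (expR_gt0 2) sP sQ bP bQ diagP offQ dH H0 Op z).
- by move=> l _; exact: H_det.
Qed.

(** As functions of y both sides solve the equation with coefficient [conn_y l] and start from
    [X x l] on the diagonal. *)
Lemma Fhat_H l : l != 0 -> Fhat (x, y) l = X x l *m H l^-1 y.
Proof.
move=> l0; have [_ dX _ _] := hX l; have Ix : I x by case: Op.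
rewrite -[LHS](mulKsharp _ (dX x Ix)); congr (_ *m _); apply/esym.
apply: (sl2_ode_unique (E1 := H l^-1) (E2 := fun t => sharp (X x l) *m Fhat (x, t) l)
  (a := fun t => conn_y l (x, t)) (x0 := x)).
- by move=> s _; rewrite /conn_y mxtraceZ trace_map_mx tr2 !mxE /= addr0 rmorph0 mulr0.
- move=> s ss; apply: cder_eq (dH _ (stS Op ss)) _.
  by rewrite /pencil /P /toC map_mx0 add0r.
- move=> s ss; rewrite -mulmxA; apply: cderMl.
  exact: ((cder_snd _ _ _ _).1 (Fhat_dy l0 (stS Op ss))).
- by rewrite Fhat_diag // sharp_mul ?det1 // dX.
- by rewrite Fhat_diag // sharp_mul // dX.
Qed.

End slice_y.

(** The two expressions of [Fhat], as [X(x) H_-] and as [X(y) H_+^-1], are compared on the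
    circle. *)
Lemma factorization p : Om p -> exists Hm Hp : C -> 'M[C]_2,
  [/\ G_sigma_minus_star Hm, G_sigma_plus Hp,
      forall l, `|l| = 1 -> (X p.1 l)^-1 * X p.2 l = Hm l * Hp l,
      forall l, 1 <= `|l| -> Fhat p l = X p.1 l * Hm l
    & forall l, l != 0 -> `|l| <= 1 -> Fhat p l = X p.2 l * (Hp l)^-1].
Proof.
case: p => x y Op; have [Ix Iy _] := Op; have [H hH] := frame_y Ix.
have hF l : l != 0 -> Fhat (x, y) l = X x l *m H l^-1 y.
  exact (fun l0 => Fhat_H Op (fun l' t => (hH l').1 t) (fun l' => (hH l').2) l0).
have nz (l : C) : 1 <= `|l| -> l != 0.
  by move=> hl; rewrite -normr_gt0 (lt_le_trans ltr01).
exists (fun l => H l^-1 y), (fun l => sharp (G l (x, y))); split.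
- exact (H_loop Op (fun l' t => (hH l').1 t) (fun l' => (hH l').2)).
- exact: G_loop.
- move=> l hl; have l0 : l != 0 by apply: nz; rewrite hl.
  have [_ dX _ _] := hX l.
  have -> : H l^-1 y = sharp (X x l) *m Fhat (x, y) l.
    by rewrite hF // mulmxA sharp_mul ?mul1mx // dX.
  rewrite sharp_inv ?dX //; rewrite -[RHS]mulmxA /Fhat -[X y l *m _ *m _]mulmxA.
  by rewrite mul_sharp detG // mulmx1.
- by move=> l /nz; exact: hF.
- by move=> l _ _; rewrite sharp_inv ?det_sharp ?detG // sharpK.
Qed.

(** At [l = 1] the reality condition says that [G] is a real matrix. *)
Lemma Fhat_real p : Om p -> (forall x, I x -> imM (X x 1) = 0) -> imM (Fhat p 1) = 0.
Proof.
case: p => x y Op hX1; have Iy : I y by case: Op.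
have h : imM (G 1 (x, y)) = 0.
  have h1 := G_conj Op 1; rewrite conjc1 in h1.
  apply/matrixP => i j; have := congr1 (fun M : 'M[C]_2 => complex.Im (M i j)) h1.
  rewrite !mxE; case: (G 1 (x, y) i j) => u v /= hv.
  lra.
by rewrite /Fhat imM_mul hX1 // h mulmx0 mul0mx addr0.
Qed.

End frame.

Theorem dpw_construction : exists (A : set (R * R)) (b : R * R -> R) (g : R * R -> 'M[R]_2)
    (X : R -> C -> 'M[C]_2) (Fh : R * R -> C -> 'M[C]_2),
  [/\ [/\ open A, A `<=` I `*` I, forall x, I x -> A (x, x)
        & forall p, A p -> g p 0 0 = 0 /\ g p 1 1 = 0],
      forall l, [/\ csmooth I (fun x => X x l), forall x, I x -> \det (X x l) = 1,
        forall x, I x -> cder (fun x => X x l) x 1 (X x l *m potential l x)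
        & X x0 l = toC A0],
      forall l, [/\ csmooth A (fun p => Fh p l),
        forall p, A p -> \det (Fh p l) = 1,
        forall p, A p -> cder (fun p => Fh p l) p (1, 0)
          (Fh p l *m (toC (b p *: e3) + l *: toC (be p.1)))
        & l != 0 -> forall p, A p -> cder (fun p => Fh p l) p (0, 1)
          (Fh p l *m (l^-1 *: toC (g p)))],
      forall l x, I x -> Fh (x, x) l = X x l
    & forall p, A p -> ((forall x, I x -> imM (X x 1) = 0) -> imM (Fh p 1) = 0) /\
      exists Hm Hp : C -> 'M[C]_2,
      [/\ G_sigma_minus_star Hm, G_sigma_plus Hp,
          forall l, `|l| = 1 -> (X p.1 l)^-1 * X p.2 l = Hm l * Hp l,
          forall l, 1 <= `|l| -> Fh p l = X p.1 l * Hm l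
        & forall l, l != 0 -> `|l| <= 1 -> Fh p l = X p.2 l * (Hp l)^-1]].
Proof.
have [phi [b [[sphi sb] dphi db phi_diag phi_le]]] := goursat_sol.
have [X hX] := potential_frame; have [G hG] := frame_x sb phi_le.
exists Om, b, (gam phi), X, (Fhat X G); split.
- split=> //; first by case=> x y [].
    by move=> x Ix; exact: strip_diag.
  by move=> p _; rewrite !mxE.
- exact hX.
- move=> l; split.
  + exact (Fhat_smooth hX hG l).
  + move=> p; exact (@Fhat_det b X hX G hG l p).
  + by case=> x y Op; exact (Fhat_dx X hG l Op).
  + move=> l0 p Op.
    exact (Fhat_dy dphi db phi_diag hX hG l0 Op).
- by move=> l x Ix; exact (Fhat_diag X hG l Ix).
- move=> p Op; split; first exact (Fhat_real hG Op).
  exact (factorization sphi sb dphi db phi_diag phi_le hX hG Op).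
Qed.

End construction.

(** * Brackets and conjugation in sl(2) *)

Section sl2_algebra.
Variable K : comUnitRingType.
Implicit Types A B : 'M[K]_2.

Lemma lie_e3 A : lie e3 A = mx2 0 (- (A 0 1 *+ 2)) (A 1 0 *+ 2) 0.
Proof.
rewrite -[lie e3 A]/(e3 *m A - A *m e3).
by apply: mx2P; rewrite [LHS]mxE [X in _ + X]mxE !mulmx2E !mxE /=; ring.
Qed.

(** The bracket of two elements of p lies in k, which commutes with [e3]. *)
Lemma lie_e3_lie A B : A 0 0 = 0 -> A 1 1 = 0 -> B 0 0 = 0 -> B 1 1 = 0 ->
  lie e3 (lie A B) = 0.
Proof.
move=> a0 a1 b0 b1; rewrite lie_e3.
have e i j : lie A B i j = A i 0 * B 0 j + A i 1 * B 1 j - (B i 0 * A 0 j + B i 1 * A 1 j).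
  by rewrite -!mulmx2E -[lie A B]/(A *m B - B *m A) [LHS]mxE [X in _ + X]mxE.
by rewrite !e a0 a1 b0 b1; apply: mx2P; rewrite !mxE /=; ring.
Qed.

Lemma lie_conj F A B : \det F = 1 ->
  lie (F *m A *m sharp F) (F *m B *m sharp F) = F *m lie A B *m sharp F.
Proof.
move=> dF; have h (M N : 'M[K]_2) :
    (F *m M *m sharp F) * (F *m N *m sharp F) = F *m (M *m N) *m sharp F.
  by rewrite -!mulmxE -!mulmxA [sharp F *m (F *m _)]mulmxA sharp_mul // mul1mx.
by rewrite /lie !h mulmxBr mulmxBl.
Qed.

End sl2_algebra.

Section real_calculus.
Context {R : realType} {V : normedModType R}.
Implicit Types (A : set V) (f : V -> 'M[R]_2).

(** The derivative of [Ad_F f] is [Ad_F (f' + [U, f])] if [F' = F U]. *)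
Lemma is_derive_conj F f p v (U D : 'M[R]_2) : \tr U = 0 ->
  is_derive p v F (F p *m U) -> is_derive p v f D ->
  is_derive p v (fun q => F q *m f q *m sharp (F q))
    (F p *m (D + lie U (f p)) *m sharp (F p)).
Proof.
move=> U0 dF df.
apply: is_derive_eq (is_derive_mulmx (is_derive_mulmx dF df) (is_derive_sharp dF)) _.
rewrite sharpM (sharpN U0) mulNmx mulmxN.
have -> : lie U (f p) = U *m f p - f p *m U by [].
rewrite !mulmxDr !mulmxN !mulmxDl !mulNmx !mulmxA.
by rewrite -addrA addrCA addrA.
Qed.

End real_calculus.

(** * The initial data and the harmonic map *)

Section initial_data.
Context {R : realType} (I : set R) (N0 N1 F : R -> 'M[R]_2).
Hypotheses (oI : open I) (sN0 : smooth I N0) (S21N0 : forall x, I x -> S21 (N0 x)).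
Hypotheses (sN1 : smooth I N1) (sl2N1 : forall x, I x -> sl2 (N1 x)).
Hypothesis N1N0 : forall x, I x -> sl2_form (N1 x) (N0 x) = 0.
Hypotheses (sF : smooth I F) (detF : forall x, I x -> \det (F x) = 1).
Hypothesis FN0 : forall x, I x -> Ad (F x) e3 = N0 x.

Definition kcoeff x : R := sl2_form ((F x)^-1 * derive1 F x) e3.

Let w x := sharp (F x) *m derive1 F x.

Let AdV x (M : 'M[R]_2) : I x -> Ad (F x)^-1 M = sharp (F x) *m M *m F x.
Proof. by move=> Ix; rewrite /Ad invrK sharp_inv ?detF. Qed.

Let N0E x : I x -> N0 x = F x *m e3 *m sharp (F x).
Proof. by move=> Ix; rewrite -FN0 // /Ad sharp_inv ?detF. Qed.

Let sl2_form_e3 (M : 'M[R]_2) : sl2_form M e3 = 2^-1 * (M 1 1 - M 0 0).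
Proof.
rewrite /sl2_form tr2; congr (_ * _); rewrite -[M * e3]/(M *m e3) !mulmx2E !mxE /=.
by ring.
Qed.

Let kcoeffE x : I x -> kcoeff x = 2^-1 * (w x 1 1 - w x 0 0).
Proof. by move=> Ix; rewrite /kcoeff sl2_form_e3 sharp_inv ?detF. Qed.

Let dF x : I x -> is_derive x (1 : R) F (derive1 F x).
Proof.
move=> Ix; rewrite derive1E.
exact (Ck_is_derive (1 : R) ((smoothP _ _).1 sF 1%N) Ix).
Qed.

Let Ck_derive1 n (f : R -> 'M[R]_2) : smooth I f -> Ck n I (derive1 f).
Proof.
move=> /smoothP/(_ n.+1)/(Ck_der (1 : R)) h.
by apply: (Ck_eq oI _ h) => p _; rewrite derive1E.
Qed.

Let Ck_w n : Ck n I w.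
Proof. exact (Ck_mulmx oI (Ck_sharp oI ((smoothP _ _).1 sF n)) (Ck_derive1 n sF)). Qed.

Lemma kcoeff_smooth : smooth I kcoeff.
Proof.
apply/smoothP => n; have h := (Ck_mxP _ _ oI).1 (Ck_w n).
apply: (Ck_eq oI _ (CkM oI (Ck_cst n (2^-1 : R) oI) (CkB oI (h 1 1) (h 0 0)))) => x Ix.
by rewrite kcoeffE.
Qed.

Let Ck_lie n (f : R -> 'M[R]_2) (a : R) : Ck n I f -> Ck n I (fun x => a *: lie e3 (f x)).
Proof.
move=> /(Ck_mxP _ _ oI) h; apply/(Ck_mxP _ _ oI) => i j.
have k0 := Ck_cst n (0 : R) oI; have c r := Ck_cst n (r : R) oI.
case: i => [[|[|//]] hi]; case: j => [[|[|//]] hj].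
- by apply: (Ck_eq oI _ k0) => p _; rewrite lie_e3 !mxE mulr0.
- apply: (Ck_eq oI _ (CkM oI (c (- (a * 2))) (h 0 1))) => p _; rewrite lie_e3 !mxE /=.
  by ring.
- apply: (Ck_eq oI _ (CkM oI (c (a * 2)) (h 1 0))) => p _; rewrite lie_e3 !mxE /=.
  by ring.
- by apply: (Ck_eq oI _ k0) => p _; rewrite lie_e3 !mxE mulr0.
Qed.

Let Ck_conj n (f : R -> 'M[R]_2) : Ck n I f -> Ck n I (fun x => sharp (F x) *m f x *m F x).
Proof.
have h := (smoothP _ _).1 sF n.
by move=> hf; exact (Ck_mulmx oI (Ck_mulmx oI (Ck_sharp oI h) hf) h).
Qed.

Lemma beta1_smooth : smooth I (beta1 N1 F).
Proof.
apply/smoothP => n.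
apply: (Ck_eq oI _ (Ck_lie (- 4^-1) (Ck_conj ((smoothP _ _).1 sN1 n)))) => x Ix.
by rewrite /beta1 AdV.
Qed.

Lemma gamma_m1_smooth : smooth I (gamma_m1 N0 N1 F).
Proof.
apply/smoothP => n; have h1 := (smoothP _ _).1 sN1 n.
have h : Ck n I (fun x => derive1 N0 x - N1 x).
  apply: (CkD oI (Ck_derive1 n sN0)); apply/(Ck_mxP _ _ oI) => i j.
  apply: (Ck_eq oI _ (CkN oI ((Ck_mxP _ _ oI).1 h1 i j))) => p _.
  by rewrite [RHS]mxE.
apply: (Ck_eq oI _ (Ck_lie (- 4^-1) (Ck_conj h))) => x Ix.
by rewrite /gamma_m1 AdV.
Qed.

Lemma beta1_off x : beta1 N1 F x 0 0 = 0 /\ beta1 N1 F x 1 1 = 0.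
Proof. by rewrite /beta1 lie_e3 !mxE /= mulr0. Qed.

Lemma gamma_m1_off x : gamma_m1 N0 N1 F x 0 0 = 0 /\ gamma_m1 N0 N1 F x 1 1 = 0.
Proof. by rewrite /gamma_m1 lie_e3 !mxE /= mulr0. Qed.

(** The derivative of [\det F = 1], as the trace of the adjugate of [F] times [F']. *)
Let w_tr x : I x -> \tr (w x) = 0.
Proof.
move=> Ix; have /is_derive_mxP h := dF Ix.
have hd := is_deriveB (is_deriveM (h 0 0) (h 1 1)) (is_deriveM (h 0 1) (h 1 0)).
have h1 : is_derive x (1 : R) ((fun q => F q 0 0) * (fun q => F q 1 1)
    - (fun q => F q 0 1) * (fun q => F q 1 0)) 0.
  apply: (near_eq_is_derive _ (is_derive_cst (1 : R) x (1 : R))).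
  apply: filterS (open_nbhs_nbhs (conj oI Ix)) => s Is.
  by rewrite -(detF Is) det2E.
have [_ <-] := h1; have [_ ->] := hd; rewrite tr2 /w !mulmx2E !mxE /=.
rewrite -[RHS]/(F x 0 0 * _ + F x 1 1 * _ - (F x 0 1 * _ + F x 1 0 * _)); ring.
Qed.

(** Obtained by differentiating [N0 = Ad_F e3]. *)
Let dN0 x : I x -> sharp (F x) *m derive1 N0 x *m F x = - lie e3 (w x).
Proof.
move=> Ix; have hF := dF Ix.
have Fw : derive1 F x = F x *m w x by rewrite /w mulmxA mul_sharp detF // mul1mx.
rewrite Fw in hF.
have h := is_derive_conj (w_tr Ix) hF (is_derive_cst (e3 : 'M[R]_2) x (1 : R)).
have h' : is_derive x (1 : R) N0 (F x *m (0 + lie (w x) e3) *m sharp (F x)).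
  apply: near_eq_is_derive h.
  by apply: filterS (open_nbhs_nbhs (conj oI Ix)) => s Is; rewrite N0E.
rewrite derive1E (@derive_val _ _ _ _ _ _ _ h') add0r.
rewrite !mulmxA sharp_mul ?detF // mul1mx -mulmxA sharp_mul ?detF // mulmx1.
by rewrite /lie opprB.
Qed.

(** On p the square of ad e3 is 4, which explains the factor 1/4: [beta1 + gamma_m1] is [-1/4
    [e3, Ad_F^-1 N0']], that is [1/4 [e3, [e3, w]]], the p-part of [w = F^-1 F']. *)
Lemma frame_decomposition x : I x ->
  derive1 F x = F x *m (kcoeff x *: e3 + beta1 N1 F x + gamma_m1 N0 N1 F x).
Proof.
move=> Ix; have Fw : derive1 F x = F x *m w x by rewrite /w mulmxA mul_sharp detF // mul1mx.
rewrite {}Fw; congr (_ *m _); have wt := w_tr Ix; rewrite tr2 in wt.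
have e : sharp (F x) *m (derive1 N0 x - N1 x) *m F x = - lie e3 (w x) - sharp (F x) *m N1 x *m F x.
  by rewrite mulmxBr mulmxBl dN0.
rewrite /beta1 /gamma_m1 !AdV // e kcoeffE // !lie_e3.
move: (sharp (F x) *m N1 x *m F x) (w x) wt => M v wt.
by apply: mx2P; rewrite !mxE /=; lra.
Qed.

(** Again by [(ad e3)^2 = 4] the left side is the p-part of [Ad_F^-1 N1]; orthogonality of [N1] and
    [N0] says that its k-part vanishes. *)
Lemma lie_beta1 x : I x -> - lie e3 (beta1 N1 F x) = sharp (F x) *m N1 x *m F x.
Proof.
move=> Ix; rewrite /beta1 AdV // !lie_e3.
set M := sharp (F x) *m N1 x *m F x.
have M0 : M 0 0 + M 1 1 = 0.
  rewrite -tr2 /M mxtrace_mulC mulmxA mul_sharp detF // mul1mx; exact: sl2N1.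
have M1 : M 1 1 - M 0 0 = 0.
  have e : sl2_form (N1 x) (N0 x) = sl2_form M e3.
    rewrite N0E // /sl2_form; congr (_ * _); rewrite -[N1 x * _]/(N1 x *m _).
    by rewrite mulmxA mxtrace_mulC !mulmxA.
  by have := N1N0 Ix; rewrite e sl2_form_e3 => h; lra.
by clearbody M; apply: mx2P; rewrite !mxE /=; lra.
Qed.

End initial_data.

(** * The harmonic map of a frame *)

Section harmonic_frame.
Context {R : realType} (A : set (R * R)) (F g : R * R -> 'M[R]_2).
Variables (b : R * R -> R) (be : R -> 'M[R]_2).
Hypotheses (oA : open A) (sF : smooth A F) (detF : forall p, A p -> \det (F p) = 1).
Hypothesis be_off : forall p, A p -> be p.1 0 0 = 0 /\ be p.1 1 1 = 0.
Hypothesis g_off : forall p, A p -> g p 0 0 = 0 /\ g p 1 1 = 0.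
Hypothesis dFx : forall p, A p -> is_derive p (1, 0) F (F p *m (b p *: e3 + be p.1)).
Hypothesis dFy : forall p, A p -> is_derive p (0, 1) F (F p *m g p).

Definition frame_map p := F p *m e3 *m sharp (F p).

Lemma dx_frame_map p : A p ->
  dx frame_map p = F p *m (- lie e3 (be p.1)) *m sharp (F p).
Proof.
move=> Ap; have [h1 h2] := be_off Ap.
have t0 : \tr (b p *: e3 + be p.1) = 0 by rewrite tr2 !mxE /= h1 h2; ring.
have h := is_derive_conj t0 (dFx Ap) (is_derive_cst (e3 : 'M[R]_2) p (1, 0)).
rewrite /dx (@derive_val _ _ _ _ _ _ _ h) add0r; congr (_ *m _ *m _).
have -> : lie (b p *: e3 + be p.1) e3 = - lie e3 (b p *: e3 + be p.1) by rewrite /lie opprB.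
by rewrite !lie_e3; apply: mx2P; rewrite !mxE /=; ring.
Qed.

(** As [be] depends on x alone, only the conjugation by [F] is differentiated in y. *)
Lemma dydx_frame_map p : A p -> dy (dx frame_map) p =
  F p *m lie (g p) (- lie e3 (be p.1)) *m sharp (F p).
Proof.
case: p => x y Ap; have [h1 h2] := g_off Ap.
have t0 : \tr (g (x, y)) = 0 by rewrite tr2 h1 h2 addr0.
have hc : is_derive (x, y) ((0, 1) : R * R) (fun p => - lie e3 (be p.1)) 0.
  by apply/is_derive_snd_mx; exact (is_derive_cst (- lie e3 (be x)) y (1 : R)).
have h := is_derive_conj t0 (dFy Ap) hc.
have h' : is_derive (x, y) ((0, 1) : R * R) (dx frame_map)
    (F (x, y) *m (0 + lie (g (x, y)) (- lie e3 (be x))) *m sharp (F (x, y))).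
  apply: near_eq_is_derive h.
  by apply: filterS (open_nbhs_nbhs (conj oA Ap)) => q Aq; rewrite dx_frame_map.
by rewrite /dy (@derive_val _ _ _ _ _ _ _ h') add0r.
Qed.

Lemma frame_map_harmonic : harmonic_map A frame_map.
Proof.
split.
- apply/smoothP => n; have h := (smoothP _ _).1 sF n.
  exact (Ck_mulmx oA (Ck_mulmx oA h (Ck_cst n (e3 : 'M[R]_2) oA)) (Ck_sharp oA h)).
- move=> p Ap; have hc : sharp (F p) *m F p = 1%:M by rewrite sharp_mul ?detF.
  have e33 : e3 *m e3 = 1%:M :> 'M[R]_2 by exact: e3_sqr.
  split.
    rewrite /sl2 /= /frame_map mxtrace_mulC mulmxA hc mul1mx tr2 !mxE /=; ring.
  rewrite /sl2_form -[_ * frame_map p]/(frame_map p *m frame_map p).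
  rewrite /frame_map -!mulmxA [sharp _ *m (F p *m _)]mulmxA hc mul1mx [e3 *m (e3 *m _)]mulmxA.
  by rewrite e33 mul1mx mul_sharp detF // mxtrace1 mulVf.
- move=> p Ap; have [h1 h2] := g_off Ap; have [h3 h4] := be_off Ap.
  (* Up to conjugation by [F] this is the bracket of [e3] with a bracket of two elements of p. *)
  rewrite dydx_frame_map // lie_conj ?detF // lie_e3_lie ?mulmx0 ?mul0mx //;
    by rewrite lie_e3 !mxE oppr0.
Qed.

End harmonic_frame.

Lemma toC_e3 (R : realType) : toC (e3 : 'M[R]_2) = e3.
Proof. by apply: mx2P; rewrite !mxE //= rmorphN1. Qed.

Lemma toC_sharp (R : realType) (A : 'M[R]_2) : toC (sharp A) = sharp (toC A).
Proof. by apply: mx2P; rewrite !mxE //= rmorphN. Qed.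

Lemma in_p_off (R : realType) (A : 'M[R]_2) : A 0 0 = 0 -> A 1 1 = 0 -> in_p A.
Proof.
move=> h0 h1; exists (2^-1 * (A 1 0 - A 0 1)), (2^-1 * (A 0 1 + A 1 0)).
by apply: mx2P; rewrite !mxE /= ?h0 ?h1; lra.
Qed.

Theorem theorem4p10 (R : realType) (I : set R) (N0 N1 F : R -> 'M[R]_2)
    (x0 : R)
    (I_open : open I) (I_itv : is_interval I)
    (N0_smooth : smooth I N0) (N0_S21 : forall x, I x -> S21 (N0 x))
    (N1_smooth : smooth I N1) (N1_sl2 : forall x, I x -> sl2 (N1 x))
    (N1_N0 : forall x, I x -> sl2_form (N1 x) (N0 x) = 0)
    (F_smooth : smooth I F) (F_SL2 : forall x, I x -> \det (F x) = 1)
    (F_N0 : forall x, I x -> Ad (F x) e3 = N0 x)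
    (x0_I : I x0) :
  exists (Omega : set (R * R)) (nu : R * R -> 'M[R]_2),
    [/\ [/\ open Omega, Omega `<=` I `*` I & forall x, I x -> Omega (x, x)],
        harmonic_map Omega nu,
        forall x, I x -> nu (x, x) = N0 x /\ dx nu (x, x) = N1 x
      & exists (X Y : R -> R[i] -> 'M[R[i]]_2)
          (Fh : R * R -> R[i] -> 'M[R[i]]_2),
          [/\ dpw I x0 (alpha_hat N0 N1 F) (alpha_hat N0 N1 F) (F x0) (F x0)
                Omega X Y Fh nu,
              extended_frame Omega nu Fh
            & forall x, I x -> forall l : R[i], l != 0 ->
                Fh (x, x) l = X x l]].
Proof.
have be_off (x : R) (_ : I x) := beta1_off N1 F x.
have ga_off (x : R) (_ : I x) := gamma_m1_off N0 N1 F x.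
have [A [b [g [X [Fh [[oA AI Adiag gA] hX hF Fdiag hA]]]]]] := dpw_construction I_open I_itv x0_I
  (kcoeff_smooth I_open F_smooth F_SL2) (beta1_smooth I_open N1_smooth F_smooth F_SL2)
  (gamma_m1_smooth I_open N0_smooth N1_smooth F_smooth F_SL2) be_off ga_off (F_SL2 _ x0_I).
(* At [l = 1] the potential is [F^-1 F'], so [X] and [F] solve the same equation with the same value
   at [x0]. *)
have X1 x : I x -> X x 1 = toC (F x).
  move=> Ix; have [_ dX X' X0] := hX 1.
  have sI s : seg x0 x s -> I s by case/orP; [exact: I_itv x0_I Ix _|exact: I_itv Ix x0_I _].
  have pot s : I s -> potential (kcoeff F) (beta1 N1 F) (gamma_m1 N0 N1 F) 1 s =
      toC (kcoeff F s *: e3 + beta1 N1 F s + gamma_m1 N0 N1 F s).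
    by move=> _; rewrite /potential invr1 !scale1r -!map_mxD.
  apply: (sl2_ode_unique (x0 := x0) (E1 := fun x => X x 1) (E2 := fun x => toC (F x))
    (a := potential (kcoeff F) (beta1 N1 F) (gamma_m1 N0 N1 F) 1)).
  - move=> s /sI Is; have [h1 h2] := be_off s Is; have [h3 h4] := ga_off s Is.
    rewrite pot // trace_map_mx -(rmorph0 (real_complex R)); congr (_%:C).
    move: (beta1 N1 F s) (gamma_m1 N0 N1 F s) h1 h2 h3 h4 => B G h1 h2 h3 h4.
    by rewrite tr2 !mxE /= h1 h2 h3 h4; ring.
  - by move=> s /sI; exact: X'.
  - move=> s /sI Is; rewrite pot // -toC_mul -(frame_decomposition N1 I_open F_smooth F_SL2 F_N0) //.
    by apply: cder_toC; rewrite derive1E;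
      exact (Ck_is_derive (1 : R) ((smoothP _ _).1 F_smooth 1%N) Is).
  - by rewrite det_map_mx F_SL2 ?rmorph1.
  - exact: X0.
have AX : alpha_hat N0 N1 F = potential (kcoeff F) (beta1 N1 F) (gamma_m1 N0 N1 F) by [].
(* At [l = 1] the extended frame is real; its real part is the frame of [nu]. *)
pose Fr p := reM (Fh p 1).
have Fr1 p : A p -> Fh p 1 = toC (Fr p).
  move=> Ap; have [h _] := hA p Ap; apply: eq_reim; rewrite ?reM_toC // imM_toC; apply: h.
  by move=> x Ix; rewrite X1 // imM_toC.
have [sFh dFh Fhx Fhy] := hF 1.
have detFr p : A p -> \det (Fr p) = 1.
  move=> Ap; have := dFh p Ap; rewrite Fr1 // det_map_mx -(rmorph1 (real_complex R)).
  exact: complexI.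
have Frx p : A p -> is_derive p (1, 0) Fr (Fr p *m (b p *: e3 + beta1 N1 F p.1)).
  move=> Ap; have [h _] := Fhx p Ap; apply: is_derive_eq h _.
  by rewrite Fr1 // scale1r -map_mxD -toC_mul reM_toC.
have Fry p : A p -> is_derive p (0, 1) Fr (Fr p *m g p).
  move=> Ap; have [h _] := Fhy (oner_neq0 _) p Ap; apply: is_derive_eq h _.
  by rewrite Fr1 // invr1 scale1r -toC_mul reM_toC.
have sFr : smooth A Fr by case: sFh.
have Abe p : A p -> beta1 N1 F p.1 0 0 = 0 /\ beta1 N1 F p.1 1 1 = 0 by move=> _; exact: beta1_off.
have solX : solves I x0 (alpha_hat N0 N1 F) (F x0) X.
  move=> l l0; have [h1 h2 h3 h4] := hX l; split=> // x Ix.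
  rewrite (cder_val (h3 x Ix)) sharp_inv ?h2 // -[LHS]/(sharp (X x l) *m _).
  by rewrite mulmxA sharp_mul ?h2 // mul1mx AX.
exists A, (frame_map Fr); split=> //.
- exact: (frame_map_harmonic oA sFr detFr Abe gA Frx Fry).
- move=> x Ix; have Ax := Adiag x Ix.
  have Frd : Fr (x, x) = F x by rewrite /Fr Fdiag // X1 // reM_toC.
  split; first by rewrite /frame_map Frd -F_N0 // /Ad sharp_inv ?F_SL2.
  (* On the diagonal [nu_x] is [Ad_F (- [e3, beta1])], and the bracket gives back [Ad_F^-1 N1]. *)
  rewrite (dx_frame_map Abe Frx Ax) Frd (lie_beta1 N1_sl2 N1_N0 F_SL2 F_N0 Ix).
  by rewrite !mulmxA mul_sharp F_SL2 // mul1mx -mulmxA mul_sharp F_SL2 // mulmx1.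
(* The two potentials and the two initial values agree, so [X] also serves as [Y]. *)
exists X, X, Fh; split.
- split=> //; first by move=> p Ap; have [] := hA p Ap.
  move=> p Ap; rewrite Fr1 // /Ad sharp_inv ?det_map_mx ?detFr ?rmorph1 //.
  by rewrite /frame_map !toC_mul toC_e3 toC_sharp.
(* The witness 0 for the k-part in y is the gauge [gamma_0 = 0]. *)
- exists Fr, (fun p => b p *: e3), (fun p => beta1 N1 F p.1), (fun=> 0), g; split.
  + split=> // p Ap; split; first exact: detFr.
    by rewrite /Ad sharp_inv ?detFr.
  + exact: Fr1.
  + move=> p Ap; split; first by exists (b p).
      by have [] := Abe p Ap; exact: in_p_off.
    rewrite /dx (@derive_val _ _ _ _ _ _ _ (Frx p Ap)) sharp_inv ?detFr //.
    by rewrite -[LHS]/(sharp (Fr p) *m _) mulmxA sharp_mul ?detFr // mul1mx.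
  + move=> p Ap; split; first by exists 0; rewrite scale0r.
      by have [] := gA p Ap; exact: in_p_off.
    rewrite /dy (@derive_val _ _ _ _ _ _ _ (Fry p Ap)) sharp_inv ?detFr //.
    by rewrite add0r -[LHS]/(sharp (Fr p) *m _) mulmxA sharp_mul ?detFr // mul1mx.
  + move=> l l0; have [h1 h2 h3 h4] := hF l; split=> // p Ap.
    split; first exact: h2.
      rewrite (cder_val (h3 p Ap)) sharp_inv ?h2 //.
      by rewrite -[LHS]/(sharp (Fh p l) *m _) mulmxA sharp_mul ?h2 // mul1mx.
    rewrite (cder_val (h4 l0 p Ap)) sharp_inv ?h2 //.
    rewrite -[LHS]/(sharp (Fh p l) *m _) mulmxA sharp_mul ?h2 // mul1mx.
    have -> : toC (0 : 'M[R]_2) = 0 by apply/matrixP => i j; rewrite !mxE.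
    by rewrite add0r.
- by move=> x Ix l _; exact: Fdiag.
Qed.
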